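(* Let $n\in\mathbb N$ and let $\nu$ be a strongly connected multi-type Galton--Watson measure whose types are the elements of $[n]$. Then there exists a probability measure $\mu$ on $\mathbf T_n$ that is reversible for simple random walk and satisfies $\mu\sim_g\nu$ if and only if there are numbers $\{p_{i,j}: i,j\in[n]\}$ in $[0,1]$ with $\sum_{j}p_{i,j}=1$ for every $i$ such that: (a) for all $i\in[n]$ and $d\in D(\nu_i)$, given that the number of children of the root is $d$, the $\nu_i$-offspring distribution of the root is multinomial with parameters $\{p_{i,j}: j\in[n]\}$ (which do not depend on $d$); and (b) $$\prod_{s=1}^{m-1}\frac{p_{i_s,i_{s+1}}}{p_{i_{s+1},i_s}}=1$$ for all $i_1,\dots,i_m\in[n]$ with $i_m=i_1$ such that $p_{i_s,i_{s+1}}>0$ for all $s\in\{1,\dots,m-1\}$. In this case the reversible measure $\mu$ with $\mu\sim_g\nu$ is unique; for all $i\in[n]$, $d+1\in D(\mu_i)$ if and only if $d\in D(\nu_i)$, and, given that the root has label $i$, the $\mu_i$-probability that the root has degree $d+1$ equals the $\nu_i$-probability that the root has $d$ children; and the probabilities $\mu(i)$ of the label of the root are given by the solution of $$\frac{\mu(i)}{\mu(j)}=\frac{p_{j,i}}{p_{i,j}}\quad(\text{for } i,j\in[n]\text{ with }p_{i,j}>0),\qquad \sum_{i=1}^n\mu(i)=1 .$$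
   Context: Notation. $[n]=\{1,\dots,n\}$; $\mathbf S_n=\{(c_1,\dots,c_n): c_i\in\mathbb N\cup\{0\}\}$; $|\mathbf c|=\sum_i c_i$. $\mathbf T_n$ is the set of isomorphism classes (root-, adjacency- and label-preserving) of locally finite rooted trees $(T,o)$ whose vertices are labeled by elements of $[n]$, with the $\sigma$-field generated by the events ''the restriction of $(T,o)$ to vertices at distance at most $h$ from $o$ is isomorphic to a given finite labeled rooted tree of height $h$''. Children of the root are its neighbors; the parent of $x\ne o$ is its neighbor on the path to $o$, its other neighbors are its children. For a probability measure $\mu$ on $\mathbf T_n$: $\mu(i)$ is the $\mu$-probability that the root has label $i$, and $\mu_i(\mathbf c)$ is the conditional probability, given that the root has label $i$, that for every $j$ the root has exactly $c_j$ neighbors with label $j$. $\nu$ is a multi-type Galton--Watson measure with type set $[n]$; $\nu_i(\mathbf c)$ is the probability that a vertex of type $i$ has exactly $c_j$ children of type $j$ for every $j\in[n]$; given their types, vertices reproduce independently. $\nu$ is strongly connected if for all $i,j\in[n]$ the root has type $i$ with positive probability and, given that the root has type $i$, the tree contains a vertex of type $j$ with positive probability. For a probability measure $\rho$ on $\mathbf S_n$ (such as $\mu_i$ or $\nu_i$), $D(\rho)=\{d:\exists\,\mathbf c\text{ with }|\mathbf c|=d,\ \rho(\mathbf c)>0\}$. A probability measure on $\{\mathbf c\in\mathbf S_n:|\mathbf c|=d\}$ is multinomial with parameters $p_1,\dots,p_n\in[0,1]$, $\sum_kp_k=1$, if $\mathbf c$ has probability $\frac{d!}{\prod_kc_k!}\prod_kp_k^{c_k}$.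 $\mu\sim_g\nu$ means that under $\mu$, conditionally on the labels of the root and of its neighbors, the descendant subtrees rooted at the neighbors of the root are independent, and the one rooted at a neighbor with label $j$ is a Galton--Watson tree with the offspring distributions of $\nu$ started from a vertex of type $j$, the type of a vertex being its label. Simple random walk on $\mathbf T_n$ moves from $(T,o)$ to $(T,o')$ with $o'$ a uniformly chosen neighbor of $o$; $\mathbf P((T,o)\to A)$ is the probability that one step leads into $A$. $\mu$ is reversible if $\int_A\mathbf P((T,o)\to B)\,d\mu=\int_B\mathbf P((T,o)\to A)\,d\mu$ for all measurable $A,B\subset\mathbf T_n$. Convention: the root has at least one neighbor $\mu$-a.s. (so that simple random walk is defined). *)

(* Defs.v *)
From HB Require Import structures.
From mathcomp Require Import all_boot all_order all_algebra generic_quotient.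
From mathcomp Require Import all_classical all_reals all_analysis.

Set Implicit Arguments.
Unset Strict Implicit.
Unset Printing Implicit Defensive.
Import Order.TTheory GRing.Theory Num.Theory.
Local Open Scope quotient_scope.
Local Open Scope classical_set_scope.
Local Open Scope ring_scope.

(* Every natural number [n >= 1] is written as [n.+1], and the label set is
['I_n.+1].  A locally finite rooted tree is encoded by the Ulam-Harris-Neveu
words: the root is the empty word, the children of the vertex [u] are the words
[rcons u k] with [k < nchild u].  Any two functions [nchild] and [label] define
such a tree (their values outside of the vertex set are irrelevant), and every
locally finite rooted tree is isomorphic to one of this form.  The order of the
children is forgotten below, when passing to isomorphism classes. *)

Record plane_tree (n : nat) := PlaneTree {
  nchild : seq nat -> nat;
  label : seq nat -> 'I_n.+1
}.

HB.instance Definition _ n := gen_eqMixin (plane_tree n).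
HB.instance Definition _ n := gen_choiceMixin (plane_tree n).
HB.instance Definition _ n := isPointed.Build (plane_tree n)
  (PlaneTree (fun=> 0%N) (fun=> ord0)).

Section Isomorphism.
Variable n : nat.
Implicit Types S T : plane_tree n.

Definition subtree T k : plane_tree n :=
  PlaneTree (fun u => nchild T (k :: u)) (fun u => label T (k :: u)).

Fixpoint vertex T (u : seq nat) : bool :=
  if u is k :: v then (k < nchild T [::])%N && vertex (subtree T k) v else true.

Definition vertices T : set (seq nat) := [set u | vertex T u].

Definition adjacent (u v : seq nat) : Prop :=
  exists k, v = rcons u k \/ u = rcons v k.

(* The graph T rooted at its vertex x and the graph S rooted at y are
   isomorphic as labelled rooted trees. *)
Definition pointed_iso T x S y : Prop :=
  exists f : seq nat -> seq nat,
    [/\ set_bij (vertices T) (vertices S) f,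
        (forall u v, vertices T u -> vertices T v ->
           (adjacent u v <-> adjacent (f u) (f v))),
        (forall u, vertices T u -> label S (f u) = label T u)
      & f x = y].

Definition tree_iso S T : Prop := pointed_iso S [::] T [::].

Lemma tree_iso_refl T : tree_iso T T.
Proof. by exists id; split=> //; split=> // u Tu; exists u. Qed.

Lemma tree_iso_sym S T : tree_iso S T -> tree_iso T S.
Proof.
move=> [f [fb fadj flab f0]].
have [fh fi fs] := fb.
have ex v : {u | vertices T v -> vertices S u /\ f u = v}.
  apply: cid; have [Tv|nTv] := pselect (vertices T v); last by exists [::].
  by have [u Su <-] := fs v Tv; exists u.
pose g v := sval (ex v).
have gP v : vertices T v -> vertices S (g v) /\ f (g v) = v by exact: (svalP (ex v)).
have fK u : vertices S u -> g (f u) = u.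
  move=> Su; have [h1 h2] := gP _ (fh _ Su).
  by apply: fi => //; rewrite inE.
exists g; split.
- split.
  + by move=> v /gP[].
  + move=> v w; rewrite !inE => /gP[_ hv] /gP[_ hw] e.
    by rewrite -hv -hw e.
  + by move=> u Su; exists (f u); [exact: fh | exact: fK].
- move=> u v /gP[Su hu] /gP[Sv hv]; apply: iff_sym.
  by have := fadj _ _ Su Sv; rewrite hu hv.
- by move=> u /gP[Su hu]; rewrite -(flab _ Su) hu.
- by rewrite -f0 fK.
Qed.

Lemma tree_iso_trans S T U : tree_iso S T -> tree_iso T U -> tree_iso S U.
Proof.
move=> [f [fb fadj flab f0]] [g [gb gadj glab g0]].
exists (g \o f); have [fh _ _] := fb; split.
- exact: set_bij_comp fb gb.
- move=> u v Su Sv; rewrite (fadj _ _ Su Sv).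
  exact: gadj (fh _ Su) (fh _ Sv).
- by move=> u Su; rewrite /= (glab _ (fh _ Su)) flab.
- by rewrite /= f0.
Qed.

Definition tree_isob S T : bool := `[< tree_iso S T >].

Lemma tree_isob_equiv : equiv_class_of tree_isob.
Proof.
split.
- by move=> T; apply/asboolP/tree_iso_refl.
- by move=> S T; apply/asboolP/asboolP; exact: tree_iso_sym.
- move=> T S U /asboolP ST /asboolP TU; apply/asboolP.
  exact: tree_iso_trans ST TU.
Qed.

Canonical tree_iso_equiv := EquivRelPack tree_isob_equiv.

Definition tree_class := {eq_quot tree_iso_equiv}.
HB.instance Definition _ := Choice.on tree_class.
HB.instance Definition _ := EqQuotient.on tree_class.
HB.instance Definition _ := isPointed.Build tree_class (\pi_tree_class point).

Definition tree_ball (h : nat) T : plane_tree n :=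
  PlaneTree (fun u => if (size u < h)%N then nchild T u else 0%N) (label T).

(* A plane tree S of height more than h contributes only the empty set. *)
Definition cylinders : set_system tree_class :=
  [set A | exists h S, A = [set t | tree_iso (tree_ball h (repr t)) S]].

End Isomorphism.

Definition trees (n : nat) := g_sigma_algebraType (@cylinders n).
HB.instance Definition _ n := Measurable.on (trees n).

Definition class_of_tree n (T : plane_tree n) : trees n := \pi_(tree_class n) T.
Definition repr_tree n (t : trees n) : plane_tree n := repr (t : tree_class n).

Definition counts (n : nat) := {ffun 'I_n.+1 -> nat}.

Definition csize n (c : counts n) : nat := (\sum_j c j)%N.

Section Functionals.
Variable n : nat.
Implicit Types (t : trees n) (i j : 'I_n.+1) (c : counts n).

Definition root_label t : 'I_n.+1 := label (repr_tree t) [::].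

Definition root_degree t : nat := nchild (repr_tree t) [::].

Definition root_counts t : counts n :=
  [ffun j => #|[set k : 'I_(root_degree t)
                | label (repr_tree t) [:: val k] == j]|].

Definition root_is i : set (trees n) := [set t | root_label t = i].

Definition root_counts_are c : set (trees n) := [set t | root_counts t = c].

Definition has_label j : set (trees n) :=
  [set t | exists2 u, vertices (repr_tree t) u & label (repr_tree t) u = j].

(* The class of the graph T rooted at x: such an S exists for every vertex x of
   T, and is unique up to isomorphism. *)
Definition rerooted (T : plane_tree n) (x : seq nat) : trees n :=
  class_of_tree (get [set S | pointed_iso T x S [::]]).

(* The types of the children of a vertex with offspring vector c; the order in
   which they are listed does not affect isomorphism classes. *)
Definition child_types c : seq 'I_n.+1 :=
  flatten [seq nseq (c j) j | j <- enum 'I_n.+1].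

(* The tree whose root has label i and descendant subtrees ts at its
   neighbours. *)
Definition graft i (ts : seq (trees n)) : trees n :=
  class_of_tree (PlaneTree
    (fun u => if u is k :: v then nchild (repr_tree (nth point ts k)) v
              else size ts)
    (fun u => if u is k :: v then label (repr_tree (nth point ts k)) v
              else i)).

(* The type of the individual u in the genealogy started from an individual of
   type i, when any individual u of type j has offspring vector xi (u, j). *)
Fixpoint gw_type i (xi : seq nat * 'I_n.+1 -> counts n) (u : seq nat) :=
  if u is k :: v then
    gw_type (nth i (child_types (xi ([::], i))) k)
            (fun wj => xi (k :: wj.1, wj.2)) v
  else i.

Definition gw_tree i (xi : seq nat * 'I_n.+1 -> counts n) : trees n :=
  class_of_tree (PlaneTree (fun u => csize (xi (u, gw_type i xi u)))
                           (gw_type i xi)).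

End Functionals.

Section Laws.
Variables (R : realType) (n : nat).
Implicit Types (i j : 'I_n.+1) (c : counts n) (d : nat).
Implicit Types (q : 'I_n.+1 -> counts n -> R) (mu nu : probability (trees n) R).

Definition cprob disp (Om : measurableType disp) (P : probability Om R)
  (A B : set Om) : R := fine (P (A `&` B)) / fine (P B).

(* root_prob mu i is mu(i) and root_law mu i c is mu_i(c), written out. *)
Definition root_prob mu i : R := fine (mu (root_is i)).

Definition root_law mu i c : R := cprob mu (root_counts_are c) (root_is i).

(* M plays the role of the sigma-field of U; it is setT for discrete U. *)
Definition independent disp (Om : measurableType disp) (P : probability Om R)
    (I : eqType) (U : Type) (M : set_system U) (X : I -> Om -> U) : Prop :=
  forall (s : seq I) (B : I -> set U), uniq s -> (forall a, M (B a)) ->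
    fine (P (\bigcap_(a in [set` s]) (X a @^-1` B a))) =
    \prod_(a <- s) fine (P (X a @^-1` B a)).

(* lam is the law of the Galton-Watson tree with offspring distributions q
   started from a vertex of type i: it is built from independent offspring
   vectors xi (u, j), where xi (u, j) has law q j and is used if the individual
   u has type j. *)
Definition GW_from q i (lam : set (trees n) -> R) : Prop :=
  exists (disp : measure_display) (Om : measurableType disp) (P : probability Om R)
         (xi : seq nat * 'I_n.+1 -> Om -> counts n),
    [/\ (forall uj B, measurable (xi uj @^-1` B)),
        (forall uj c, P (xi uj @^-1` [set c]) = (q uj.2 c)%:E),
        independent P setT xi
      & forall A, measurable A ->
          lam A = fine (P [set w | A (gw_tree i (fun uj => xi uj w))])].

Definition GW q nu : Prop := forall i, (0 < nu (root_is i))%E ->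
  GW_from q i (fun A => cprob nu A (root_is i)).

Definition strongly_connected nu : Prop := forall i j,
  (0 < nu (root_is i))%E /\ 0 < cprob nu (has_label j) (root_is i).

(* mu ~_g nu involves nu only through its offspring distributions q.
   Conditionally on its root having label i and c j neighbours of label j for
   every j, the tree has the law of the tree obtained by grafting on a root with
   label i independent Galton-Watson trees started from the types listed in
   child_types c. *)
Definition sim_g mu q : Prop :=
  forall i c, (0 < mu (root_is i `&` root_counts_are c))%E ->
  exists (disp : measure_display) (Om : measurableType disp) (P : probability Om R)
         (X : 'I_(size (child_types c)) -> Om -> trees n),
    [/\ (forall k, measurable_fun setT (X k)),
        independent P measurable X,
        (forall k, GW_from q (tnth (in_tuple (child_types c)) k)
                     (fun A => fine (P (X k @^-1` A))))
      & forall A, measurable A ->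
          cprob mu A (root_is i `&` root_counts_are c) =
          fine (P [set w | A (graft i [seq X k w | k <- enum 'I_(size (child_types c))])])].

Definition walk (t : trees n) (A : set (trees n)) : R :=
  (\sum_(k < root_degree t) \1_A (rerooted (repr_tree t) [:: val k]))
    / (root_degree t)%:R.

Definition walk_defined mu : Prop := mu [set t | root_degree t = 0%N] = 0%E.

Definition reversible mu : Prop :=
  forall A B : set (trees n), measurable A -> measurable B ->
    (\int[mu]_(t in A) (walk t B)%:E = \int[mu]_(t in B) (walk t A)%:E)%E.

Definition size_prob (rho : counts n -> R) d : R :=
  \sum_(c \in [set c : counts n | csize c = d]) rho c.

Definition sizes (rho : counts n -> R) : set nat :=
  [set d | exists c, csize c = d /\ 0 < rho c].

Definition multinomial d (p : 'I_n.+1 -> R) (rho : counts n -> R) : Prop :=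
  forall c, csize c = d ->
    rho c = (d`!)%:R / (\prod_k (c k)`!)%:R * \prod_k p k ^+ c k.

Definition stochastic (p : 'I_n.+1 -> 'I_n.+1 -> R) : Prop :=
  (forall i j, 0 <= p i j <= 1) /\ (forall i, \sum_j p i j = 1).

Definition multinomial_offspring q p : Prop :=
  forall i d, d \in sizes (q i) ->
    multinomial d (p i) (fun c => q i c / size_prob (q i) d).

(* A cycle with p (x s.+1) (x s) = 0 for some s, for which the quotient makes no
   sense, violates this condition: the product is then 0. *)
Definition cycle_condition (p : 'I_n.+1 -> 'I_n.+1 -> R) : Prop :=
  forall (m : nat) (x : nat -> 'I_n.+1), x m = x 0%N ->
    (forall s, (s < m)%N -> 0 < p (x s) (x s.+1)) ->
    \prod_(0 <= s < m) (p (x s) (x s.+1) / p (x s.+1) (x s)) = 1.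

Definition root_system (p : 'I_n.+1 -> 'I_n.+1 -> R) (x : 'I_n.+1 -> R) : Prop :=
  (forall i j, 0 < p i j -> x i / x j = p j i / p i j) /\ \sum_i x i = 1.

End Laws.

(* Main.v *)
(* Let lam_i (gw_law) be the law of the Galton-Watson tree started from type i, and
   gam_(i,c) (star_law) the law of a root of type i with c j independent trees of
   law lam_j below it, for every j.  Then mu ~_g nu says that mu is a mixture of the
   gam_(i,c), with weights w(i,c), while lam_i is their mixture with weights q_i(c).

   A tree together with an edge at its root is a pair of trees, the two sides of
   the edge, and a step of the walk along this edge exchanges the two sides.  Under
   gam_(i,c), the sides of an edge leading to type j are independent with laws
   gam_(i,c-e_j) and lam_j, so that the flow of the walk from A to B is
     sum_(i,c,j) w(i,c) c_j/|c| (gam_(i,c-e_j) x lam_j)(edges from A to B).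
   If mu is reversible, testing this on the label and the neighbours of the root
   yields a symmetric matrix kap with w(i,c) c_j/|c| = kap_(i,j) q_i(c-e_j); here
   kap_(i,j) is mu(i) p_(i,j), and comparing two indices j shows that q_i is
   multinomial given its size.  Conversely, if these relations hold, then the flow
   is sum_(i,j) kap_(i,j) (lam_i x lam_j)(edges from A to B), which is symmetric in
   A and B.  The cycle condition makes mu(i) p_(i,j) = mu(j) p_(j,i) solvable.

   Measurability and uniqueness rest on the balls around the root: there are only
   countably many of them up to isomorphism, and they generate the sigma-field. *)
From HB Require Import structures.
From mathcomp Require Import all_boot all_order all_algebra generic_quotient.
From mathcomp Require Import all_classical all_reals all_analysis measurable_realfun zify ring.
Require Import Defs.
Set Implicit Arguments.
Unset Strict Implicit.
Unset Printing Implicit Defensive.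
Import Order.TTheory GRing.Theory Num.Theory.
Local Open Scope classical_set_scope.
Local Open Scope ring_scope.


(** * Isomorphisms of rooted trees and codes of balls *)

(** Isomorphism classes forget the order of the children, whereas a Galton-Watson tree lists them by
    increasing type. Hence deleting a child from the list of c has to give exactly the list of c-e_j
    ([remove_child_type]) before the side of an edge that keeps the root can be recognized as a tree
    of law gam_(i,c-e_j). [GW_from] and [sim_g] leave the probability space free, so all laws are
    first shown to depend on [q] alone; one family of offspring vectors, taken from [nu], then
    serves for every type.

    The balance of root data separates variables: with (i,b+e_j) on one side and (j,b'+e_i) on the
    other, reversibility reads F(b) q_j(b') = F'(b') q_i(b), and fixing a vector of positive
    probability on each side makes F a multiple of q_i.

    Strong connectivity spreads the positivity of mu(i) from one type to all, makes the ratio system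
    uniquely solvable, and pins down p: a type that never has children says nothing about its row of
    p, but must then be the only type. *)

Lemma eq_perm (X : eqType) (s t : seq X) : s = t -> perm_eq s t.
Proof. by move=> ->. Qed.

Section TreeIsomorphisms.
Variable n : nat.
Implicit Types S T : plane_tree n.

Lemma vertex_rcons T u k :
  vertex T (rcons u k) = vertex T u && (k < nchild T u)%N.
Proof.
elim: u T => [|l u IH] T /=; first by rewrite andbT.
by rewrite IH andbA.
Qed.

Lemma adjacent_cons k l u v :
  adjacent (k :: u) (l :: v) <-> k = l /\ adjacent u v.
Proof.
split.
- case=> a [] /= [-> ->]; split=> //; exists a; [by left|by right].
- case=> -> [a [] ->]; exists a; [by left|by right].
Qed.

Lemma adjacent_nil_cons k u : adjacent [::] (k :: u) <-> u = [::].
Proof.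
split; first by case=> a [] //= [].
by move=> ->; exists k; left.
Qed.

Lemma adjacentC u v : adjacent u v <-> adjacent v u.
Proof. by split=> -[a [] e]; exists a; [right|left|right|left]. Qed.

Lemma adjacent_cons_nil k u : adjacent (k :: u) [::] <-> u = [::].
Proof. by rewrite adjacentC adjacent_nil_cons. Qed.

(** * Root-preserving isomorphisms respect depth and parents *)

Section IsoMap.
Variables (S T : plane_tree n) (f : seq nat -> seq nat).
Hypothesis fbij : set_bij (vertices S) (vertices T) f.
Hypothesis fadj : forall u v, vertices S u -> vertices S v ->
  (adjacent u v <-> adjacent (f u) (f v)).
Hypothesis f0 : f [::] = [::].

Let finj u v : vertices S u -> vertices S v -> f u = f v -> u = v.
Proof. by case: fbij => _ fi _ Su Sv; apply: fi; rewrite inE. Qed.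

(** Adjacency is unordered, so it must be proved that children go to children. Strong induction on
    the depth: the image of a child of [u] is a neighbour of [f u]; were it the parent of [f u], it
    would be the image of the parent of [u], against injectivity. *)
Lemma iso_size u : vertices S u -> size (f u) = size u.
Proof.
have [m] := ubnP (size u); elim: m u => // m IH.
elim/last_ind=> [|u k _]; first by rewrite f0.
rewrite size_rcons ltnS => um Suk.
have Su : vertices S u by move: Suk; rewrite /vertices /= vertex_rcons => /andP[].
have [|a [->|fu]] := (fadj Su Suk).1; first by exists k; left.
  by rewrite size_rcons IH.
case: (lastP u) Su um Suk fu => [|u' k'] Su um Suk fu.
  by move: fu; rewrite f0; case: (f _).
have Su' : vertices S u' by move: Su; rewrite /vertices /= vertex_rcons => /andP[].
have um' : (size u' < m)%N by move: um; rewrite size_rcons; apply: ltnW.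
have [|b [fu'|fu']] := (fadj Su' Su).1; first by exists k'; left.
  have e : f u' = f (rcons (rcons u' k') k).
    by move: fu; rewrite fu' => /rcons_inj[].
  have /(congr1 size) := finj Su' Suk e; rewrite !size_rcons => /eqP.
  by rewrite -addn2 -[X in X == _]addn0 eqn_add2l.
have := congr1 size fu'; rewrite size_rcons (IH _ um' Su').
rewrite (IH _ _ Su) // size_rcons => /eqP.
by rewrite -addn2 -[X in X == _]addn0 eqn_add2l.
Qed.

Lemma iso_rcons u k : vertices S (rcons u k) ->
  exists l, f (rcons u k) = rcons (f u) l.
Proof.
move=> Suk.
have Su : vertices S u by move: Suk; rewrite /vertices /= vertex_rcons => /andP[].
have [|a [->|fu]] := (fadj Su Suk).1; first (by exists k; left); first by exists a.
have := congr1 size fu; rewrite size_rcons !iso_size // size_rcons => /eqP.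
by rewrite -addn2 -[X in X == _]addn0 eqn_add2l.
Qed.

Definition iso_child k := head 0%N (f [:: k]).

Lemma iso_cons k u : vertices S (k :: u) ->
  f (k :: u) = iso_child k :: behead (f (k :: u)).
Proof.
elim/last_ind: u => [|u a IH].
  move=> /(@iso_rcons [::]) [l]; rewrite f0 /= /iso_child => -> //.
rewrite -rcons_cons => h.
have Su : vertices S (k :: u).
  by move: h; rewrite /vertices /mkset vertex_rcons => /andP[].
have [l ->] := iso_rcons h.
by rewrite (IH Su).
Qed.

End IsoMap.

Lemma map_iota_bij (g : nat -> nat) a b :
  (forall k, (k < a)%N -> (g k < b)%N) ->
  {in iota 0 a &, injective g} ->
  (forall l, (l < b)%N -> exists2 k, (k < a)%N & g k = l) ->
  perm_eq (map g (iota 0 a)) (iota 0 b).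
Proof.
move=> gh gi gs; apply: uniq_perm; rewrite ?iota_uniq //.
  by rewrite map_inj_in_uniq ?iota_uniq.
move=> l; rewrite mem_iota add0n /=; apply/mapP/idP.
  by case=> k; rewrite mem_iota /= add0n => ka ->; apply: gh.
move=> /gs [k ka <-]; exists k => //; by rewrite mem_iota.
Qed.

(** An isomorphism permutes the children of the root and restricts to each branch by dropping the
    first letter. The [pointed_iso] clause serves the walk, which compares the trees rerooted at
    corresponding children. *)
Lemma tree_iso_children S T : tree_iso S T ->
  label S [::] = label T [::] /\
  exists g : nat -> nat,
    perm_eq (map g (iota 0 (nchild S [::]))) (iota 0 (nchild T [::])) /\
    forall k, (k < nchild S [::])%N ->
      tree_iso (subtree S k) (subtree T (g k)) /\ pointed_iso S [:: k] T [:: g k].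
Proof.
move=> [f [fb fadj flab f0]]; have [fh fi fs] := fb.
have finj u v : vertices S u -> vertices S v -> f u = f v -> u = v.
  by move=> Su Sv; apply: fi; rewrite inE.
have Sk k : (k < nchild S [::])%N -> vertices S [:: k] by rewrite /vertices /= andbT.
have f1 k : (k < nchild S [::])%N -> f [:: k] = [:: iso_child f k].
  move=> ka; have /= e := iso_cons fb fadj f0 (Sk _ ka); rewrite e.
  have := iso_size fb fadj f0 (Sk _ ka); rewrite e /=.
  by case: (behead _).
split; first by rewrite -[in RHS]f0 flab.
exists (iso_child f); split.
  apply: map_iota_bij.
  - move=> k ka; have := fh _ (Sk _ ka).
    by rewrite f1 // /vertices /= andbT.
  - move=> k l; rewrite !mem_iota /= !add0n => ka la e.
    suff: [:: k] = [:: l] by case.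
    by apply: finj; rewrite ?f1 ?e //; apply: Sk.
  - move=> l lb; have [|u Su fu] := fs [:: l]; first by rewrite /vertices /= andbT.
    have := iso_size fb fadj f0 Su; rewrite fu /= => su.
    case: u su Su fu => [//|k [|//]] _ Su.
    have ka : (k < nchild S [::])%N by move: Su; rewrite /vertices /= andbT.
    by rewrite f1 // => -[<-]; exists k.
move=> k ka; split; last by exists f; split=> //; exact: f1.
have fk u : vertices (subtree S k) u ->
    f (k :: u) = iso_child f k :: behead (f (k :: u)).
  by move=> Su; apply: (iso_cons fb fadj f0); rewrite /vertices /= ka.
have Sc u : vertices (subtree S k) u -> vertices S (k :: u).
  by rewrite /vertices /= ka.
exists (fun u => behead (f (k :: u))); split.
- split.
  + move=> u /[dup] /fk e /Sc /fh; rewrite e.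
    by rewrite /vertices /= => /andP[].
  + move=> u v; rewrite !inE => Su Sv e.
    have : f (k :: u) = f (k :: v) by rewrite (fk _ Su) e -(fk _ Sv).
    by move/(finj _ _ (Sc _ Su) (Sc _ Sv)) => -[].
  + move=> v Tv.
    have [|u Su fu] := fs (iso_child f k :: v).
      rewrite /vertices /=; apply/andP; split=> //.
      by have := fh _ (Sk _ ka); rewrite f1 // /vertices /= andbT.
    case: u Su fu => [|k' u] Su fu; first by rewrite f0 in fu.
    have k'a : (k' < nchild S [::])%N by move: Su; rewrite /vertices /= => /andP[].
    have := iso_cons fb fadj f0 Su; rewrite fu => -[e1].
    have e : k' = k.
      suff: [:: k'] = [:: k] by case.
      by apply: finj; [exact: Sk|exact: Sk|rewrite !f1 // e1].
    exists u; last by rewrite /= -e fu.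
    by move: Su; rewrite -e /vertices /= => /andP[].
- move=> u v Su Sv.
  have := fadj _ _ (Sc _ Su) (Sc _ Sv).
  rewrite !adjacent_cons (fk _ Su) (fk _ Sv) !adjacent_cons /=.
  by move=> h; split=> a; [have := h.1 (conj erefl a)|have := h.2 (conj erefl a)]; case.
- move=> u Su; have /= e := fk _ Su.
  by rewrite /= -(flab _ (Sc _ Su)) e.
- by rewrite /= f1.
Qed.

(** The converse of [tree_iso_children]; later isomorphisms of rooted trees are built from their
    branches by it instead of by maps on words. *)
Lemma tree_iso_glue S T (g : nat -> nat) :
  label S [::] = label T [::] ->
  perm_eq (map g (iota 0 (nchild S [::]))) (iota 0 (nchild T [::])) ->
  (forall k, (k < nchild S [::])%N -> tree_iso (subtree S k) (subtree T (g k))) ->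
  tree_iso S T.
Proof.
move=> lab pe sub.
have /choice [F FP] : forall k, exists f, (k < nchild S [::])%N ->
    [/\ set_bij (vertices (subtree S k)) (vertices (subtree T (g k))) f,
        (forall u v, vertices (subtree S k) u -> vertices (subtree S k) v ->
           (adjacent u v <-> adjacent (f u) (f v))),
        (forall u, vertices (subtree S k) u ->
           label (subtree T (g k)) (f u) = label (subtree S k) u)
      & f [::] = [::]].
  move=> k; have [ka|] := boolP (k < nchild S [::])%N; last by exists id.
  by have [f fP] := sub _ ka; exists f.
have gh k : (k < nchild S [::])%N -> (g k < nchild T [::])%N.
  move=> ka; have : g k \in iota 0 (nchild T [::]).
    by rewrite -(perm_mem pe) map_f // mem_iota.
  by rewrite mem_iota.
have /mkseq_uniqP gi : uniq (mkseq g (nchild S [::])).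
  by rewrite (perm_uniq pe) iota_uniq.
exists (fun u => if u is k :: v then g k :: F k v else [::]); split => //.
- split.
  + case=> [//|k u]; rewrite /vertices /= => /andP[ka Su].
    by rewrite gh //=; have [[h _ _] _ _ _] := FP _ ka; exact: h.
  + case=> [|k u] [|l v] //; rewrite !inE /vertices /=.
    move=> /andP[ka Su] /andP[la Sv] [e1 e2].
    have e := gi _ _ ka la e1; subst l; congr cons.
    have [[_ h _] _ _ _] := FP _ ka; apply: h => //; by rewrite inE.
  + case=> [|l v]; first by exists [::].
    rewrite /vertices /= => /andP[lb Tv].
    have : l \in map g (iota 0 (nchild S [::])) by rewrite (perm_mem pe) mem_iota.
    case/mapP=> k; rewrite mem_iota /= add0n => ka le; subst l.
    have [[_ _ h] _ _ _] := FP _ ka; have [u Su <-] := h _ Tv.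
    by exists (k :: u); rewrite //= ka.
- case=> [|k u] [|l v] //.
  + move=> _; rewrite /vertices /= => /andP[la Sv].
    rewrite !adjacent_nil_cons; have [[_ h _] _ _ h0] := FP _ la.
    split=> [->//|e]; apply: h; rewrite ?inE //; by rewrite e h0.
  + rewrite /vertices /= => /andP[ka Su] _.
    rewrite ![adjacent (_ :: _) _]adjacentC.
    rewrite !adjacent_nil_cons; have [[_ h _] _ _ h0] := FP _ ka.
    split=> [->//|e]; apply: h; rewrite ?inE //; by rewrite e h0.
  + rewrite /vertices /= => /andP[ka Su] /andP[la Sv].
    rewrite !adjacent_cons; split.
      move=> [e a]; subst l; have [_ h _ _] := FP _ ka.
      by split=> //; apply: (h _ _ Su Sv).1.
    move=> [/(gi _ _ ka la) e a]; subst l; have [_ h _ _] := FP _ ka.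
    by split=> //; apply: (h _ _ Su Sv).2.
- case=> [//|k u]; rewrite /vertices /= => /andP[ka Su].
  by have [_ _ h _] := FP _ ka; exact: h.
Qed.

(** * Codes of balls *)

Definition code := GenTree.tree nat.

Definition code_le (x y : code) := (choice.pickle x <= choice.pickle y)%N.

Definition csort := sort code_le.

Lemma csortP (s t : seq code) : reflect (csort s = csort t) (perm_eq s t).
Proof.
apply: perm_sortP.
- by move=> x y; exact: leq_total.
- by move=> y x z; exact: leq_trans.
- by move=> x y; rewrite -eqn_leq => /eqP /(pcan_inj choice.pickleK).
Qed.

(* ccode h T is a complete invariant of the ball of radius h around the root, up
   to isomorphism (ccode_tree_ball, tree_iso_ccode, ccode_ball_iso): its nodes are
   labelled as in T, and sorting forgets the order of the children. *)
Fixpoint ccode h T : code :=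
  GenTree.Node (label T [::])
    (if h is h'.+1 then
       csort [seq ccode h' (subtree T k) | k <- iota 0 (nchild T [::])]
     else [::]).

(** [csort] orders codes by their pickle numbers, and truncation changes these numbers; therefore
    every level is sorted anew. *)
Fixpoint ctrunc h (z : code) : code :=
  if z is GenTree.Node l s then
    GenTree.Node l (if h is h'.+1 then csort (map (ctrunc h') s) else [::])
  else z.

Lemma ccode_trunc h h' T : (h <= h')%N -> ccode h T = ctrunc h (ccode h' T).
Proof.
elim: h h' T => [|h IH] [|h'] T //; rewrite ltnS => hh'.
rewrite [LHS]/= [ccode h'.+1 T]/=.
congr GenTree.Node; apply/csortP.
apply: (@perm_trans _ (map (ctrunc h) [seq ccode h' (subtree T k) | k <- iota 0 (nchild T [::])])).
  by rewrite -map_comp; apply: eq_perm; apply: eq_map => k /=; apply: IH.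
by apply: perm_map; rewrite perm_sym perm_sort.
Qed.

Lemma ccode_le h h' S T : (h <= h')%N ->
  ccode h' S = ccode h' T -> ccode h S = ccode h T.
Proof. by move=> hh' e; rewrite !(ccode_trunc _ hh') e. Qed.

Lemma ccodeS h S T : ccode h.+1 S = ccode h.+1 T <->
  label S [::] = label T [::] /\
  perm_eq [seq ccode h (subtree S k) | k <- iota 0 (nchild S [::])]
          [seq ccode h (subtree T k) | k <- iota 0 (nchild T [::])].
Proof.
split=> /= [[e1 e2]|[-> /csortP ->]//].
by split; [exact: val_inj|exact/csortP].
Qed.

Lemma tree_iso_ccode h S T : tree_iso S T -> ccode h S = ccode h T.
Proof.
elim: h S T => [|h IH] S T /tree_iso_children[e [g [pe sub]]]; first by rewrite /= e.
apply/ccodeS; split=> //.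
have /(perm_map (fun k => ccode h (subtree T k))) := pe.
rewrite -map_comp; apply: perm_trans; apply: eq_perm.
apply/eq_in_map => k; rewrite mem_iota /= add0n => /sub[/IH] //.
Qed.

Lemma perm_map_choice (X : eqType) (F G : nat -> X) a b :
  perm_eq (map F (iota 0 a)) (map G (iota 0 b)) ->
  exists g : nat -> nat, perm_eq (map g (iota 0 a)) (iota 0 b) /\
    forall k, (k < a)%N -> G (g k) = F k.
Proof.
move=> pe; have /esym := perm_size pe; rewrite !size_map !size_iota => e; subst b.
case: a pe => [|a] pe; first by exists id.
have x0 := F 0%N.
have /(perm_iotaP x0) [s sp es] := pe.
rewrite size_map size_iota in sp.
have ss : size s = a.+1 by rewrite (perm_size sp) size_iota.
exists (nth 0%N s); split.
  by rewrite -ss map_nth_iota0 // take_size ss.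
move=> k ka; have := congr1 (fun l => nth x0 l k) es.
rewrite (nth_map 0%N) ?size_iota // nth_iota // add0n => ->.
have kb : (nth 0%N s k < a.+1)%N.
  have := mem_nth 0%N (_ : k < size s)%N; rewrite ss (perm_mem sp) mem_iota.
  by move=> /(_ ka).
by rewrite (nth_map 0%N) ?ss // (nth_map 0%N) ?size_iota // nth_iota.
Qed.

Lemma subtree_ball h T k : subtree (tree_ball h.+1 T) k = tree_ball h (subtree T k).
Proof. by []. Qed.

Lemma ccode_tree_ball h T : ccode h (tree_ball h T) = ccode h T.
Proof.
elim: h T => [//|h IH] T; apply/ccodeS; split=> //=.
by apply: eq_perm; apply: eq_map => k; rewrite subtree_ball IH.
Qed.

Lemma ccode_ball_iso h S T : ccode h S = ccode h T ->
  tree_iso (tree_ball h S) (tree_ball h T).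
Proof.
elim: h S T => [|h IH] S T.
  by move=> [/val_inj e]; apply: (@tree_iso_glue _ _ id).
move=> /ccodeS[e /perm_map_choice[g [pe sub]]].
apply: (@tree_iso_glue _ _ g) => // k ka.
by rewrite !subtree_ball; apply: IH; rewrite sub.
Qed.

(** * Edges at the root and rerooting *)

Lemma pointed_iso_comp S T U x y z :
  pointed_iso S x T y -> pointed_iso T y U z -> pointed_iso S x U z.
Proof.
move=> [f [fb fadj flab f0]] [g [gb gadj glab g0]].
exists (g \o f); have [fh _ _] := fb; split.
- exact: set_bij_comp fb gb.
- move=> u v Su Sv; rewrite (fadj _ _ Su Sv).
  exact: gadj (fh _ Su) (fh _ Sv).
- by move=> u Su; rewrite /= (glab _ (fh _ Su)) flab.
- by rewrite /= f0.
Qed.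

Lemma pointed_iso_sym S T x y : vertices S x ->
  pointed_iso S x T y -> pointed_iso T y S x.
Proof.
move=> Sx [f [fb fadj flab f0]].
have [fh fi fs] := fb.
have ex v : exists u, vertices T v -> vertices S u /\ f u = v.
  have [/fs[u Su <-]|nTv] := pselect (vertices T v); last by exists [::].
  by exists u.
have [g gP] := choice ex.
have fK u : vertices S u -> g (f u) = u.
  move=> Su; have [h1 h2] := gP _ (fh _ Su).
  by apply: fi => //; rewrite inE.
exists g; split.
- split.
  + by move=> v /gP[].
  + move=> v w; rewrite !inE => /gP[_ hv] /gP[_ hw] e.
    by rewrite -hv -hw e.
  + by move=> u Su; exists (f u); [exact: fh | exact: fK].
- move=> u v /gP[Su hu] /gP[Sv hv]; apply: iff_sym.
  by have := fadj _ _ Su Sv; rewrite hu hv.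
- by move=> u /gP[Su hu]; rewrite -(flab _ Su) hu.
- by rewrite -f0 fK.
Qed.

(* T hangs below the root of S, as child number 0. *)
Definition pjoin S T : plane_tree n := PlaneTree
  (fun u => match u with
            | [::] => (nchild S [::]).+1
            | 0%N :: v => nchild T v
            | k.+1 :: v => nchild S (k :: v)
            end)
  (fun u => match u with
            | [::] => label S [::]
            | 0%N :: v => label T v
            | k.+1 :: v => label S (k :: v)
            end).

Definition premove k T : plane_tree n := PlaneTree
  (fun u => match u with
            | [::] => (nchild T [::]).-1
            | m :: v => nchild T (bump k m :: v)
            end)
  (fun u => match u with
            | [::] => label T [::]
            | m :: v => label T (bump k m :: v)
            end).

Lemma subtree_pjoin0 S T : subtree (pjoin S T) 0 = T.
Proof. by case: T. Qed.

Lemma subtree_pjoinS S T k : subtree (pjoin S T) k.+1 = subtree S k.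
Proof. by []. Qed.

Lemma subtree_premove k T m : subtree (premove k T) m = subtree T (bump k m).
Proof. by []. Qed.

Lemma ccode_pjoin h S T : ccode h.+1 (pjoin S T) =
  GenTree.Node (label S [::]) (csort (ccode h T ::
    [seq ccode h (subtree S k) | k <- iota 0 (nchild S [::])])).
Proof.
rewrite /= subtree_pjoin0; congr (GenTree.Node _ (csort (_ :: _))).
rewrite -[1%N]/(1 + 0)%N iotaDl -map_comp; exact: eq_map.
Qed.

Lemma eq_ccode_pjoin h S S' T T' :
  ccode h S = ccode h S' -> ccode h T = ccode h T' ->
  ccode h (pjoin S T) = ccode h (pjoin S' T').
Proof.
case: h => [|h]; first by move=> [/= e] _; rewrite e.
move=> /ccodeS[e pe] eT; rewrite !ccode_pjoin e.
congr GenTree.Node; apply/csortP.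
by rewrite (ccode_le (leqnSn h) eT) perm_cons.
Qed.

(** The old root becomes child 0 of the new one, the children of [k] move up by one, and the
    siblings of [k] are renumbered by [unbump k]. The map is written out because the base point
    [[:: k]] is not the root, so that [tree_iso_glue] does not apply. *)
Lemma reroot_pjoin T k : (k < nchild T [::])%N ->
  pointed_iso T [:: k] (pjoin (subtree T k) (premove k T)) [::].
Proof.
move=> ka.
have unb m : m != k -> bump k (unbump k m) = m.
  by move=> mk; rewrite unbumpK // inE eq_sym.
have bumpE m : (bump k m < nchild T [::])%N = (m < (nchild T [::]).-1)%N.
  by move: ka; rewrite /bump; case: (leqP k m) => /= km ka; apply/idP/idP; lia.
exists (fun u => match u with
  | [::] => [:: 0%N]
  | m :: v => if m == k then (if v is j :: w then j.+1 :: w else [::])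
              else 0%N :: unbump k m :: v
  end); split.
- split.
  + move=> [|m v] //=; rewrite /vertices /= => /andP[mN Tv].
    case: eqP Tv => [->|/eqP mk] Tv.
      by case: v Tv => [//|j w] /=; rewrite ltnS.
    rewrite /= -bumpE unb // mN /=.
    by rewrite subtree_pjoin0 subtree_premove unb.
  + move=> [|m v] [|m' v'] //=; rewrite ?inE /vertices /=.
    * by move=> _ _; case: ifP => // _; case: v'.
    * by move=> _ _; case: ifP => // _; case: v.
    * move=> _ _; case: eqP => [->|/eqP mk]; case: eqP => [->|/eqP m'k].
      - by case: v => [|j w]; case: v' => [|j' w'] // -[-> ->].
      - by case: v.
      - by case: v'.
      - by case=> /(congr1 (bump k)); rewrite !unb // => -> ->.
  + move=> [|[|j] w]; rewrite /vertices /=.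
    * by move=> _; exists [:: k]; rewrite /= ?ka // eqxx.
    * rewrite subtree_pjoin0; case: w => [_|m w] /=.
        by exists [::].
      rewrite -bumpE subtree_premove => h; exists (bump k m :: w) => //.
      by rewrite /= eq_sym (negbTE (neq_bump _ _)) bumpK.
    * rewrite subtree_pjoinS ltnS => h; exists (k :: j :: w); first by rewrite /= ka.
      by rewrite /= eqxx.
- have adj0 : adjacent [::] [::] <-> False by split=> // -[a []].
  move=> [|m v] [|m' v'] _ _; rewrite ?adjacent_cons_nil ?adjacent_nil_cons ?adjacent_cons ?adj0.
  + by split=> // -[].
  + case: eqP => [_|/eqP mk]; last by rewrite adjacent_cons adjacent_nil_cons; split=> [->|[]].
    case: v' => [|j w]; first by rewrite adjacent_cons_nil.
    by rewrite adjacent_cons; split=> // -[].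
  + case: eqP => [_|/eqP mk]; last by rewrite adjacent_cons adjacent_cons_nil; split=> [->|[]].
    case: v => [|j w]; first by rewrite adjacent_nil_cons.
    by rewrite adjacent_cons; split=> // -[].
  + case: eqP => [->|/eqP mk]; case: eqP => [->|/eqP m'k].
    * case: v => [|j w]; case: v' => [|j' w'];
        rewrite ?adjacent_cons_nil ?adjacent_nil_cons ?adjacent_cons ?adj0.
      - by split=> // -[].
      - by split=> // -[].
      - by split=> // -[].
      - by split=> [[_ [-> h]]|[[->] h]].
    * split=> [[e]|]; first by rewrite -e eqxx in m'k.
      by case: v => [|j w]; rewrite ?adjacent_nil_cons ?adjacent_cons // => -[].
    * split=> [[e]|]; first by rewrite e eqxx in mk.
      by case: v' => [|j w]; rewrite ?adjacent_cons_nil ?adjacent_cons // => -[].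
    * rewrite !adjacent_cons; split=> [[->]//|[_ [/(congr1 (bump k))]]].
      by rewrite !unb.
- move=> [|m v] //=; rewrite /vertices /= => /andP[mN Tv].
  case: eqP Tv => [->|/eqP mk] Tv; first by case: v Tv.
  by rewrite /= unb.
- by rewrite /= eqxx.
Qed.
End TreeIsomorphisms.


(** * Operations on isomorphism classes *)

Section Classes.
Variable n : nat.
Implicit Types (S T : plane_tree n) (s t : trees n) (i j : 'I_n.+1) (c : counts n).

Lemma class_of_treeP S T : class_of_tree S = class_of_tree T <-> tree_iso S T.
Proof.
split=> [/eqmodP/asboolP//|iso]; apply/eqmodP; exact/asboolP.
Qed.

Lemma repr_treeK t : class_of_tree (repr_tree t) = t.
Proof. exact: reprK. Qed.

Lemma repr_class T : tree_iso (repr_tree (class_of_tree T)) T.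
Proof. by apply/class_of_treeP; rewrite repr_treeK. Qed.

Definition tcode h t := ccode h (repr_tree t).
Arguments tcode : simpl never.

Lemma tcode_class h T : tcode h (class_of_tree T) = ccode h T.
Proof. exact/tree_iso_ccode/repr_class. Qed.

Lemma tcode_le h h' s t : (h <= h')%N -> tcode h' s = tcode h' t -> tcode h s = tcode h t.
Proof. exact: ccode_le. Qed.

(** [rerooted] selects its tree by [get]; [reroot_pjoin] shows that there is a tree to select, and
    any two choices are isomorphic. *)
Lemma rerooted_child T k : (k < nchild T [::])%N ->
  rerooted T [:: k] = class_of_tree (pjoin (subtree T k) (premove k T)).
Proof.
move=> ka; apply/class_of_treeP.
have h : vertices T [:: k] by rewrite /vertices /= andbT.
apply: (@pointed_iso_comp _ _ T _ _ [:: k]); last exact: reroot_pjoin.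
apply: pointed_iso_sym => //.
apply: (@getPex _ [set S | pointed_iso T [:: k] S [::]]).
by exists (pjoin (subtree T k) (premove k T)); exact: reroot_pjoin.
Qed.

Lemma rerooted_iso S T x y : vertices S x -> vertices T y -> pointed_iso S x T y ->
  (exists U, pointed_iso T y U [::]) -> rerooted S x = rerooted T y.
Proof.
move=> Sx Ty xy [U yU]; apply/class_of_treeP.
apply: (@pointed_iso_comp _ _ S _ _ x).
  apply: pointed_iso_sym => //; apply: (@getPex _ [set S' | pointed_iso S x S' [::]]).
  by exists U; apply: pointed_iso_comp xy yU.
apply: pointed_iso_comp xy _; apply: (@getPex _ [set S | pointed_iso T y S [::]]).
by exists U.
Qed.

Definition join s t : trees n := class_of_tree (pjoin (repr_tree s) (repr_tree t)).

(** [join] works on chosen representatives; this is its independence of the choice. *)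
Lemma join_class S T : join (class_of_tree S) (class_of_tree T) = class_of_tree (pjoin S T).
Proof.
apply/class_of_treeP.
have [e [g [pe sub]]] := tree_iso_children (repr_class S).
pose g' k := if k is m.+1 then (g m).+1 else 0%N.
apply: (@tree_iso_glue _ _ _ g') => //=.
  rewrite perm_cons -[1%N]/(1 + 0)%N !iotaDl -map_comp.
  have := perm_map (addn 1) pe; rewrite -map_comp.
  by rewrite (_ : [seq _ | _ <- _] = [seq (g' \o addn 1) a | a <- iota 0 (nchild (repr_tree (class_of_tree S)) [::])]).
case=> [_|k]; first by rewrite !subtree_pjoin0; exact: repr_class.
by rewrite ltnS => /sub [].
Qed.

Lemma eq_tcode_join h s s' t t' : tcode h s = tcode h s' -> tcode h t = tcode h t' ->
  tcode h (join s t) = tcode h (join s' t').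
Proof. by rewrite !tcode_class; exact: eq_ccode_pjoin. Qed.

(** A form of [graft] with a family on all of [nat] and a length, so that leaving out child [k] is
    the composition with [bump k]. *)
Definition graft_fun i (F : nat -> trees n) m : trees n :=
  class_of_tree (PlaneTree
    (fun u => if u is k :: v then nchild (repr_tree (F k)) v else m)
    (fun u => if u is k :: v then label (repr_tree (F k)) v else i)).

Lemma graftE i ts : graft i ts = graft_fun i (nth point ts) (size ts).
Proof. by []. Qed.

Definition pgraft i (F : nat -> plane_tree n) m : plane_tree n := PlaneTree
  (fun u => if u is k :: v then nchild (F k) v else m)
  (fun u => if u is k :: v then label (F k) v else i).

Lemma subtree_pgraft i F m k : subtree (pgraft i F m) k = F k.
Proof. by rewrite /subtree /=; case: (F k). Qed.

Lemma pgraft_iso i F m F' : (forall k, (k < m)%N -> tree_iso (F k) (F' k)) ->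
  tree_iso (pgraft i F m) (pgraft i F' m).
Proof.
move=> FF'; apply: (@tree_iso_glue _ _ _ id) => //=; first by rewrite map_id.
by move=> k km; rewrite !subtree_pgraft; exact: FF'.
Qed.

Lemma class_pgraft i F m :
  class_of_tree (pgraft i F m) = graft_fun i (fun k => class_of_tree (F k)) m.
Proof.
by apply/class_of_treeP/pgraft_iso => k _; apply: tree_iso_sym; exact: repr_class.
Qed.

Lemma eq_graft_fun i F m F' : (forall k, (k < m)%N -> F k = F' k) ->
  graft_fun i F m = graft_fun i F' m.
Proof.
move=> FF'; apply/class_of_treeP/pgraft_iso => k /FF' ->; exact: tree_iso_refl.
Qed.

(** This shows the edge to child [k] from the root, [reroot_pjoin] from the child: a step along the
    edge exchanges the two arguments of [pjoin]. *)
Lemma premove_iso T k : (k < nchild T [::])%N ->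
  tree_iso T (pjoin (premove k T) (subtree T k)).
Proof.
move=> ka; pose g m := if m == k then 0%N else (unbump k m).+1.
have unb m : m != k -> bump k (unbump k m) = m.
  by move=> mk; rewrite unbumpK // inE eq_sym.
have gK m : m != k -> g m = (unbump k m).+1 by rewrite /g => /negbTE ->.
apply: (@tree_iso_glue _ _ _ g) => //=.
- rewrite -[X in perm_eq _ X]/(iota 0 (nchild T [::]).-1.+1); apply: map_iota_bij.
  + by move=> m ma; rewrite /g /unbump; case: eqP => // mk; case: (ltnP k m) => ? /=; lia.
  + move=> m l _ _; rewrite /g; case: eqP => [->|/eqP mk]; case: eqP => [->|/eqP lk] //.
    by move=> [] /(congr1 (bump k)); rewrite !unb.
  + case=> [_|l la]; first by exists k => //; rewrite /g eqxx.
    exists (bump k l); last by rewrite gK ?bumpK // eq_sym neq_bump.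
    by move: la; rewrite /bump; case: (leqP k l) => /= ? ?; lia.
- move=> m ma; rewrite /g; case: eqP => [->|/eqP mk].
    by rewrite subtree_pjoin0; exact: tree_iso_refl.
  by rewrite subtree_pjoinS subtree_premove unb //; exact: tree_iso_refl.
Qed.

Lemma premove_pgraft i F m k : premove k (pgraft i F m) = pgraft i (F \o bump k) m.-1.
Proof. by congr PlaneTree; apply: funext => -[|l u]. Qed.

Lemma join_graft_fun i F m k : (k < m.+1)%N ->
  join (graft_fun i (F \o bump k) m) (F k) = graft_fun i F m.+1.
Proof.
move=> km; rewrite -[F k]repr_treeK join_class; apply/esym/class_of_treeP.
set T := PlaneTree _ _; apply: tree_iso_trans (premove_iso (k := k) _) _ => //.
by rewrite premove_pgraft subtree_pgraft; exact: tree_iso_refl.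
Qed.

Lemma tcode_graft_fun h i F m : tcode h.+1 (graft_fun i F m) =
  GenTree.Node i (csort [seq tcode h (F k) | k <- iota 0 m]).
Proof.
rewrite tcode_class /=; congr (GenTree.Node _ (csort _)).
by apply: eq_map => k; rewrite subtree_pgraft.
Qed.

Lemma root_label_class T : root_label (class_of_tree T) = label T [::].
Proof. by have /tree_iso_children[] := repr_class T. Qed.

Lemma root_degree_class T : root_degree (class_of_tree T) = nchild T [::].
Proof.
have /tree_iso_children[_ [g [/perm_size]]] := repr_class T.
by rewrite size_map !size_iota.
Qed.

Lemma card_ord_count (P : pred nat) d :
  #|[set k : 'I_d | P k]| = count P (iota 0 d).
Proof.
rewrite -sum1_card -sum1_count -[iota 0 d](_ : index_iota 0 d = _) ?big_mkord.
  by apply: eq_bigl => k; rewrite unfold_in; exact: asboolb.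
by rewrite /index_iota subn0.
Qed.

Lemma root_counts_class T : root_counts (class_of_tree T) =
  [ffun j => count (fun k => label T [:: k] == j) (iota 0 (nchild T [::]))].
Proof.
apply/ffunP => j; rewrite !ffunE.
rewrite (card_ord_count (fun k => label (repr_tree (class_of_tree T)) [:: k] == j)).
have [_ [g [pe sub]]] := tree_iso_children (repr_class T).
move/permP : pe => <-; rewrite count_map; apply: eq_in_count => k.
rewrite mem_iota /= add0n => /sub[+ _].
by move=> /tree_iso_children[/= -> _].
Qed.

Lemma root_label_graft_fun i F m : root_label (graft_fun i F m) = i.
Proof. by rewrite root_label_class. Qed.

Lemma root_degree_graft_fun i F m : root_degree (graft_fun i F m) = m.
Proof. by rewrite root_degree_class. Qed.

Lemma root_counts_graft_fun i F m : root_counts (graft_fun i F m) =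
  [ffun j => count (fun k => root_label (F k) == j) (iota 0 m)].
Proof. by rewrite root_counts_class. Qed.

Lemma root_label_join s t : root_label (join s t) = root_label s.
Proof. by rewrite root_label_class. Qed.

Lemma root_countsE t : root_counts t =
  [ffun j => count (fun k => label (repr_tree t) [:: k] == j) (iota 0 (root_degree t))].
Proof. by rewrite -{1}[t]repr_treeK root_counts_class. Qed.

Lemma root_counts_join s t : root_counts (join s t) =
  [ffun j => (root_counts s j + (root_label t == j))%N].
Proof.
rewrite root_counts_class root_countsE; apply/ffunP => j; rewrite !ffunE /=.
rewrite addnC; congr (_ + _)%N.
by rewrite -[1%N]/(1 + 0)%N iotaDl count_map.
Qed.

Lemma csize_root_counts t : csize (root_counts t) = root_degree t.
Proof.
rewrite /csize root_countsE.
under eq_bigr do rewrite ffunE -sum1_count big_mkcond /=.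
rewrite exchange_big /= -[RHS](size_iota 0) -sum1_size; apply: eq_bigr => k _.
rewrite (bigD1 (label (repr_tree t) [:: k])) //= eqxx big1 // => j.
by rewrite eq_sym => /negbTE ->.
Qed.

Lemma size_child_types c : size (child_types c) = csize c.
Proof.
rewrite /child_types size_flatten /shape -map_comp sumnE big_map big_enum /csize.
by apply: eq_bigr => j _; rewrite /= size_nseq.
Qed.

Lemma count_child_types c j : count_mem j (child_types c) = c j.
Proof.
rewrite /child_types count_flatten -map_comp sumnE big_map big_enum (bigD1 j) //=.
by rewrite count_nseq /= eqxx mul1n big1 ?addn0 // => k kj; rewrite count_nseq /= (negbTE kj).
Qed.

(** The recursion behind the branching property: the tree at child [k] is again a Galton-Watson
    tree, driven by the offspring vectors of the individuals below [k]. *)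
Lemma gw_tree_graft i xi : gw_tree i xi = graft_fun i
  (fun k => gw_tree (nth i (child_types (xi ([::], i))) k) (fun wj => xi (k :: wj.1, wj.2)))
  (csize (xi ([::], i))).
Proof.
rewrite -class_pgraft; apply/class_of_treeP.
apply: (@tree_iso_glue _ _ _ id) => //=; first by rewrite map_id.
by move=> k _; rewrite subtree_pgraft; exact: tree_iso_refl.
Qed.

Lemma root_label_gw_tree i xi : root_label (gw_tree i xi) = i.
Proof. by rewrite root_label_class. Qed.

Lemma root_counts_gw_tree i xi : root_counts (gw_tree i xi) = xi ([::], i).
Proof.
rewrite gw_tree_graft root_counts_graft_fun; set c := xi _.
apply/ffunP => j; rewrite ffunE -[RHS]count_child_types -size_child_types.
rewrite -[in RHS](mkseq_nth i (child_types c)) /mkseq count_map.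
by apply: eq_count => k /=; rewrite root_label_gw_tree.
Qed.

Section Walk.
Variable R : realType.

(** [walk] is computed on the representative of the class. The bijection between the children of two
    representatives reindexes the sum, and corresponding rerooted trees have the same class. *)
Lemma walk_class T (A : set (trees n)) : walk R (class_of_tree T) A =
  (\sum_(0 <= k < nchild T [::]) \1_A (class_of_tree (pjoin (subtree T k) (premove k T))))
    / (nchild T [::])%:R.
Proof.
rewrite /walk root_degree_class; congr (_ / _).
have [_ [g [pe sub]]] := tree_iso_children (repr_class T).
have dE : nchild (repr_tree (class_of_tree T)) [::] = nchild T [::].
  exact: root_degree_class.
rewrite -(big_mkord xpredT (fun k => \1_A (rerooted (repr_tree (class_of_tree T)) [:: k]))).
rewrite /index_iota subn0 -[in RHS](perm_big _ pe) big_map /= dE.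
rewrite big_seq [RHS]big_seq; apply: eq_bigr => k; rewrite mem_iota /= add0n => km.
have gm : (g k < nchild T [::])%N.
  have : g k \in iota 0 (nchild T [::]).
    by rewrite -(perm_mem pe) map_f // dE mem_iota.
  by rewrite mem_iota.
rewrite -(rerooted_child gm); congr (\1_A _); apply: rerooted_iso.
- by rewrite /vertices /mkset /= dE km.
- by rewrite /vertices /= gm.
- by have [] := sub k; first by rewrite dE.
- by exists (pjoin (subtree T (g k)) (premove (g k) T)); exact: reroot_pjoin.
Qed.

Lemma walk_graft_fun i F m (A : set (trees n)) : walk R (graft_fun i F m) A =
  (\sum_(0 <= k < m) \1_A (join (F k) (graft_fun i (F \o bump k) m.-1))) / m%:R.
Proof.
rewrite [LHS]walk_class /=; congr (_ / _); apply: eq_bigr => k _.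
set T := PlaneTree _ _; congr (\1_A _).
rewrite -[X in class_of_tree (pjoin X _)](_ : repr_tree (F k) = _); last first.
  by rewrite -(subtree_pgraft i (fun k => repr_tree (F k)) m).
by rewrite premove_pgraft -[F k in RHS]repr_treeK join_class.
Qed.

End Walk.
End Classes.


(** * The sigma-field of the trees *)

Section Determined.
Variable n : nat.
Implicit Types (S T : plane_tree n) (s t : trees n) (i j : 'I_n.+1) (c : counts n).
Implicit Types (E A B : set (trees n)).

Definition determined h E := forall s t, tcode h s = tcode h t -> E s -> E t.

(** A generating pi-system: events of two radii are both determined by the larger ball. *)
Definition local_events : set (set (trees n)) := [set E | exists h, determined h E].

Lemma determined_le h h' E : (h <= h')%N -> determined h E -> determined h' E.
Proof. by move=> hh' dE s t /(tcode_le hh') /dE. Qed.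

Lemma determined_tcode h Z : determined h (tcode h @^-1` Z).
Proof. by move=> s t /= ->. Qed.

Lemma local_setI : setI_closed local_events.
Proof.
move=> A B [h dA] [h' dB]; exists (maxn h h') => s t e [As Bs]; split.
- exact: (determined_le (leq_maxl _ _) dA e As).
- exact: (determined_le (leq_maxr _ _) dB e Bs).
Qed.

(* There are only countably many codes. *)
Lemma determined_measurable h E : determined h E -> measurable E.
Proof.
move=> dE.
have -> : E = \bigcup_z [set t | tcode h t = z /\ exists2 s, E s & tcode h s = z].
  apply/seteqP; split=> [t Et|t [z _ [e [s Es e']]]].
    by exists (tcode h t) => //; split=> //; exists t.
  by apply: dE Es; rewrite e'.
apply: countable_bigcupT_measurable; first exact: countableP.
move=> z; have [[s Es e]|nE] := pselect (exists2 s, E s & tcode h s = z).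
  have -> : [set t | tcode h t = z /\ exists2 s, E s & tcode h s = z] =
            [set t | tree_iso (tree_ball h (repr t)) (tree_ball h (repr_tree s))].
    apply/seteqP; split=> t /=.
      by move=> [et _]; apply: ccode_ball_iso; rewrite -/(tcode h t) et.
    move=> /(tree_iso_ccode h); rewrite !ccode_tree_ball => et; split.
      by rewrite -e.
    by exists s.
  by apply: sub_sigma_algebra; exists h, (tree_ball h (repr_tree s)).
rewrite (_ : [set _ | _] = set0); first exact: measurable0.
by apply/seteqP; split=> t // [].
Qed.

Lemma cylinder_local E : cylinders E -> local_events E.
Proof.
move=> [h [S ->]]; exists h => s t e /= sS.
apply: tree_iso_trans sS; apply: ccode_ball_iso; exact: esym.
Qed.

Lemma measurable_treesE : @measurable _ (trees n) = <<s local_events >>.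
Proof.
apply/seteqP; split.
  apply: sub_sigma_algebra2; exact: cylinder_local.
apply: smallest_sub; first exact: sigma_algebra_measurable.
by move=> E [h]; exact: determined_measurable.
Qed.

(** A local event is a countable union of events that prescribe the code of a ball, so only the
    latter need measurable preimages. *)
Lemma measurable_fun_trees d (X : measurableType d) (f : X -> trees n) :
  (forall h z, measurable (f @^-1` (tcode h @^-1` [set z]))) ->
  measurable_fun setT f.
Proof.
move=> mf; apply: (measurability local_events measurable_treesE).
move=> _ [E [h dE] <-]; rewrite setTI.
have -> : f @^-1` E = \bigcup_z
    ((if `[< exists2 s, E s & tcode h s = z >] then setT else set0) `&`
     (f @^-1` (tcode h @^-1` [set z]))).
  apply/seteqP; split=> [x Ex|x [z _ []]] /=.
    by exists (tcode h (f x)) => //; split=> //; case: asboolP => // -[]; exists (f x).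
  by case: asboolP => // -[s Es e] _ fx; apply: dE Es; rewrite e.
apply: countable_bigcupT_measurable; first exact: countableP.
by move=> z; apply: measurableI => //; case: ifP.
Qed.

Lemma determined_measurable_fun h d (X : measurableType d) (f : trees n -> X) :
  (forall s t, tcode h s = tcode h t -> f s = f t) -> measurable_fun setT f.
Proof.
move=> df _ Y mY; rewrite setTI; apply: (@determined_measurable h).
by move=> s t /df e; rewrite /preimage /mkset e.
Qed.

(** Such a set is the union of countably many rectangles, one for each pair of codes. *)
Lemma determined_measurable2 h (C : set (trees n * trees n)) :
  (forall s s' t t', tcode h s = tcode h s' -> tcode h t = tcode h t' ->
    C (s, t) -> C (s', t')) -> measurable C.
Proof.
move=> dC.
have -> : C = \bigcup_(z : code * code)
    ([set s | tcode h s = z.1 /\ exists s' t', [/\ C (s', t'), tcode h s' = z.1 & tcode h t' = z.2]] `*`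
     [set t | tcode h t = z.2]).
  apply/seteqP; split=> [[s t] Cst|[s t] [[y z] _ /= [[e1 [s' [t' [C' e2 e3]]]] e4]]].
    by exists (tcode h s, tcode h t) => //; split=> //; split=> //; exists s, t.
  by apply: dC C'; rewrite ?e1 ?e2 ?e3 ?e4.
apply: countable_bigcupT_measurable; first exact: countableP.
move=> z; apply: measurableX; apply: (@determined_measurable h).
  by move=> s t e [<- ex]; split.
by move=> s t e /= <-.
Qed.

Lemma measurable_join : measurable_fun setT (fun st : trees n * trees n => join st.1 st.2).
Proof.
apply: measurable_fun_trees => h z; apply: (@determined_measurable2 h).
by move=> s s' t t' e1 e2 /= <-; apply/esym/eq_tcode_join.
Qed.

Lemma determined_root_label (D : set 'I_n.+1) : determined 0 (@root_label n @^-1` D).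
Proof. by move=> s t [/val_inj] /=; rewrite /root_label => ->. Qed.

Lemma tcode1_root_counts s t : tcode 1 s = tcode 1 t -> root_counts s = root_counts t.
Proof.
rewrite /tcode => /ccodeS[_ /perm_map_choice[g [pe sub]]].
rewrite !root_countsE /root_degree; apply/ffunP => j; rewrite !ffunE.
have /permP <- := pe; rewrite count_map; apply: eq_in_count => k.
rewrite mem_iota /= add0n => /sub [/val_inj e].
by rewrite e.
Qed.

Lemma determined_root_counts (D : set (counts n)) : determined 1 (@root_counts n @^-1` D).
Proof. by move=> s t /tcode1_root_counts /= ->. Qed.

Lemma tcode1_root_degree s t : tcode 1 s = tcode 1 t -> root_degree s = root_degree t.
Proof. by move=> /tcode1_root_counts e; rewrite -!csize_root_counts e. Qed.

Lemma measurable_has_label j : measurable (has_label j : set (trees n)).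
Proof.
pose E h := [set t : trees n | exists u,
  [/\ (size u <= h)%N, vertices (repr_tree t) u & label (repr_tree t) u = j]].
have -> : has_label j = \bigcup_h E h.
  apply/seteqP; split=> [t [u Tu uj]|t [h _ [u [_ Tu uj]]]]; last by exists u.
  by exists (size u) => //; exists u; split.
apply: bigcupT_measurable => h; apply: (@determined_measurable h) => s t.
rewrite /tcode /E /=; elim: h (repr_tree s) (repr_tree t) => [|h IH] S T.
  by move=> [/val_inj e] [[|k u] [// _ _ <-]]; exists [::].
move=> /ccodeS[e /perm_map_choice[g [pe sub]]] [[|k u] [uh Su uj]].
  by exists [::]; split=> //; rewrite -e.
move: Su; rewrite /vertices /= => /andP[ka Su].
have [|v [vh Tv vj]] := IH (subtree S k) (subtree T (g k)) (esym (sub _ ka)).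
  by exists u; split.
exists (g k :: v); split=> //; rewrite /vertices /mkset /= Tv andbT.
have : g k \in iota 0 (nchild T [::]) by rewrite -(perm_mem pe) map_f // mem_iota.
by rewrite mem_iota.
Qed.

(** Cancellation of multisets: equal multisets of branch codes stay equal after the removal of one
    equal element from each. *)
Lemma ccode_premove h S T k l : (k < nchild S [::])%N -> (l < nchild T [::])%N ->
  ccode h.+1 S = ccode h.+1 T -> ccode h (subtree S k) = ccode h (subtree T l) ->
  ccode h.+1 (premove k S) = ccode h.+1 (premove l T).
Proof.
move=> ka la e esub.
have := e; rewrite (tree_iso_ccode _ (premove_iso ka)) (tree_iso_ccode _ (premove_iso la)).
rewrite !ccode_pjoin esub => -[e0 /csortP]; rewrite perm_cons => pe.
by apply/ccodeS; split=> //; apply: val_inj.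
Qed.

(** * Measurability of the walk *)

Section WalkMeasurable.
Variable R : realType.

(** The ball of radius [h] around a child lies in the ball of radius [h.+1] around the root. The
    further unit keeps positive the radius of the tree without the branch, as [ccode_premove]
    requires. *)
Lemma walk_determined h B s t : determined h B -> tcode h.+2 s = tcode h.+2 t ->
  walk R s B = walk R t B.
Proof.
move=> /(determined_le (leqnSn h)) dB e.
rewrite -[s]repr_treeK -[t]repr_treeK !walk_class.
have := e; rewrite /tcode; set S := repr_tree s; set T := repr_tree t => eST.
have [e0 /perm_map_choice[g [pe sub]]] := (ccodeS _ _ _).1 eST.
have de : nchild S [::] = nchild T [::].
  by have := perm_size pe; rewrite size_map !size_iota.
rewrite -de; congr (_ / _); rewrite [in RHS]de.
rewrite /index_iota !subn0 -(perm_big _ pe) big_map /= [LHS]big_seq [RHS]big_seq.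
apply: eq_bigr => k; rewrite mem_iota /= add0n => ka.
have la : (g k < nchild T [::])%N.
  have : g k \in iota 0 (nchild T [::]) by rewrite -(perm_mem pe) map_f // mem_iota.
  by rewrite mem_iota.
have esub : ccode h.+1 (subtree S k) = ccode h.+1 (subtree T (g k)) by rewrite sub.
have ecode : tcode h.+1 (class_of_tree (pjoin (subtree S k) (premove k S))) =
    tcode h.+1 (class_of_tree (pjoin (subtree T (g k)) (premove (g k) T))).
  rewrite !tcode_class; apply: eq_ccode_pjoin => //.
  by apply: ccode_premove => //; [exact: ccode_le eST|exact: ccode_le esub].
rewrite !indicE; congr (_%:R); apply: congr1; apply/idP/idP; rewrite !inE.
  exact: dB.
by apply: dB.
Qed.

Lemma walk_ge0 t B : 0 <= walk R t B.
Proof. by rewrite /walk divr_ge0 // sumr_ge0 // => k _; rewrite indicE. Qed.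

(** The step distribution is a scaled finite sum of Dirac measures, from which it inherits countable
    additivity. *)
Lemma walk_bigcup t (F : nat -> set (trees n)) :
  (forall k, measurable (F k)) -> trivIset setT F ->
  (walk R t (\bigcup_k F k))%:E = (\sum_(k <oo | k \in setT) (walk R t (F k))%:E)%E.
Proof.
move=> mF tF.
have r0 : 0 <= ((root_degree t)%:R^-1 : R) by rewrite invr_ge0.
pose x k := rerooted (repr_tree t) [:: k].
pose m : {measure set (trees n) -> \bar R} :=
  mscale (NngNum r0) (msum (fun k => [the measure _ _ of dirac (x k)]) (root_degree t)).
have mE A : (walk R t A)%:E = m A.
  rewrite /m /= /mscale /= /msum /walk mulrC EFinM; congr (_ * _)%E.
  by rewrite -sumEFin; apply: eq_bigr => k _; rewrite /= diracE indicE.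
rewrite mE measure_bigcup //.
by apply: eq_eseriesr => k _; rewrite mE.
Qed.

Lemma walkT t : walk R t setT = (root_degree t != 0%N)%:R.
Proof.
rewrite /walk; under eq_bigr do rewrite indicT.
rewrite sumr_const card_ord; have [->|d0] := eqVneq; first by rewrite mul0r.
by rewrite divff // pnatr_eq0.
Qed.

(** Dynkin induction from the local events. A complement is subtracted from the value at [setT],
    which is 1, but 0 on trees of degree 0. *)
Lemma measurable_walk B : measurable B -> measurable_fun setT (fun t : trees n => walk R t B).
Proof.
rewrite measurable_treesE.
apply: (dynkin_induction (P := fun B => measurable_fun setT (fun t : trees n => walk R t B)) measurable_treesE local_setI).
- apply: (@determined_measurable_fun 1) => s t e.
  by rewrite !walkT (tcode1_root_degree e).
- move=> {}B [h dB]; apply: (@determined_measurable_fun h.+2) => s t.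
  exact: walk_determined.
- move=> {}B mB wB.
  have -> : (fun t => walk R t (~` B)) = (fun t => walk R t setT) \- (fun t => walk R t B).
    apply/funext => t /=; rewrite /walk -mulrBl -sumrB; congr (_ / _).
    by apply: eq_bigr => k _; rewrite !indicE in_setC in_setT; case: (_ \in B); rewrite ?subrr ?subr0.
  apply: measurable_funB => //; apply: (@determined_measurable_fun 1) => s t e.
  by rewrite !walkT (tcode1_root_degree e).
- move=> F mF tF wF; apply/measurable_EFinP.
  rewrite (_ : _ \o _ = (fun t => \sum_(k <oo | k \in setT) (walk R t (F k))%:E)%E).
    apply: ge0_emeasurable_sum => [k t _ _|k _]; first by rewrite lee_fin walk_ge0.
    by apply/measurable_EFinP; exact: wF.
  by apply/funext => t /=; rewrite walk_bigcup.
Qed.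

End WalkMeasurable.

Lemma trees_measure_unique (R : realType) (m1 m2 : {measure set (trees n) -> \bar R}) :
  (m1 setT < +oo)%E -> (forall h E, determined h E -> m1 E = m2 E) ->
  forall A, measurable A -> m1 A = m2 A.
Proof.
move=> fin e A mA; apply: (@measure_unique _ _ _ local_events (fun=> setT)) => //.
- exact: measurable_treesE.
- exact: local_setI.
- by move=> _; exists 0%N.
- by rewrite bigcup_const.
- by move=> B [h /e].
Qed.

End Determined.


(** * Countable sums and independence of groups of variables *)

Lemma measurable_count_preimage d (X : measurableType d) (K : countType) (g : X -> K) Z :
  (forall x, measurable (g @^-1` [set x])) -> measurable (g @^-1` Z).
Proof.
move=> mg; have -> : g @^-1` Z = \bigcup_x (if `[< Z x >] then g @^-1` [set x] else set0).
  apply/seteqP; split=> [x Zx|x [y _]].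
    by exists (g x) => //; case: asboolP.
  by case: asboolP => // Zy /= ->.
by apply: countable_bigcupT_measurable => [|x]; [exact: countableP|case: ifP].
Qed.

Section CountableSums.
Variable R : realType.

(** Turns a sum over a countable type into a series over pickle numbers, where numbers that code
    nothing contribute 0; this gives access to the results on series. *)
Lemma esum_count (K : countType) (f : K -> \bar R) : (forall x, 0 <= f x)%E ->
  (\esum_(x in setT) f x = \sum_(k <oo) oapp f 0 (choice.pickle_inv k))%E.
Proof.
move=> f0; rewrite nneseries_esumT => [|k]; last by case: choice.pickle_inv => //=.
transitivity (\esum_(k in range (@choice.pickle K)) oapp f 0 (choice.pickle_inv k))%E.
  rewrite (@reindex_esum _ _ _ setT _ (@choice.pickle K)).
    by apply: eq_esum => x _; rewrite choice.pickleK_inv.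
  split; [by move=> x _; exists x|move=> x y _ _; exact: (pcan_inj choice.pickleK)|by []].
rewrite esum_mkcond; apply: eq_esum => k _; case: ifPn => // /negP nk.
case e : choice.pickle_inv => [x|] //=; case: nk; rewrite inE; exists x => //.
by have := @choice.pickle_invK K k; rewrite e.
Qed.

Lemma measure_esum d (T : measurableType d) (mu : {measure set T -> \bar R})
    (K : countType) (g : T -> K) (E : set T) :
  (forall x, measurable (g @^-1` [set x])) -> measurable E ->
  mu E = (\esum_(x in setT) mu (E `&` g @^-1` [set x]))%E.
Proof.
move=> mg mE; rewrite esum_count; last by move=> x; exact: measure_ge0.
pose F k := oapp (fun x => E `&` g @^-1` [set x]) set0 (choice.pickle_inv k).
have {1}-> : E = \bigcup_k F k.
  apply/seteqP; split=> [x Ex|x [k _]]; last first.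
    by rewrite /F; case: choice.pickle_inv => //= y [].
  by exists (choice.pickle (g x)) => //; rewrite /F choice.pickleK_inv.
rewrite measure_bigcup.
- rewrite (@eq_eseriesl _ _ xpredT) => [|k]; last by rewrite in_setT.
  apply: eq_eseriesr => k _.
  by rewrite /F; case: choice.pickle_inv => //=; rewrite measure0.
- by move=> k _; rewrite /F; case: choice.pickle_inv => //= x; exact: measurableI.
- move=> k l _ _ [x []]; rewrite /F.
  have := @choice.pickle_invK K k; have := @choice.pickle_invK K l.
  by case: choice.pickle_inv => //= y <-; case: choice.pickle_inv => //= z <- [_ <-] [_ <-].
Qed.

Lemma count_law_eq d (T : measurableType d) (mu : {measure set T -> \bar R})
    d' (T' : measurableType d') (mu' : {measure set T' -> \bar R})
    (K : countType) (g : T -> K) (g' : T' -> K) :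
  (forall x, measurable (g @^-1` [set x])) ->
  (forall x, measurable (g' @^-1` [set x])) ->
  (forall x, mu (g @^-1` [set x]) = mu' (g' @^-1` [set x])) ->
  forall Z, mu (g @^-1` Z) = mu' (g' @^-1` Z).
Proof.
move=> mg mg' e Z.
rewrite (measure_esum mu mg (measurable_count_preimage Z mg)).
rewrite (measure_esum mu' mg' (measurable_count_preimage Z mg')).
apply: eq_esum => x _; have [Zx|nZx] := pselect (Z x).
  rewrite [X in mu X](_ : _ = g @^-1` [set x]); last first.
    by apply/seteqP; split=> [y []//|y /= gy]; split=> //=; rewrite gy.
  rewrite e; congr (mu' _).
  by apply/seteqP; split=> [y /= gy|y []//]; split=> //=; rewrite gy.
rewrite [X in mu X](_ : _ = set0) ?measure0; last first.
  by apply/seteqP; split=> y //= [Zy gy]; apply: nZx; rewrite -gy.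
rewrite [X in mu' X](_ : _ = set0) ?measure0 //.
by apply/seteqP; split=> y //= [Zy gy]; apply: nZx; rewrite -gy.
Qed.

End CountableSums.

(** * Independence of sigma-fields generated by disjoint groups of variables *)

Section Grouping.
Variables (R : realType) (d : measure_display) (Om : measurableType d).
Variables (P : probability Om R) (I : eqType) (U : Type) (xi : I -> Om -> U).
Hypothesis mxi : forall a B, measurable (xi a @^-1` B).
Hypothesis ind : independent P setT xi.
Implicit Types J : set I.

(* The pi-system generating the sigma-field of the variables xi a with a in J. *)
Definition boxes J : set (set Om) := [set E | exists s (B : I -> set U),
  [/\ uniq s, (forall a, a \in s -> J a) & E = \bigcap_(a in [set` s]) (xi a @^-1` B a)]].

Lemma boxes_setI J : setI_closed (boxes J).
Proof.
move=> _ _ [s [B [us sJ ->]]] [s' [B' [us' s'J ->]]].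
exists (undup (s ++ s')), (fun a => (if a \in s then B a else setT) `&`
                              (if a \in s' then B' a else setT)); split.
- exact: undup_uniq.
- by move=> a; rewrite mem_undup mem_cat => /orP[/sJ|/s'J].
- apply/seteqP; split=> w.
    by move=> [h h'] a /= _; split; case: ifP => // aa; [exact: h|exact: h'].
  move=> h; split=> a /= as_; have /h : a \in undup (s ++ s') by rewrite mem_undup mem_cat as_ ?orbT.
    by rewrite as_ => -[].
  by rewrite as_ => -[].
Qed.

Lemma boxes_setT J : boxes J setT.
Proof. by exists [::], (fun=> setT); split=> //; apply/seteqP; split. Qed.

Lemma boxes_measurable J : boxes J `<=` measurable.
Proof.
move=> _ [s [B [_ _ ->]]]; apply: fin_bigcap_measurable => // a _; exact: mxi.
Qed.

Lemma boxesS J J' : J `<=` J' -> boxes J `<=` boxes J'.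
Proof. by move=> JJ' E [s [B [us sJ ->]]]; exists s, B; split=> // a /sJ /JJ'. Qed.

Lemma boxes1 J a B : J a -> boxes J (xi a @^-1` B).
Proof.
move=> Ja; exists [:: a], (fun=> B); split=> //.
- by move=> b; rewrite inE => /eqP ->.
- apply/seteqP; split=> w; first by move=> h b /=; rewrite inE => /eqP ->.
  by apply => /=; rewrite inE.
Qed.

Lemma prob_fin E : measurable E -> P E = (fine (P E))%:E.
Proof. by move=> mE; rewrite fineK // fin_num_measure. Qed.

Lemma boxes_indep J J' E E' : [disjoint J & J'] -> boxes J E -> boxes J' E' ->
  P (E `&` E') = (P E * P E')%E.
Proof.
move=> /disj_setPS dJ bE bE'.
have mE := boxes_measurable bE; have mE' := boxes_measurable bE'.
suff e : fine (P (E `&` E')) = fine (P E) * fine (P E').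
  by rewrite (prob_fin (measurableI _ _ mE mE')) e EFinM -!prob_fin.
case: bE bE' {mE mE'} => [s [B [us sJ ->]]] [s' [B' [us' s'J ->]]].
have dss a : a \in s -> a \in s' -> False by move=> /sJ Ja /s'J J'a; apply: (dJ a).
pose B2 a := if a \in s then B a else B' a.
have uss : uniq (s ++ s').
  rewrite cat_uniq us us' andbT /=; apply/hasPn => a as'; apply/negP => as_.
  exact: dss as_ as'.
rewrite !ind // -[RHS](_ : \prod_(a <- s ++ s') fine (P (xi a @^-1` B2 a)) = _).
  rewrite -ind //; congr (fine (P _)); apply/seteqP; split=> w.
    move=> [h h'] a /=; rewrite mem_cat /B2; case: ifP => [as_ _|_ /=]; first exact: h.
    exact: h'.
  move=> h; split=> a /= as_.
    by have := h a; rewrite /= mem_cat /B2 as_; apply.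
  have := h a; rewrite /= mem_cat /B2 as_ orbT.
  case: ifP => [as'|_]; last by apply.
  by case: (dss _ as' as_).
rewrite big_cat /=; congr (_ * _); apply: eq_big_seq => a as_; rewrite /B2 ?as_ //.
by case: ifP => // as'; case: (dss _ as' as_).
Qed.

(** For fixed [F], the finite measures P(E & F) and P(F) P(E) of E agree on the pi-system [G], hence
    on the sigma-field it generates. Used once for each of the two sigma-fields. *)
Lemma pi_indep (G : set (set Om)) F : G `<=` measurable -> setI_closed G -> G setT ->
  measurable F -> (forall E, G E -> P (E `&` F) = (P E * P F)%E) ->
  forall E, <<s G >> E -> P (E `&` F) = (P E * P F)%E.
Proof.
move=> mG GI GT mF GF E sE.
have r0 : 0 <= fine (P F) by rewrite fine_ge0.
have : P (E `&` F) = ((fine (P F))%:E * P E)%E.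
  apply: (@g_sigma_algebra_measure_unique _ R _ G mG (fun=> setT) (fun=> GT) _
    (mrestr P mF) (mscale (NngNum r0) P)) sE => //.
  - by rewrite bigcup_const.
  - by move=> A /GF AF; change (P (A `&` F) = ((fine (P F))%:E * P A)%E); rewrite -prob_fin // muleC.
  - by move=> _; change (P (setT `&` F) < +oo)%E; rewrite setTI (le_lt_trans (probability_le1 P mF)) // ltry.
by rewrite -prob_fin // muleC.
Qed.

Definition events J : set (set Om) := <<s boxes J >>.

Lemma events_measurable J : events J `<=` measurable.
Proof.
by apply: smallest_sub; [exact: sigma_algebra_measurable|exact: boxes_measurable].
Qed.

Lemma eventsS J J' : J `<=` J' -> events J `<=` events J'.
Proof. by move=> /boxesS h; exact: sub_sigma_algebra2. Qed.

Lemma events1 J a B : J a -> events J (xi a @^-1` B).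
Proof. by move=> Ja; apply: sub_sigma_algebra; exact: boxes1. Qed.

Lemma events_indep J J' E E' : [disjoint J & J'] -> events J E -> events J' E' ->
  P (E `&` E') = (P E * P E')%E.
Proof.
move=> dJ eE eE'.
apply: (pi_indep (@boxes_measurable J) (@boxes_setI J) (boxes_setT J)) eE.
  exact: events_measurable eE'.
move=> {}E bE; rewrite setIC muleC.
apply: (pi_indep (@boxes_measurable J') (@boxes_setI J') (boxes_setT J')) eE'.
  exact: boxes_measurable bE.
by move=> {}E' bE'; rewrite setIC muleC; exact: boxes_indep bE bE'.
Qed.

Lemma events_setT J : events J setT.
Proof. by apply: sub_sigma_algebra; exact: boxes_setT. Qed.

Lemma events_setI J E E' : events J E -> events J E' -> events J (E `&` E').
Proof. exact: (@measurableI _ (g_sigma_algebraType (boxes J))). Qed.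

(** The second conclusion carries the induction: the intersection of the remaining events depends on
    the remaining groups only, so it is independent of the next event. *)
Lemma events_prod (K : eqType) (J : K -> set I) (E : K -> set Om) (s : seq K) :
  uniq s -> (forall k l a, J k a -> J l a -> k = l) -> (forall k, events (J k) (E k)) ->
  P (\bigcap_(k in [set` s]) E k) = (\prod_(k <- s) P (E k))%E /\
  events (\bigcup_(k in [set` s]) J k) (\bigcap_(k in [set` s]) E k).
Proof.
move=> + dJ eE; elim: s => [_|k s IH /= /andP[ks us]].
  rewrite big_nil [X in P X](_ : _ = setT) ?probability_setT; last first.
    by apply/seteqP; split.
  split=> //; rewrite [X in events _ X](_ : _ = setT); last by apply/seteqP; split.
  exact: events_setT.
have [IH1 IH2] := IH us.
have eC : \bigcap_(l in [set` k :: s]) E l = E k `&` \bigcap_(l in [set` s]) E l.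
  apply/seteqP; split=> w.
    move=> h; split; first by apply: h; rewrite /= inE eqxx.
    by move=> l /= ls; apply: h; rewrite /= inE ls orbT.
  by move=> [h1 h2] l /=; rewrite inE => /orP[/eqP ->//|]; exact: h2.
rewrite eC big_cons; split.
  rewrite (events_indep _ (eE k) IH2) ?IH1 //.
  apply/disj_setPS => a [Jk [l /= ls Jl]]; move: ks.
  by rewrite (dJ _ _ _ Jk Jl) ls.
apply: events_setI.
  by apply: eventsS (eE k) => a Ja; exists k => //=; rewrite inE eqxx.
by apply: eventsS IH2 => a [l /= ls Ja]; exists l => //=; rewrite inE ls orbT.
Qed.

End Grouping.


(** * Random trees *)

Section Law.
Variables (R : realType) (d d' : measure_display).
Variables (X : measurableType d) (Y : measurableType d').

Definition law (P : probability X R) (f : X -> Y) (mf : measurable_fun setT f) :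
    probability Y R :=
  let mixin := isMeasurableFun.Build _ _ _ _ _ mf in
  let f' : {mfun X >-> Y} := HB.pack f mixin in
  distribution P f'.

Arguments law : simpl never.

Lemma lawE (P : probability X R) (f : X -> Y) (mf : measurable_fun setT f) A :
  law P mf A = P (f @^-1` A).
Proof. by []. Qed.

End Law.

Lemma measurable_preimage d d' (X : measurableType d) (Y : measurableType d')
  (f : X -> Y) B : measurable_fun setT f -> measurable B -> measurable (f @^-1` B).
Proof. by move=> mf mB; rewrite -[X in measurable X]setTI; exact: mf. Qed.

Section RandomTrees.
Variable n : nat.
Implicit Types (i j : 'I_n.+1) (c : counts n).

Lemma tcode_measurable h Z : measurable (@tcode n h @^-1` Z).
Proof. exact: (determined_measurable (@determined_tcode n h Z)). Qed.

Section Measurability.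
Variables (d : measure_display) (X : measurableType d).

Lemma measurable_map_code (f : nat -> X -> code) (ks : seq nat) l :
  (forall k z, measurable (f k @^-1` [set z])) ->
  measurable ((fun w => [seq f k w | k <- ks]) @^-1` [set l]).
Proof.
move=> mf; elim: ks l => [|k ks IH] [|z l].
- by rewrite (_ : _ @^-1` _ = setT) //; apply/seteqP; split.
- by rewrite (_ : _ @^-1` _ = set0) //; apply/seteqP; split.
- by rewrite (_ : _ @^-1` _ = set0) //; apply/seteqP; split.
- rewrite (_ : _ @^-1` _ = f k @^-1` [set z] `&` (fun w => [seq f k w | k <- ks]) @^-1` [set l]).
    exact: measurableI.
  by apply/seteqP; split=> w /=; [case=> -> ->|case=> -> ->].
Qed.

Lemma measurable_tcode_graft h i m (F : nat -> X -> trees n) z :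
  (forall k z, measurable (F k @^-1` (tcode h @^-1` [set z]))) ->
  measurable ((fun w => graft_fun i (F^~ w) m) @^-1` (tcode h.+1 @^-1` [set z])).
Proof.
move=> mF; pose g w := [seq tcode h (F k w) | k <- iota 0 m].
rewrite (_ : _ @^-1` _ = g @^-1` [set l | GenTree.Node i (csort l) = z]).
  apply: (@measurable_count_preimage _ _ (seq code)) => l.
  exact: (measurable_map_code (f := fun k w => tcode h (F k w))).
by apply/seteqP; split=> w /=; rewrite tcode_graft_fun.
Qed.

Lemma measurable_tcode h (F : X -> trees n) Z : measurable_fun setT F ->
  measurable (F @^-1` (tcode h @^-1` Z)).
Proof.
move=> mF; apply: measurable_preimage => //.
exact: tcode_measurable.
Qed.

Lemma measurable_graft_fun i m (F : nat -> X -> trees n) :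
  (forall k, measurable_fun setT (F k)) ->
  measurable_fun setT (fun w => graft_fun i (F^~ w) m).
Proof.
move=> mF; apply: measurable_fun_trees => -[|h] z.
  have [<-|ne] := pselect (GenTree.Node i [::] = z).
    by rewrite (_ : _ @^-1` _ = setT) //; apply/seteqP; split=> w //= _; rewrite tcode_class.
  rewrite (_ : _ @^-1` _ = set0) //; apply/seteqP; split=> w //=.
  by rewrite tcode_class => e; apply: ne; rewrite -e.
by apply: measurable_tcode_graft => k {}z; exact: measurable_tcode.
Qed.

(** Induction on the radius, for all families [xi] at once since branches are driven by shifted
    ones. Splitting according to the offspring vector of the root makes the types of the children
    deterministic. *)
Lemma measurable_gw_tree (xi : seq nat * 'I_n.+1 -> X -> counts n) i :
  (forall a c, measurable (xi a @^-1` [set c])) ->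
  measurable_fun setT (fun w => gw_tree i (xi^~ w)).
Proof.
move=> mxi; apply: measurable_fun_trees => h z.
elim: h xi mxi i z => [|h IH] xi mxi i z.
  have [<-|ne] := pselect (GenTree.Node i [::] = z).
    by rewrite (_ : _ @^-1` _ = setT) //; apply/seteqP; split=> w //= _; rewrite tcode_class.
  rewrite (_ : _ @^-1` _ = set0) //; apply/seteqP; split=> w //=.
  by rewrite tcode_class => e; apply: ne; rewrite -e.
pose F c k w := gw_tree (nth i (child_types c) k) (fun a => xi (k :: a.1, a.2) w).
rewrite (_ : _ @^-1` _ = \bigcup_c (xi ([::], i) @^-1` [set c] `&`
   (fun w => graft_fun i ((F c)^~ w) (csize c)) @^-1` (tcode h.+1 @^-1` [set z]))).
  apply: countable_bigcupT_measurable; first exact: countableP.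
  move=> c; apply: measurableI => //.
  apply: measurable_tcode_graft => k {}z.
  exact: (IH (fun a => xi (k :: a.1, a.2))).
apply/seteqP; split=> [w /= e|w [c _ [/= xc e]]].
  by exists (xi ([::], i) w) => //; split=> //=; rewrite -[RHS]e gw_tree_graft.
by rewrite gw_tree_graft xc.
Qed.

End Measurability.

Section GaltonWatson.
Variables (R : realType) (q : 'I_n.+1 -> counts n -> R).

(** The first three clauses of [GW_from], separated because they pass to the individuals below a
    child ([iid_shift]). *)
Definition iid_offspring d (Om : measurableType d) (P : probability Om R)
    (xi : seq nat * 'I_n.+1 -> Om -> counts n) :=
  [/\ (forall uj B, measurable (xi uj @^-1` B)),
      (forall uj c, P (xi uj @^-1` [set c]) = (q uj.2 c)%:E)
    & independent P setT xi].

Lemma independent_comp d (Om : measurableType d) (P : probability Om R)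
    (I J : eqType) U (M : set_system U) (X : I -> Om -> U) (g : J -> I) :
  injective g -> M setT -> independent P M X -> independent P M (X \o g).
Proof.
move=> gi MT ind s B us MB.
(* Indices outside the range of [g] receive the event [setT]. *)
have /choice[B' B'P] : forall a, exists D, M D /\ (forall b, g b = a -> D = B b).
  move=> a; have [[b <-]|nb] := pselect (exists b, g b = a).
    by exists (B b); split=> // c /gi ->.
  by exists setT; split=> // b e; case: nb; exists b.
have B'g b : B' (g b) = B b by apply: (B'P (g b)).2.
have := ind (map g s) B'; rewrite map_inj_uniq // big_map => /(_ us (fun a => (B'P a).1)).
rewrite (eq_bigr (fun a => fine (P ((X \o g) a @^-1` B a)))) => [|b _]; last by rewrite B'g.
move=> <-; congr (fine (P _)); apply/seteqP; split=> w.
  by move=> h _ /= /mapP[b bs ->]; rewrite B'g; exact: h.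
by move=> h b /= bs; rewrite -B'g; apply: h; rewrite /= map_f.
Qed.

Lemma iid_shift k d (Om : measurableType d) (P : probability Om R)
    (xi : seq nat * 'I_n.+1 -> Om -> counts n) :
  iid_offspring P xi -> iid_offspring P (fun a => xi (k :: a.1, a.2)).
Proof.
move=> [mxi qxi ind]; split=> [uj B|uj c|].
- exact: mxi.
- exact: qxi.
- apply: (independent_comp (g := fun a : seq nat * 'I_n.+1 => (k :: a.1, a.2))) => //.
  by move=> [u a] [v b] /= [-> ->].
Qed.

Section Forest.
Variables (d : measure_display) (Om : measurableType d) (P : probability Om R).
Variable xi : seq nat * 'I_n.+1 -> Om -> counts n.
Hypothesis iid : iid_offspring P xi.

(* The k-th tree of the forest grows from a root of type ts_k, using the offspring
   vectors of the individuals below the (g k)-th child of the root. *)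
Definition forest i (ts : seq 'I_n.+1) (g : nat -> nat) (k : nat) (w : Om) : trees n :=
  gw_tree (nth i ts k) (fun a => xi (g k :: a.1, a.2) w).

Definition branch k : set (seq nat * 'I_n.+1) := [set a | exists u, a.1 = k :: u].

Let mxi a B : measurable (xi a @^-1` B). Proof. by case: iid. Qed.
Let ind : independent P setT xi. Proof. by case: iid. Qed.

Lemma measurable_gw i : measurable_fun setT (fun w => gw_tree i (xi^~ w)).
Proof. exact: measurable_gw_tree. Qed.

Lemma measurable_forest i ts g k : measurable_fun setT (forest i ts g k).
Proof. exact: (measurable_gw_tree (xi := fun a => xi (g k :: a.1, a.2))). Qed.

(** The Galton-Watson tree is measurable for any sigma-field that makes its offspring vectors
    measurable; here [Om] is given the one generated by the variables below child [g k]. *)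
Lemma forest_event i ts g k B : measurable B ->
  events xi (branch (g k)) (forest i ts g k @^-1` B).
Proof.
move=> mB.
have mf : measurable_fun setT (forest i ts g k : g_sigma_algebraType (boxes xi (branch (g k))) -> _).
  apply: (@measurable_gw_tree _ (g_sigma_algebraType (boxes xi (branch (g k))))
    (fun a => xi (g k :: a.1, a.2))) => a c.
  by apply: events1; exists a.1.
exact: (measurable_preimage mf mB).
Qed.

Lemma branch_disjoint k l a : branch k a -> branch l a -> k = l.
Proof. by move=> [u e] [v]; rewrite e => -[]. Qed.

Lemma forest_independent i ts g : injective g -> independent P measurable (forest i ts g).
Proof.
move=> gi s B us mB.
have := @events_prod R _ Om P _ _ xi mxi ind _ (fun k => branch (g k))
  (fun k => forest i ts g k @^-1` B k) s us.
case=> [k l a ka la|k|-> _]; first exact: gi (branch_disjoint ka la).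
  exact: forest_event.
elim: s {us} => [|k s IH]; first by rewrite !big_nil.
rewrite !big_cons fineM ?IH //.
  by apply: fin_num_measure; apply: measurable_preimage => //; exact: measurable_forest.
rewrite big_seq; apply: prode_fin_num => // l _.
by apply: fin_num_measure; apply: measurable_preimage => //; exact: measurable_forest.
Qed.

Definition branches (g : nat -> nat) : set (seq nat * 'I_n.+1) :=
  [set a | exists k u, a.1 = g k :: u].

Lemma forest_graft_event i l ts g b m B : measurable B ->
  events xi (branches (g \o b))
    ((fun w => graft_fun i (fun k => forest l ts g (b k) w) m) @^-1` B).
Proof.
move=> mB.
have mf : measurable_fun setT
    ((fun w => graft_fun i (fun k => forest l ts g (b k) w) m) :
       g_sigma_algebraType (boxes xi (branches (g \o b))) -> _).
  apply: (@measurable_graft_fun _ (g_sigma_algebraType (boxes xi (branches (g \o b))))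
    i m (fun k => forest l ts g (b k))) => k.
  apply: (@measurable_gw_tree _ (g_sigma_algebraType (boxes xi (branches (g \o b))))
    (fun a => xi (g (b k) :: a.1, a.2))) => a c.
  by apply: events1; exists k, a.1.
exact: (measurable_preimage mf mB).
Qed.

(** The branching property. The offspring vector of the root uses the empty word and the branches
    use nonempty words, so they are independent; once the vector is [c], the tree is the graft of a
    forest with types [child_types c]. *)
Lemma gw_branching i (A : set (trees n)) : measurable A ->
  (P [set w | A (gw_tree i (xi^~ w))] =
   \esum_(c in setT) (q i c)%:E *
     P ((fun w => graft_fun i ((forest i (child_types c) id)^~ w) (csize c)) @^-1` A))%E.
Proof.
move=> mA.
have mE : measurable [set w | A (gw_tree i (xi^~ w))].
  exact: (measurable_preimage (@measurable_gw i) mA).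
rewrite (@measure_esum _ _ _ P (counts n) (xi ([::], i))) //.
apply: eq_esum => c _.
have [_ qxi _] := iid; rewrite -(qxi ([::], i) c).
rewrite -(@events_indep R _ Om P _ _ xi mxi ind [set ([::], i)] (branches id)).
- congr (P _); apply/seteqP; split=> w /= [].
    by rewrite gw_tree_graft => e xc; split=> //; rewrite -xc.
  by move=> xc e; split=> //; rewrite gw_tree_graft xc.
- by apply/disj_setPS => a [/= -> [k [u]]].
- exact: events1.
- exact: (forest_graft_event i _ _ (g := id) (b := id)).
Qed.

End Forest.

(** Independence of the first [m] trees, the only ones that enter a graft with [m] children. *)
Definition indep_upto d (Om : measurableType d) (P : probability Om R) m
    (F : nat -> Om -> trees n) := forall B : nat -> set (trees n),
  (forall k, measurable (B k)) ->
  P (\bigcap_(k in [set` iota 0 m]) F k @^-1` B k) = (\prod_(k <- iota 0 m) P (F k @^-1` B k))%E.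

(** * The law of a graft depends only on the laws of its independent branches *)

Section GraftLaw.
Variables (d d' : measure_display) (Om : measurableType d) (Om' : measurableType d').
Variables (P : probability Om R) (P' : probability Om' R) (m : nat).
Variables (F : nat -> Om -> trees n) (F' : nat -> Om' -> trees n).
Hypotheses (mF : forall k, measurable_fun setT (F k)).
Hypotheses (mF' : forall k, measurable_fun setT (F' k)).
Hypotheses (indF : indep_upto P m F) (indF' : indep_upto P' m F').

(** The code of the graft is a function of the list of codes of its branches. There are countably
    many lists, and prescribing one is a box event, to which independence applies. *)
Lemma graft_law_tcode h i z :
  (forall k z, (k < m)%N -> P (F k @^-1` (tcode h @^-1` [set z])) =
                            P' (F' k @^-1` (tcode h @^-1` [set z]))) ->
  P ((fun w => graft_fun i (F^~ w) m) @^-1` (tcode h.+1 @^-1` [set z])) =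
  P' ((fun w => graft_fun i (F'^~ w) m) @^-1` (tcode h.+1 @^-1` [set z])).
Proof.
move=> FF'; pose Z := [set l | GenTree.Node i (csort l) = z].
rewrite (_ : _ @^-1` _ = (fun w => [seq tcode h (F k w) | k <- iota 0 m]) @^-1` Z); last first.
  by apply/seteqP; split=> w /=; rewrite tcode_graft_fun.
rewrite [in RHS](_ : _ @^-1` _ = (fun w => [seq tcode h (F' k w) | k <- iota 0 m]) @^-1` Z); last first.
  by apply/seteqP; split=> w /=; rewrite tcode_graft_fun.
apply: (@count_law_eq R _ _ P _ _ P' (seq code)).
- move=> l; apply: (measurable_map_code (f := fun k w => tcode h (F k w))) => k y.
  exact: (@measurable_tcode _ _ h (F k) [set y] (mF k)).
- move=> l; apply: (measurable_map_code (f := fun k w => tcode h (F' k w))) => k y.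
  exact: (@measurable_tcode _ _ h (F' k) [set y] (mF' k)).
move=> l; have [sl|nsl] := eqVneq (size l) m; last first.
  rewrite (_ : _ @^-1` _ = set0); last first.
    apply/seteqP; split=> w //= e; move: nsl.
    by rewrite -e size_map size_iota eqxx.
  rewrite measure0 (_ : _ @^-1` _ = set0) ?measure0 //.
  apply/seteqP; split=> w //= e; move: nsl.
  by rewrite -e size_map size_iota eqxx.
have z0 : code := GenTree.Leaf 0%N.
pose B k := @tcode n h @^-1` [set nth z0 l k].
have box (Om0 : Type) (F0 : nat -> Om0 -> trees n) :
    (fun w => [seq tcode h (F0 k w) | k <- iota 0 m]) @^-1` [set l] =
    \bigcap_(k in [set` iota 0 m]) F0 k @^-1` B k.
  apply/seteqP; split=> w /=.
    move=> e k /=; rewrite mem_iota /B /= add0n -e => km.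
    by rewrite (nth_map 0%N) ?size_iota // nth_iota.
  move=> e; apply: (@eq_from_nth _ z0); first by rewrite size_map size_iota.
  move=> k; rewrite size_map size_iota => km.
  rewrite (nth_map 0%N) ?size_iota // nth_iota // add0n.
  by apply: e; rewrite /= mem_iota.
have mB k : measurable (B k) by exact: tcode_measurable.
rewrite !box; transitivity (\prod_(k <- iota 0 m) P (F k @^-1` B k))%E; first exact: indF.
transitivity (\prod_(k <- iota 0 m) P' (F' k @^-1` B k))%E; last exact/esym/indF'.
rewrite big_seq [RHS]big_seq; apply: eq_bigr => k; rewrite mem_iota /= add0n => km.
exact: FF'.
Qed.

Lemma graft_law i : (forall k A, (k < m)%N -> measurable A -> P (F k @^-1` A) = P' (F' k @^-1` A)) ->
  forall A, measurable A -> P ((fun w => graft_fun i (F^~ w) m) @^-1` A) =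
    P' ((fun w => graft_fun i (F'^~ w) m) @^-1` A).
Proof.
move=> FF' A mA.
rewrite -(lawE P (measurable_graft_fun i m mF)) -(lawE P' (measurable_graft_fun i m mF')).
apply: trees_measure_unique => // [|h {mA}A dA].
  by rewrite [ltLHS](_ : _ = 1%E) ?ltry //; exact: probability_setT.
change (P ((fun w => graft_fun i (F^~ w) m) @^-1` A) =
        P' ((fun w => graft_fun i (F'^~ w) m) @^-1` A)).
have dA' := determined_le (leqnSn h) dA.
rewrite (_ : A = tcode h.+1 @^-1` [set tcode h.+1 t | t in A]); last first.
  apply/seteqP; split=> t; first by exists t.
  by move=> [s As e]; apply: dA' As.
pose Z := [set tcode h.+1 t | t in A].
apply: (@count_law_eq R _ _ P _ _ P' code (fun w => tcode h.+1 (graft_fun i (F^~ w) m))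
  (fun w => tcode h.+1 (graft_fun i (F'^~ w) m)) _ _ _ Z) => z.
- exact: (@measurable_tcode _ _ h.+1 _ [set z] (measurable_graft_fun i m mF)).
- exact: (@measurable_tcode _ _ h.+1 _ [set z] (measurable_graft_fun i m mF')).
- apply: graft_law_tcode => k {}z km; apply: FF' => //.
  exact: tcode_measurable.
Qed.

End GraftLaw.

End GaltonWatson.
End RandomTrees.


(** * Grafted Galton-Watson trees and the walk *)

Section ChildTypes.
Variable n : nat.
Implicit Types (i j : 'I_n.+1) (c : counts n).

(** The vector c - e_j; if c j = 0, truncated subtraction returns [c] itself, so sums over [j] need
    a weight that vanishes there. *)
Definition remove_count c j : counts n := [ffun k => (c k - (k == j))%N].

Lemma child_types_sorted c : sorted (fun i j : 'I_n.+1 => (i <= j)%N) (child_types c).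
Proof.
have tr : transitive (fun i j : 'I_n.+1 => (i <= j)%N) by move=> y x z; exact: leq_trans.
have enum_sorted : pairwise (fun i j : 'I_n.+1 => (i <= j)%N) (enum 'I_n.+1).
  rewrite -sorted_pairwise //.
  by have := iota_sorted 0 n.+1; rewrite -val_enum_ord sorted_map.
rewrite sorted_pairwise // /child_types.
elim: (enum 'I_n.+1) enum_sorted => //= j s IH /andP[js ss].
rewrite pairwise_cat IH // andbT; apply/andP; split.
  apply/allrelP => x y; rewrite mem_nseq => /andP[_ /eqP ->].
  case/flattenP => t /mapP[k ks ->]; rewrite mem_nseq => /andP[_ /eqP ->].
  by move/allP : js => /(_ k ks).
by elim: (c j) => //= m ->; rewrite andbT; apply/allP => x; rewrite mem_nseq => /andP[_ /eqP ->].
Qed.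

(** The list without its k-th entry is still sorted and has the counts of the smaller vector; a
    sorted list is determined by its counts. *)
Lemma remove_child_type i c k m : (k < csize c)%N ->
  nth i (child_types (remove_count c (nth i (child_types c) k))) m =
  nth i (child_types c) (bump k m).
Proof.
rewrite -size_child_types => kc; set j := nth i (child_types c) k.
have cE : child_types c = take k (child_types c) ++ j :: drop k.+1 (child_types c).
  by rewrite -drop_nth // cat_take_drop.
set L := take k (child_types c) ++ drop k.+1 (child_types c).
suff -> : child_types (remove_count c j) = L.
  rewrite /L nth_cat size_take kc /bump; case: leqP => km /=.
    by rewrite nth_drop; congr (nth _ _ _); lia.
  by rewrite nth_take.
apply: (@sorted_eq _ (fun i j : 'I_n.+1 => (i <= j)%N)).
- by move=> y x z; exact: leq_trans.
- by move=> x y; rewrite -eqn_leq => /eqP /val_inj.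
- exact: child_types_sorted.
- apply: subseq_sorted (child_types_sorted c); first by move=> y x z; exact: leq_trans.
  by rewrite [X in subseq _ X]cE; apply: cat_subseq => //; exact: subseq_cons.
- apply/allP => x _; rewrite /= count_child_types ffunE.
  have -> : c x = (count_mem x (take k (child_types c)) +
      ((x == j) + count_mem x (drop k.+1 (child_types c))))%N.
    by rewrite -(count_child_types c x) [in LHS]cE count_cat /= eq_sym.
  by rewrite /L count_cat addnCA addKn.
Qed.

Lemma csize_remove_count c j : (0 < c j)%N -> csize (remove_count c j) = (csize c).-1.
Proof.
move=> cj; rewrite /csize (bigD1 j) //= [in RHS](bigD1 j) //= ffunE eqxx.
rewrite (eq_bigr c); last by move=> k /negbTE kj; rewrite ffunE kj subn0.
by rewrite -[in RHS]subn1 addnBAC.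
Qed.

Lemma child_types_gt0 i c k : (k < csize c)%N -> (0 < c (nth i (child_types c) k))%N.
Proof.
rewrite -size_child_types => kc.
by rewrite -count_child_types -has_count has_pred1 mem_nth.
Qed.

Lemma sum_child_types (R : realType) c (f : 'I_n.+1 -> \bar R) : (forall j, 0 <= f j)%E ->
  (\sum_(j <- child_types c) f j = \sum_j (c j)%:R%:E * f j)%E.
Proof.
move=> f0; rewrite big_flatten big_map big_enum; apply: eq_bigr => j _ /=.
elim: (c j) => [|m IH]; first by rewrite big_nil mul0e.
by rewrite big_cons IH -natr1 EFinD ge0_muleDl ?mul1e ?lee_fin // addeC.
Qed.

End ChildTypes.

Section GaltonWatsonLaw.
Variables (n : nat) (R : realType) (q : 'I_n.+1 -> counts n -> R).
Implicit Types (i j : 'I_n.+1) (c : counts n).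

Lemma independent_indep_upto d (Om : measurableType d) (P : probability Om R) m
    (F : nat -> Om -> trees n) : (forall k, measurable_fun setT (F k)) ->
  independent P measurable F -> indep_upto P m F.
Proof.
move=> mF ind B mB.
have fin k : P (F k @^-1` B k) \is a fin_num.
  by apply: fin_num_measure; exact: measurable_preimage.
have fin' : P (\bigcap_(k in [set` iota 0 m]) F k @^-1` B k) \is a fin_num.
  apply: fin_num_measure; apply: fin_bigcap_measurable => // k _.
  exact: measurable_preimage.
rewrite -[LHS]fineK // ind ?iota_uniq // -[RHS]fineK; last first.
  by apply: prode_fin_num => k _; exact: fin.
congr EFin; elim: (iota 0 m) => [|k s IH]; first by rewrite !big_nil.
by rewrite !big_cons fineM ?IH //; apply: prode_fin_num => l _; exact: fin.
Qed.

(** Induction on the radius: at 0 the code is constant, and the branching property expresses radius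
    [h.+1] by [q] and the laws of the branches at radius [h]. *)
Lemma gw_law_tcode h i d (Om : measurableType d) (P : probability Om R) xi
    d' (Om' : measurableType d') (P' : probability Om' R) xi' z :
  iid_offspring q P xi -> iid_offspring q P' xi' ->
  P ((fun w => gw_tree i (xi^~ w)) @^-1` (tcode h @^-1` [set z])) =
  P' ((fun w => gw_tree i (xi'^~ w)) @^-1` (tcode h @^-1` [set z])).
Proof.
elim: h i xi xi' z => [|h IH] i xi xi' z iid iid'.
  have const (Om0 : Type) (xi0 : seq nat * 'I_n.+1 -> Om0 -> counts n) :
      (fun w => gw_tree i (xi0^~ w)) @^-1` (tcode 0 @^-1` [set z]) =
      if `[< GenTree.Node i [::] = z >] then setT else set0.
    case: asboolP => e; apply/seteqP; split=> w //=; rewrite tcode_class //.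
  by rewrite !const; case: ifP => _; rewrite ?probability_setT ?measure0.
rewrite (gw_branching iid i (tcode_measurable (n := n) h.+1 [set z])).
rewrite (gw_branching iid' i (tcode_measurable (n := n) h.+1 [set z])).
apply: eq_esum => c _; congr (_ * _)%E.
apply: graft_law_tcode.
- by move=> k; exact: measurable_forest iid _ _ _ _.
- by move=> k; exact: measurable_forest iid' _ _ _ _.
- apply: independent_indep_upto; last exact: (forest_independent iid i _ (@inj_id nat)).
  by move=> k; exact: measurable_forest iid _ _ _ _.
- apply: independent_indep_upto; last exact: (forest_independent iid' i _ (@inj_id nat)).
  by move=> k; exact: measurable_forest iid' _ _ _ _.
- by move=> k y km; apply: (IH _ (fun a => xi (k :: a.1, a.2)) (fun a => xi' (k :: a.1, a.2)));
    exact: iid_shift.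
Qed.

Lemma gw_law_unique i d (Om : measurableType d) (P : probability Om R) xi
    d' (Om' : measurableType d') (P' : probability Om' R) xi' :
  iid_offspring q P xi -> iid_offspring q P' xi' ->
  forall A, measurable A ->
  P ((fun w => gw_tree i (xi^~ w)) @^-1` A) = P' ((fun w => gw_tree i (xi'^~ w)) @^-1` A).
Proof.
move=> iid iid' A mA.
pose m1 : {measure set (trees n) -> \bar R} := law P (measurable_gw iid i).
pose m2 : {measure set (trees n) -> \bar R} := law P' (measurable_gw iid' i).
suff : m1 A = m2 A by [].
apply: trees_measure_unique => // [|h {mA}A dA].
  by rewrite [ltLHS](_ : _ = 1%E) ?ltry //; exact: (probability_setT (law P (measurable_gw iid i))).
change (P ((fun w => gw_tree i (xi^~ w)) @^-1` A) = P' ((fun w => gw_tree i (xi'^~ w)) @^-1` A)).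
rewrite (_ : A = tcode h @^-1` [set tcode h t | t in A]); last first.
  apply/seteqP; split=> t; first by exists t.
  by move=> [s As e]; apply: dA As.
pose Z := [set tcode h t | t in A].
apply: (@count_law_eq R _ _ P _ _ P' code (fun w => tcode h (gw_tree i (xi^~ w)))
  (fun w => tcode h (gw_tree i (xi'^~ w))) _ _ _ Z) => z.
- exact: (@measurable_tcode _ _ _ h _ [set z] (measurable_gw iid i)).
- exact: (@measurable_tcode _ _ _ h _ [set z] (measurable_gw iid' i)).
- exact: gw_law_tcode.
Qed.

Section Model.
Variables (d : measure_display) (Om : measurableType d) (P : probability Om R).
Variable xi : seq nat * 'I_n.+1 -> Om -> counts n.
Hypothesis iid : iid_offspring q P xi.

Definition gw_law i : probability (trees n) R := law P (measurable_gw iid i).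

Definition star i c (w : Om) : trees n :=
  graft_fun i ((forest xi i (child_types c) id)^~ w) (csize c).

Arguments gw_law : simpl never.

Lemma measurable_star i c : measurable_fun setT (star i c).
Proof. by apply: measurable_graft_fun => k; exact: measurable_forest iid _ _ _ _. Qed.

Definition star_law i c : probability (trees n) R := law P (measurable_star i c).

Arguments star_law : simpl never.

Lemma gw_law_star i A : measurable A ->
  (gw_law i A = \esum_(c in setT) (q i c)%:E * star_law i c A)%E.
Proof. exact: (gw_branching iid i). Qed.

Lemma forest_law i ts g k A : measurable A ->
  P (forest xi i ts g k @^-1` A) = gw_law (nth i ts k) A.
Proof. by move=> mA; apply: gw_law_unique => //; exact: iid_shift. Qed.

(** Recognizes gam_(i,c) in a family on another space, as in [sim_g], and in a forest deprived of
    one of its trees. *)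
Lemma star_law_unique i c d' (Om' : measurableType d') (P' : probability Om' R) F :
  (forall k, measurable_fun setT (F k)) -> indep_upto P' (csize c) F ->
  (forall k A, (k < csize c)%N -> measurable A ->
     P' (F k @^-1` A) = gw_law (nth i (child_types c) k) A) ->
  forall A, measurable A ->
  P' ((fun w => graft_fun i (F^~ w) (csize c)) @^-1` A) = star_law i c A.
Proof.
move=> mF indF FE A mA; apply: graft_law => //.
- by move=> k; exact: measurable_forest iid _ _ _ _.
- apply: independent_indep_upto; last exact: (forest_independent iid i _ (@inj_id nat)).
  by move=> k; exact: measurable_forest iid _ _ _ _.
- by move=> k B kc mB; rewrite FE // forest_law.
Qed.

Lemma GW_from_law i lam : GW_from q i lam ->
  forall A, measurable A -> lam A = fine (gw_law i A).
Proof.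
move=> [d' [Om' [P' [xi' [h1 h2 h3 h4]]]]] A mA; rewrite h4 //; congr fine.
exact: (gw_law_unique i (And3 h1 h2 h3) iid).
Qed.

(* A tree with a distinguished edge at its root splits into the two sides s and t of
   the edge; a step of the walk along this edge turns join s t into join t s. *)
Definition edge_event (A B : set (trees n)) : set (trees n * trees n) :=
  [set st | A (join st.1 st.2) /\ B (join st.2 st.1)].

Lemma measurable_edge_event A B : measurable A -> measurable B ->
  measurable (edge_event A B).
Proof.
move=> mA mB; apply: measurableI.
  exact: (measurable_preimage (@measurable_join n) mA).
have mswap : measurable_fun setT (fun st : trees n * trees n => join st.2 st.1).
  apply: (measurableT_comp (f := fun st : trees n * trees n => join st.1 st.2)
    (g := fun st => (st.2, st.1))); first exact: measurable_join.
  by apply: measurable_fun_pair; [exact: measurable_snd|exact: measurable_fst].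
exact: (measurable_preimage mswap mB).
Qed.

(** The sides of the edge to child [k] use the individuals outside and inside branch [k], hence are
    independent; by uniqueness of product measures, rectangles suffice. *)
Lemma star_branch_law i c k (C : set (trees n * trees n)) : (k < csize c)%N -> measurable C ->
  P [set w | C (graft_fun i ((forest xi i (child_types c) id)^~ w \o bump k) (csize c).-1,
               forest xi i (child_types c) id k w)] =
  (star_law i (remove_count c (nth i (child_types c) k)) \x
   gw_law (nth i (child_types c) k))%E C.
Proof.
move=> kc mC; set j := nth i _ k.
pose F m := forest xi i (child_types c) id (bump k m).
pose Y w := graft_fun i (F^~ w) (csize c).-1.
pose X := forest xi i (child_types c) id k.
have mF m : measurable_fun setT (F m) by exact: measurable_forest iid _ _ _ _.
have mY : measurable_fun setT Y by apply: measurable_graft_fun.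
have mX : measurable_fun setT X by exact: measurable_forest iid _ _ _ _.
have mYX : measurable_fun setT (fun w => (Y w, X w)) by exact: measurable_fun_pair.
have cj : (0 < c j)%N by exact: child_types_gt0.
have csj : csize (remove_count c j) = (csize c).-1 by exact: csize_remove_count.
have YE A : measurable A -> P (Y @^-1` A) = star_law i (remove_count c j) A.
  move=> mA; rewrite /Y -csj; apply: star_law_unique => //.
    apply: independent_indep_upto => //.
    apply: (independent_comp (X := forest xi i (child_types c) id) (g := bump k)).
    - exact: (can_inj (bumpK k)).
    - exact: measurableT.
    - exact: (forest_independent iid i _ (@inj_id nat)).
  move=> m B mc mB; rewrite forest_law // remove_child_type //.
apply/esym; pose m' : {measure set _ -> \bar R} := law P mYX.
suff -> : (star_law i (remove_count c j) \x gw_law j)%E C = m' C by [].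
apply: product_measure_unique => // A B mA mB.
transitivity (P (Y @^-1` A `&` X @^-1` B)); first by [].
case: iid => mxi _ ind.
rewrite (@events_indep R _ Om P _ _ xi mxi ind (branches (bump k)) (branch k)).
- by congr (_ * _)%E; [exact: YE|exact: forest_law].
- by apply/disj_setPS => a [[l [u e]] [v]]; rewrite e => -[/eqP]; rewrite eq_sym (negbTE (neq_bump _ _)).
- exact: (forest_graft_event (xi := xi) i i (child_types c) (g := id) (b := bump k) _ mA).
- exact: (forest_event (xi := xi) i (child_types c) (g := id)).
Qed.

(** For each child the event of starting in [A] and landing in [B] is [edge_event A B] for the two
    sides of its edge; equal terms are then grouped by the type of the child. If [c] is zero, both
    sides are 0 by the convention for division by 0. *)
Lemma walk_star i c (A B : set (trees n)) : measurable A -> measurable B ->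
  (\int[star_law i c]_(t in A) (walk R t B)%:E =
   \sum_j ((c j)%:R / (csize c)%:R)%:E *
     (star_law i (remove_count c j) \x gw_law j) (edge_event A B))%E.
Proof.
move=> mA mB.
have mwalk : measurable_fun A (fun t : trees n => (walk R t B)%:E).
  apply: measurable_funTS; apply/measurable_EFinP; exact: measurable_walk.
rewrite (ge0_integral_pushforward (measurable_star i c)) //; last first.
  by move=> t _; rewrite lee_fin walk_ge0.
pose r : R := (csize c)%:R^-1.
have r0 : 0 <= r by rewrite invr_ge0.
pose F := forest xi i (child_types c) id.
pose E k := [set w | B (join (F k w) (graft_fun i (F^~ w \o bump k) (csize c).-1))].
have mE k : measurable (E k).
  apply: (measurable_preimage (f := fun w => join (F k w) (graft_fun i (F^~ w \o bump k) (csize c).-1))) mB.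
  apply: (measurableT_comp (f := fun st : trees n * trees n => join st.1 st.2)
    (g := fun w => (F k w, graft_fun i (F^~ w \o bump k) (csize c).-1))).
    exact: measurable_join.
  apply: measurable_fun_pair; first exact: measurable_forest iid _ _ _ _.
  by apply: measurable_graft_fun => l; exact: measurable_forest iid _ _ _ _.
have mG : measurable (star i c @^-1` A) by exact: measurable_preimage (measurable_star i c) mA.
transitivity (\int[P]_(w in star i c @^-1` A) \sum_(k <- iota 0 (csize c)) (r%:E * (\1_(E k) w)%:E))%E.
  apply: eq_integral => w _ /=; rewrite walk_graft_fun /index_iota subn0 mulrC.
  rewrite EFinM -ge0_sume_distrr; last by move=> k _; rewrite lee_fin indicE.
  by rewrite -sumEFin.
rewrite ge0_integral_sum //; last 2 first.
- move=> k; apply: measurable_funTS; apply: emeasurable_funM; first exact: measurable_cst.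
  by apply/measurable_EFinP; exact: measurable_indic.
- by move=> k w _; rewrite mule_ge0 ?lee_fin ?indicE.
transitivity (\sum_(j <- child_types c) (r%:E *
   (star_law i (remove_count c j) \x gw_law j) (edge_event A B)))%E.
  rewrite (big_nth i) size_child_types /index_iota subn0 big_seq [RHS]big_seq.
  apply: eq_bigr => k; rewrite mem_iota add0n => /andP[_ kc].
  have mEk : measurable_fun (star i c @^-1` A) (fun w => (\1_(E k) w)%:E : \bar R).
    by apply: measurable_funTS; apply/measurable_EFinP; exact: measurable_indic.
  rewrite ge0_integralZl //.
  rewrite integral_indic // -star_branch_law //; last exact: measurable_edge_event.
  congr (_ * P _)%E; apply/seteqP; split=> w /=; rewrite /E /star /edge_event /= -/F.
  + case=> wB wA; split=> //; rewrite join_graft_fun; first by rewrite prednK // (leq_ltn_trans _ kc).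
    by rewrite prednK // (leq_ltn_trans _ kc).
  + case=> wA wB; split=> //; move: wA; rewrite join_graft_fun prednK // (leq_ltn_trans _ kc) //.
rewrite sum_child_types; last by move=> j; rewrite mule_ge0 ?lee_fin // measure_ge0.
by apply: eq_bigr => j _; rewrite EFinM muleA.
Qed.

End Model.
End GaltonWatsonLaw.


(** * Multinomial distributions *)

Lemma esumZl (R : realType) (K : countType) (D : set K) (r : R) (f : K -> \bar R) :
  0 <= r -> (forall x, D x -> 0 <= f x)%E ->
  (\esum_(x in D) (r%:E * f x) = r%:E * \esum_(x in D) f x)%E.
Proof.
move=> r0 f0; rewrite esum_mkcond [in RHS]esum_mkcond.
have g0 x : (0 <= (if x \in D then f x else 0))%E.
  by case: ifPn => // /set_mem /f0.
rewrite (_ : \esum_(_ in _) _ = \esum_(x in [set: K]) (r%:E * (if x \in D then f x else 0)))%E.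
  rewrite !esum_count //; last by move=> x; rewrite mule_ge0 ?lee_fin.
  rewrite -nneseriesZl; last by move=> k _; case: choice.pickle_inv => //= x; exact: g0.
  by apply: eq_eseriesr => k _; case: choice.pickle_inv => //=; rewrite mule0.
by apply: eq_esum => x _; case: ifP => // _; rewrite mule0.
Qed.

Section Counts.
Variable n : nat.
Implicit Types (i j k : 'I_n.+1) (b c : counts n).

Definition add_count c j : counts n := [ffun k => (c k + (k == j))%N].

Lemma add_countK c j : remove_count (add_count c j) j = c.
Proof. by apply/ffunP => k; rewrite !ffunE addnK. Qed.

Lemma remove_countK c j : (0 < c j)%N -> add_count (remove_count c j) j = c.
Proof.
by move=> cj; apply/ffunP => k; rewrite !ffunE; case: eqP => [->|_]; rewrite ?subn0 ?addn0 // subnK.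
Qed.

Lemma csize_add_count c j : csize (add_count c j) = (csize c).+1.
Proof.
rewrite /csize; under eq_bigr do rewrite ffunE; rewrite big_split /=.
rewrite (_ : \sum_k (k == j) = 1)%N ?addn1 //.
by rewrite (bigD1 j) //= eqxx big1 // => k /negbTE ->.
Qed.

Lemma add_count_gt0 c j : (0 < add_count c j j)%N.
Proof. by rewrite ffunE eqxx addn1. Qed.

Lemma add_count_self c j : add_count c j j = (c j).+1.
Proof. by rewrite ffunE eqxx addn1. Qed.

Lemma add_countC c j k : add_count (add_count c j) k = add_count (add_count c k) j.
Proof. by apply/ffunP => l; rewrite !ffunE addnAC. Qed.

(** The substitution c = b + e_j, for fixed [j] a bijection from [D'] onto the vectors of [D] with a
    positive entry at [j]. *)
Lemma esum_remove_count (R : realType) (D D' : set (counts n))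
    (f : 'I_n.+1 -> counts n -> \bar R) :
  (forall b j, D (add_count b j) <-> D' b) -> (forall j b, 0 <= f j b)%E ->
  (\esum_(c in D) \sum_(j | (0 < c j)%N) f j (remove_count c j) =
   \sum_j \esum_(b in D') f j b)%E.
Proof.
move=> DD' f0.
under eq_esum do rewrite big_mkcond /=.
rewrite esum_sum; last by move=> c j _ _; case: ifP.
apply: eq_bigr => j _.
transitivity (\esum_(c in D `&` [set c : counts n | (0 < c j)%N]) f j (remove_count c j))%E.
  rewrite esum_mkcondr; apply: eq_esum => c _.
  by congr (if _ then _ else _); apply/idP/idP; rewrite inE.
rewrite (@reindex_esum _ _ _ D' _ (fun b => add_count b j)).
  by apply: eq_esum => b _; rewrite add_countK.
split.
- by move=> b /DD' Db; split=> //=; rewrite add_count_self.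
- by move=> b b' _ _ /(congr1 (fun c => remove_count c j)); rewrite !add_countK.
- move=> c [Dc /= cj]; exists (remove_count c j); last by rewrite remove_countK.
  by apply/(DD' _ j); rewrite remove_countK.
Qed.

(** Every entry is at most [d]. Finiteness lets the finitely supported sum in [size_prob] agree with
    the extended sum. *)
Lemma finite_counts d : finite_set [set c : counts n | csize c = d].
Proof.
apply: (@sub_finite_set _ _ [set [ffun j => nat_of_ord (f j)] | f in [set: {ffun 'I_n.+1 -> 'I_d.+1}]]).
  move=> c /= cd; have cj j : (c j < d.+1)%N.
    by rewrite ltnS -cd /csize (bigD1 j) //= leq_addr.
  by exists [ffun j => Ordinal (cj j)] => //; apply/ffunP => j; rewrite !ffunE.
exact/finite_image/finite_finset.
Qed.

Section Real.
Variable R : realType.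
Implicit Types (f : counts n -> R) (p : 'I_n.+1 -> R).

Lemma size_probE f d : (forall c, 0 <= f c) ->
  ((size_prob f d)%:E = \esum_(c in [set c | csize c = d]) (f c)%:E)%E.
Proof.
move=> f0; rewrite esum_fset; [|exact: finite_counts|by move=> c _; rewrite lee_fin].
by rewrite fsumEFin //; exact: finite_counts.
Qed.

Lemma le_size_prob f d c : (forall c, 0 <= f c) -> csize c = d -> f c <= size_prob f d.
Proof.
move=> f0 cd; rewrite -lee_fin size_probE // -(@esum_set1 R _ c (fun c => (f c)%:E)) ?lee_fin //.
rewrite esum_mkcond [leRHS]esum_mkcond; apply: le_esum => b _.
case: ifPn; last by case: ifP => //; rewrite lee_fin.
rewrite inE => /= ->; rewrite mem_set //.
Qed.

Lemma size_probZ (a : R) f d : (forall c, 0 <= f c) -> 0 <= a ->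
  size_prob (fun c => a * f c) d = a * size_prob f d.
Proof.
move=> f0 a0; apply: EFin_inj; rewrite EFinM !size_probE //; last by move=> c; rewrite mulr_ge0.
by under eq_esum do rewrite EFinM; rewrite esumZl // => c _; rewrite lee_fin.
Qed.

Lemma eq_size_prob f g d : (forall c, csize c = d -> f c = g c) -> size_prob f d = size_prob g d.
Proof. by move=> fg; apply: eq_fsbigr => c /set_mem; exact: fg. Qed.

(* With the offspring law f, this is the law of the neighbours of the root under mu:
   an offspring vector plus one neighbour whose type has law p. *)
Definition child_mix p f c : R := \sum_(j | (0 < c j)%N) p j * f (remove_count c j).

Lemma child_mix_ge0 p f c : (forall j, 0 <= p j) -> (forall b, 0 <= f b) ->
  0 <= child_mix p f c.
Proof. by move=> p0 f0; apply: sumr_ge0 => j _; rewrite mulr_ge0. Qed.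

Lemma esum_child_mix p f (D D' : set (counts n)) : (forall j, 0 <= p j) -> (forall b, 0 <= f b) ->
  (forall b j, D (add_count b j) <-> D' b) ->
  (\esum_(c in D) (child_mix p f c)%:E = (\sum_j p j)%:E * \esum_(b in D') (f b)%:E)%E.
Proof.
move=> p0 f0 DD'.
under eq_esum do rewrite /child_mix -sumEFin.
rewrite (@esum_remove_count R D D' (fun j b => (p j * f b)%:E)) //; last first.
  by move=> j b; rewrite lee_fin mulr_ge0.
under eq_bigr => j _.
  under eq_esum do rewrite EFinM.
  rewrite esumZl //; last by move=> b _; rewrite lee_fin.
  over.
rewrite -sumEFin ge0_sume_distrl //= => j _; by rewrite lee_fin.
Qed.

Lemma size_prob_child_mix p f d : (forall j, 0 <= p j) -> \sum_j p j = 1 ->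
  (forall b, 0 <= f b) -> size_prob (child_mix p f) d.+1 = size_prob f d.
Proof.
move=> p0 p1 f0; apply: EFin_inj; rewrite !size_probE //; last by move=> c; exact: child_mix_ge0.
rewrite (@esum_child_mix p f _ [set c | csize c = d]) // ?p1 ?mul1e //.
by move=> b j /=; rewrite csize_add_count; split=> [[]|->].
Qed.

Definition multinomial_mass p c : R :=
  (csize c)`!%:R / (\prod_k (c k)`!)%:R * \prod_k p k ^+ c k.

Lemma prod_fact_neq0 c : (\prod_k (c k)`!)%:R != 0 :> R.
Proof. by rewrite pnatr_eq0 -lt0n prodn_gt0 // => k; exact: fact_gt0. Qed.

Lemma multinomial_mass_ge0 p c : (forall j, 0 <= p j) -> 0 <= multinomial_mass p c.
Proof. by move=> p0; rewrite mulr_ge0 ?divr_ge0 // prodr_ge0 // => k _; rewrite exprn_ge0. Qed.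

Lemma prod_add_count p b j : \prod_k p k ^+ add_count b j k = p j * \prod_k p k ^+ b k.
Proof.
rewrite (bigD1 j) //= [in RHS](bigD1 j) //= add_count_self exprS -mulrA; congr (_ * (_ * _)).
by apply: eq_bigr => k /negbTE kj; rewrite ffunE kj addn0.
Qed.

Lemma prod_fact_add_count b j :
  (\prod_k (add_count b j k)`! = (b j).+1 * \prod_k (b k)`!)%N.
Proof.
rewrite (bigD1 j) //= [in RHS](bigD1 j) //= add_count_self factS -mulnA; congr (_ * (_ * _))%N.
by apply: eq_bigr => k /negbTE kj; rewrite ffunE kj addn0.
Qed.

(** Among |b|+1 independent trials with counts b + e_j, a uniformly chosen one has outcome j with
    probability (b_j+1)/(|b|+1), and its removal leaves b. *)
Lemma multinomial_mass_add p b j :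
  multinomial_mass p (add_count b j) * (b j).+1%:R = (csize b).+1%:R * (p j * multinomial_mass p b).
Proof.
rewrite /multinomial_mass csize_add_count prod_add_count prod_fact_add_count factS !natrM.
have := prod_fact_neq0 b; have : (b j).+1%:R != 0 :> R by rewrite pnatr_eq0.
move: (b j).+1%:R (\prod_k (b k)`!)%:R ((csize b)`!)%:R => x y z x0 y0.
by field; rewrite x0 y0.
Qed.

Lemma sum_counts c : \sum_(j | (0 < c j)%N) (c j)%:R = (csize c)%:R :> R.
Proof.
rewrite /csize natr_sum [RHS](bigID (fun j => (0 < c j)%N)) /= [X in _ + X]big1 ?addr0 //.
by move=> j; rewrite -eqn0Ngt => /eqP ->.
Qed.

(** One more independent trial turns a multinomial vector into a multinomial vector. Algebraically,
    [multinomial_mass_add] is summed over [j]. *)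
Lemma child_mix_multinomial_mass p c : (0 < csize c)%N ->
  child_mix p (multinomial_mass p) c = multinomial_mass p c.
Proof.
move=> c0; have sc0 : (csize c)%:R != 0 :> R by rewrite pnatr_eq0 -lt0n.
apply: (mulfI sc0); rewrite /child_mix mulr_sumr -[in RHS]sum_counts mulr_suml.
apply: eq_bigr => j cj; have := multinomial_mass_add p (remove_count c j) j.
rewrite remove_countK // csize_remove_count // prednK // => <-.
by rewrite ffunE eqxx subn1 prednK // mulrC.
Qed.

Lemma size_prob_multinomial_mass p d : (forall j, 0 <= p j) -> \sum_j p j = 1 ->
  size_prob (multinomial_mass p) d = 1.
Proof.
move=> p0 p1; elim: d => [|d IH].
  apply: EFin_inj; rewrite size_probE; last by move=> c; exact: multinomial_mass_ge0.
  rewrite (_ : [set c : counts n | _] = [set [ffun=> 0%N]]).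
    rewrite esum_set1; last by rewrite lee_fin multinomial_mass_ge0.
    rewrite /multinomial_mass /csize big1 => [|j _]; last by rewrite ffunE.
    rewrite !big1 ?divr1 ?mul1r // => k _; by rewrite ffunE.
  apply/seteqP; split=> c /=.
    move=> /eqP; rewrite sum_nat_eq0 => /forallP c0; apply/ffunP => j.
    by rewrite ffunE; exact/eqP/c0.
  by move=> ->; rewrite /csize big1 // => j _; rewrite ffunE.
rewrite -IH -(@size_prob_child_mix p _ d) //; last by move=> c; exact: multinomial_mass_ge0.
by apply: eq_size_prob => c cd; rewrite child_mix_multinomial_mass // cd.
Qed.

(** A form without quotient and side condition: if no vector of size [d] has positive mass, both
    sides of the equation are 0. *)
Lemma multinomial_massP f p d : (forall c, 0 <= f c) ->
  (forall c, csize c = d -> f c = size_prob f d * multinomial_mass p c) <->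
  (d \in sizes f -> multinomial d p (fun c => f c / size_prob f d)).
Proof.
move=> f0; split=> [fE|fM c cd].
  rewrite inE => -[c0 [c0d fc0]] c cd.
  have s0 : size_prob f d != 0.
    by rewrite gt_eqF // (lt_le_trans fc0) // le_size_prob.
  by rewrite fE // mulrAC divff // mul1r /multinomial_mass cd.
have [ds|nds] := pselect (sizes f d).
  have s0 : size_prob f d != 0.
    by case: ds => c0 [c0d fc0]; rewrite gt_eqF // (lt_le_trans fc0) // le_size_prob.
  have := fM (mem_set ds) c cd; rewrite /multinomial_mass cd => <-.
  by rewrite mulrC divfK.
have fz b : csize b = d -> f b = 0.
  move=> bd; apply/eqP; rewrite eq_le f0 andbT leNgt; apply/negP => fb.
  by apply: nds; exists b.
rewrite fz // (eq_size_prob (g := fun=> 0)) //.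
by rewrite /size_prob fsbig1 ?mul0r.
Qed.

(* Both f and the multinomial weights satisfy the same one-step exchange
   relation, so they are proportional on each level set of the size. *)
Lemma exchange_multinomial f p : (forall c, 0 <= f c) -> (forall j, 0 <= p j) ->
  \sum_j p j = 1 ->
  (forall b j k, p j * f (add_count b k) * (b k).+1%:R = p k * f (add_count b j) * (b j).+1%:R) ->
  forall c, f c = size_prob f (csize c) * multinomial_mass p c.
Proof.
move=> f0 p0 p1 ex c; set M := multinomial_mass p.
have Mex b j k : p j * M (add_count b k) * (b k).+1%:R = p k * M (add_count b j) * (b j).+1%:R.
  have ek := multinomial_mass_add p b k; have ej := multinomial_mass_add p b j.
  rewrite -/M in ek ej; rewrite -(mulrA (p j)) -(mulrA (p k)) ek ej; ring.
have [j pj] : exists j, 0 < p j.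
  apply: contrapT => np; have : \sum_j p j = 0.
    apply: big1 => j _; apply/eqP; rewrite eq_le p0 andbT leNgt; apply/negP => pj.
    by apply: np; exists j.
  by rewrite p1 => /eqP; rewrite oner_eq0.
(* All [d] units at a type of positive probability: a reference vector with nonzero multinomial
   mass, to which every other vector is compared. *)
set d := csize c; pose c0 : counts n := [ffun k => if k == j then d else 0%N].
have c0d : csize c0 = d.
  rewrite /csize (bigD1 j) //= ffunE eqxx big1 ?addn0 // => k /negbTE kj.
  by rewrite ffunE kj.
have Mc0 : 0 < M c0.
  rewrite /M /multinomial_mass mulr_gt0 ?divr_gt0 ?ltr0n ?fact_gt0 //.
    by rewrite prodn_gt0 // => k; exact: fact_gt0.
  apply: prodr_gt0 => k _; rewrite ffunE; case: eqP => [->|_]; [exact: exprn_gt0|by rewrite expr0].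
have key b : csize b = d -> f b * M c0 = f c0 * M b.
  (* Each exchange moves one unit from some [k] to [j], until [c0] is reached. *)
  have [N] := ubnP (d - b j); elim: N b => // N IH b bN bd.
  have [k /andP[kj bk]|all0] := pickP (fun k => (k != j) && (0 < b k)%N); last first.
    suff -> : b = c0 by [].
    apply/ffunP => k; rewrite ffunE; case: eqP => [->|/eqP kj].
      rewrite -bd /csize (bigD1 j) //= big1 ?addn0 // => l lj.
      by have := all0 l; rewrite lj /= lt0n => /negbFE/eqP.
    by have := all0 k; rewrite kj /= lt0n => /negbFE/eqP.
  pose b' := remove_count b k; pose b2 := add_count b' j.
  have bE : b = add_count b' k by rewrite remove_countK.
  have b2d : csize b2 = d by rewrite /b2 csize_add_count -bd [in RHS]bE csize_add_count.
  have b2j : b2 j = (b j).+1 by rewrite /b2 add_count_self /b' ffunE eq_sym (negbTE kj) subn0.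
  have bjd : (b j < d)%N.
    by rewrite -b2d /csize (bigD1 j) //= b2j ltnS leq_addr.
  have := IH b2 _ b2d; rewrite b2j => /(_ ltac:(lia)) e.
  have e1 := ex b' j k; have e2 := Mex b' j k; rewrite -bE -/b2 in e1 e2.
  have h0 : p j * (b' k).+1%:R != 0 by rewrite mulf_neq0 ?gt_eqF // ltr0n.
  apply: (mulfI h0).
  transitivity ((p j * f b * (b' k).+1%:R) * M c0); first by ring.
  rewrite e1; transitivity (p k * (b' j).+1%:R * (f b2 * M c0)); first by ring.
  rewrite e; transitivity (f c0 * (p k * M b2 * (b' j).+1%:R)); first by ring.
  by rewrite -e2; ring.
have Mc0' : M c0 != 0 by rewrite gt_eqF.
have SM : size_prob f d * M c0 = f c0.
  have M0 b : 0 <= M b by exact: multinomial_mass_ge0.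
  rewrite mulrC -size_probZ //.
  rewrite (eq_size_prob (g := fun b => f c0 * M b)) => [|b bd]; last by rewrite mulrC key.
  by rewrite size_probZ // size_prob_multinomial_mass // mulr1.
by apply: (mulIf Mc0'); rewrite key // -SM; ring.
Qed.

(** For multinomial offspring, the share c_j/|c| of the weight of c = b + e_j is p_j f(b); this is
    what splits the flow of the constructed measure into products. *)
Lemma child_mix_multinomial f p : (forall c, 0 <= f c) ->
  (forall c, f c = size_prob f (csize c) * multinomial_mass p c) ->
  forall b j, child_mix p f (add_count b j) * (b j).+1%:R = (csize b).+1%:R * (p j * f b).
Proof.
move=> f0 fE b j.
have -> : child_mix p f (add_count b j) =
    size_prob f (csize b) * multinomial_mass p (add_count b j).
  rewrite -child_mix_multinomial_mass ?csize_add_count // /child_mix mulr_sumr.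
  apply: eq_bigr => k ck; rewrite fE csize_remove_count // csize_add_count /=.
  by ring.
by rewrite -mulrA multinomial_mass_add [in RHS]fE; ring.
Qed.

End Real.
End Counts.


(** * Measures with Galton-Watson branches *)

Section Mixtures.
Variables (n : nat) (R : realType) (q : 'I_n.+1 -> counts n -> R).
Implicit Types (i j : 'I_n.+1) (b c : counts n) (A B : set (trees n)).

Definition root_event i c : set (trees n) := root_is i `&` root_counts_are c.

Lemma measurable_root_is i : measurable (root_is i : set (trees n)).
Proof. exact: (determined_measurable (@determined_root_label n [set i])). Qed.

Lemma measurable_root_event i c : measurable (root_event i c).
Proof.
apply: measurableI; first exact: measurable_root_is.
exact: (determined_measurable (@determined_root_counts n [set c])).
Qed.

Lemma root_event_preimage ic : root_event ic.1 ic.2 =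
  (fun t : trees n => (root_label t, root_counts t)) @^-1` [set ic].
Proof. by case: ic => i c; apply/seteqP; split=> t [] //= -> ->. Qed.

Lemma add_count_inj j : injective (fun c : counts n => add_count c j).
Proof. by move=> b c /(congr1 (fun c => remove_count c j)); rewrite !add_countK. Qed.

Lemma root_counts_joinE (s t : trees n) :
  root_counts (join s t) = add_count (root_counts s) (root_label t).
Proof. by rewrite root_counts_join; apply/ffunP => k; rewrite !ffunE eq_sym. Qed.

Section Model.
Variables (d : measure_display) (Om : measurableType d) (P : probability Om R).
Variable xi : seq nat * 'I_n.+1 -> Om -> counts n.
Hypothesis iid : iid_offspring q P xi.

Notation gw_law := (gw_law iid).
Notation star_law := (star_law iid).

Lemma star_root i c w : root_event i c (star xi i c w).
Proof.
split; first by rewrite /root_is /= root_label_graft_fun.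
rewrite /root_counts_are /= root_counts_graft_fun; apply/ffunP => j.
rewrite ffunE -[RHS]count_child_types -size_child_types.
rewrite -[in RHS](mkseq_nth i (child_types c)) /mkseq count_map.
by apply: eq_count => k /=; rewrite root_label_gw_tree.
Qed.

Let star_lawE i c A : star_law i c A = P (star xi i c @^-1` A).
Proof. by []. Qed.

Let gw_lawE j A : gw_law j A = P ((fun w => gw_tree j (xi^~ w)) @^-1` A).
Proof. by []. Qed.

Lemma star_law_setI i c A : star_law i c (A `&` root_event i c) = star_law i c A.
Proof.
rewrite !star_lawE; congr (P _); apply/seteqP; split=> w /=; first by case.
by move=> Aw; split=> //; exact: star_root.
Qed.

Lemma star_law_root_event i c : star_law i c (root_event i c) = 1%E.
Proof. by rewrite -[root_event i c]setTI star_law_setI probability_setT. Qed.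

Lemma star_law_setI0 i c i' c' A : (i, c) <> (i', c') ->
  star_law i c (A `&` root_event i' c') = 0%E.
Proof.
move=> ne; rewrite star_lawE (_ : _ @^-1` _ = set0) ?measure0 //.
apply/seteqP; split=> w //= [_ [e1 e2]]; apply: ne.
have [] := star_root i c w; move: e1 e2; rewrite /root_is /root_counts_are /=.
by move=> -> -> -> ->.
Qed.

Lemma gw_law_root_event j b : gw_law j (root_event j b) = (q j b)%:E.
Proof.
have [_ qxi _] := iid; rewrite -(qxi ([::], j) b) gw_lawE; congr (P _).
apply/seteqP; split=> w /=.
  by move=> [_]; rewrite /root_counts_are /= root_counts_gw_tree.
by move=> e; split; [rewrite /root_is /= root_label_gw_tree|rewrite /root_counts_are /= root_counts_gw_tree].
Qed.

Lemma gw_law_root_is0 l j : l != j -> gw_law l (root_is j) = 0%E.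
Proof.
move=> /eqP lj; rewrite gw_lawE (_ : _ @^-1` _ = set0) ?measure0 //.
by apply/seteqP; split=> w //=; rewrite /root_is /= root_label_gw_tree.
Qed.

Lemma offspring_ge0 i c : 0 <= q i c.
Proof. by rewrite -lee_fin -gw_law_root_event. Qed.

Lemma offspring_sum i : (\esum_(c in [set: counts n]) (q i c)%:E = 1)%E.
Proof.
have [mxi qxi _] := iid; rewrite -(probability_setT P).
rewrite (@measure_esum _ _ _ P (counts n) (xi ([::], i)) setT) //.
by apply: eq_esum => c _; rewrite setTI; exact/esym/(qxi ([::], i) c).
Qed.

(** [sim_g] in a fixed model and multiplied out; for root data of probability 0 it holds
    trivially. *)
Definition star_mixture (mu : probability (trees n) R) :=
  forall i c A, measurable A ->
    (mu (A `&` root_event i c) = mu (root_event i c) * star_law i c A)%E.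

Lemma graft_enum (Om' : Type) i m m' (X : 'I_m -> Om' -> trees n) w : m = m' ->
  graft i [seq X k w | k <- enum 'I_m] =
  graft_fun i (fun k => if insub k is Some a then X a w else point) m'.
Proof.
move=> <-; rewrite graftE size_map size_enum_ord; apply: eq_graft_fun => k km.
rewrite (nth_map (Ordinal km)) ?size_enum_ord //.
rewrite insubT; congr (X _ w); apply: val_inj => /=.
by rewrite nth_enum_ord.
Qed.

Lemma sim_g_star_mixture mu : sim_g mu q -> star_mixture mu.
Proof.
move=> sg i c A mA.
have mR := measurable_root_event i c.
have finmu B : measurable B -> mu B \is a fin_num by move=> mB; exact: fin_num_measure.
have [mu0|mu0] := eqVneq (mu (root_event i c)) 0%E.
  rewrite mu0 mul0e; apply/eqP; rewrite eq_le measure_ge0 andbT -mu0.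
  by apply: le_measure; rewrite ?inE //; exact: measurableI.
have mugt : (0 < mu (root_event i c))%E by rewrite lt0e mu0 measure_ge0.
have [d' [Om' [P' [X [mX indX GX XE]]]]] := sg i c mugt.
have := XE A mA; rewrite /cprob.
set S := [set w | _].
have -> : fine (P' S) = fine (star_law i c A).
  (* The family on ordinals is continued by a constant tree, which the graft never uses. *)
  congr fine; pose F k (w : Om') := if insub k is Some a then X a w else point.
  have -> : S = (fun w => graft_fun i (F^~ w) (csize c)) @^-1` A.
    by rewrite /S; apply/seteqP; split=> w /=; rewrite (graft_enum i X w (size_child_types c)).
  have FE k (km : (k < size (child_types c))%N) : F k = X (Ordinal km).
    by apply/funext => w; rewrite /F insubT.
  apply: star_law_unique => //.
  - move=> k; have [km|km] := ltnP k (size (child_types c)); first by rewrite FE.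
    rewrite (_ : F k = cst point); first exact: measurable_cst.
    by apply/funext => w; rewrite /F insubF //; rewrite ltnNge km.
  - move=> B mB; rewrite -size_child_types.
    pose B' (a : 'I_(size (child_types c))) := B (val a).
    have := indX (enum 'I_(size (child_types c))) B' (enum_uniq _) (fun a => mB a).
    have -> : \bigcap_(a in [set` enum 'I_(size (child_types c))]) X a @^-1` B' a =
        \bigcap_(k in [set` iota 0 (size (child_types c))]) F k @^-1` B k.
      apply/seteqP; split=> w h.
        move=> k /=; rewrite mem_iota /= add0n => km; rewrite FE.
        by apply: (h (Ordinal km)); rewrite /= mem_enum.
      move=> a _ /=; have := h (val a); rewrite /= mem_iota /= add0n FE => /(_ (ltn_ord a)).
      by rewrite (_ : Ordinal _ = a) //; exact: val_inj.
    rewrite -val_enum_ord => e.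
    have mF k : measurable (F k @^-1` B k).
      apply: measurable_preimage => //.
      have [km|km] := ltnP k (size (child_types c)); first by rewrite FE.
      rewrite (_ : F k = cst point); first exact: measurable_cst.
      by apply/funext => w; rewrite /F insubF //; rewrite ltnNge km.
    rewrite -[LHS]fineK; last first.
      by apply: fin_num_measure; apply: fin_bigcap_measurable => // k _.
    rewrite e -prodEFin [RHS]big_map; apply: eq_bigr => a _.
    rewrite fineK; last first.
      by apply: fin_num_measure; exact: (measurable_preimage (mX a) (mB (val a))).
    rewrite /B' (_ : F (val a) = X a) // (FE _ (ltn_ord a)).
    by congr (X _); exact: val_inj.
  - move=> k B; rewrite -size_child_types => km mB.
    rewrite FE -[LHS]fineK ?fin_num_measure //; last exact: measurable_preimage.
    rewrite (GW_from_law iid (GX (Ordinal km)) mB) fineK ?fin_num_measure //.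
    by rewrite (tnth_nth i).
move/(congr1 (fun x => x * fine (mu (root_event i c)))).
rewrite divfK; last by rewrite fine_eq0 ?finmu.
move=> e; rewrite -[LHS]fineK; last by apply: finmu; exact: measurableI.
by rewrite [fine _]e mulrC EFinM !fineK ?fin_num_measure.
Qed.

Lemma star_mixture_sim_g mu : star_mixture mu -> sim_g mu q.
Proof.
move=> sm i c mugt.
exists d, Om, P, (fun k w => forest xi i (child_types c) id (val k) w); split.
- by move=> k; exact: (measurable_forest iid).
- apply: (independent_comp (X := forest xi i (child_types c) id) (g := val)).
  + exact: val_inj.
  + exact: measurableT.
  + exact: (forest_independent iid i _ (@inj_id nat)).
- move=> k; rewrite (tnth_nth i) /=.
  exists d, Om, P, (fun a => xi (val k :: a.1, a.2)).
  by case: (iid_shift (val k) iid) => h1 h2 h3; split.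
- move=> A mA; rewrite /cprob.
  have mR := measurable_root_event i c.
  have mu0 : fine (mu (root_event i c)) != 0.
    by rewrite fine_eq0 ?gt_eqF // fin_num_measure.
  rewrite (_ : fine (mu (A `&` _)) = fine (mu (root_event i c)) * fine (star_law i c A)).
    rewrite mulrAC divff // mul1r star_lawE; congr (fine (P _)).
    pose X (k : 'I_(size (child_types c))) w := forest xi i (child_types c) id (val k) w.
    have XE w : graft i [seq X k w | k <- enum 'I_(size (child_types c))] = star xi i c w.
      rewrite (graft_enum i X w (size_child_types c)).
      by apply: eq_graft_fun => k km; rewrite insubT ?size_child_types.
    by apply/seteqP; split=> w /=; rewrite -XE.
  by rewrite -fineM ?fin_num_measure //; congr fine; exact: (sm i c A mA).
Qed.

Lemma star_mixtureE mu A : star_mixture mu -> measurable A ->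
  (mu A = \esum_(ic in [set: 'I_n.+1 * counts n])
            mu (root_event ic.1 ic.2) * star_law ic.1 ic.2 A)%E.
Proof.
move=> sm mA.
rewrite (@measure_esum _ _ _ mu ('I_n.+1 * counts n)%type
  (fun t => (root_label t, root_counts t))) //.
  by apply: eq_esum => ic _; rewrite -root_event_preimage; exact: (sm ic.1 ic.2 A mA).
by move=> ic; rewrite -root_event_preimage; exact: measurable_root_event.
Qed.

(** [join] gives the root of each side one more neighbour, labelled as the other root. Cancelling it
    by [add_count_inj] turns the event into a rectangle. *)
Lemma edge_event_root i j b b' l : l = j ->
  (star_law i b \x gw_law l)%E
    (edge_event (root_event i (add_count b j)) (root_event j (add_count b' i))) = (q j b')%:E.
Proof.
move=> ->; rewrite (_ : edge_event _ _ = root_event i b `*` root_event j b').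
  rewrite product_measure1E; [|exact: measurable_root_event|exact: measurable_root_event].
  by rewrite [X in (X * _)%E]star_law_root_event mul1e; exact: gw_law_root_event.
apply/seteqP; split=> -[s t] /=.
  rewrite /edge_event /root_event /root_is /root_counts_are /= !root_label_join !root_counts_joinE.
  by move=> [[-> h1] [e2 h2]]; move: h1 h2; rewrite e2 => /add_count_inj -> /add_count_inj ->.
rewrite /edge_event /root_event /root_is /root_counts_are /= !root_label_join !root_counts_joinE.
by move=> [[-> ->] [-> ->]].
Qed.

Lemma edge_event_root0 i i' j c c' c'' l : l != j ->
  (star_law i c \x gw_law l)%E (edge_event (root_event i' c') (root_event j c'')) = 0%E.
Proof.
move=> lj; apply/eqP; rewrite eq_le measure_ge0 andbT.
have m1 := @measurable_root_event i' c'; have m2 := @measurable_root_event j c''.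
have m3 := measurable_root_is j.
apply: (@le_trans _ _ ((star_law i c \x gw_law l)%E (setT `*` root_is j))).
  apply: le_measure; rewrite ?inE; [exact: measurable_edge_event|exact: measurableX|].
  by move=> [s t] [_ []] /=; rewrite /root_is /= root_label_join.
rewrite product_measure1E //; rewrite [X in (_ * X)%E](_ : _ = 0%E) ?mule0 //.
exact: gw_law_root_is0.
Qed.

(** Of the sum over the type of the chosen neighbour only [j] survives, since after the step the
    root must have label [j]. *)
Lemma walk_root_events mu i j b b' : star_mixture mu ->
  (\int[mu]_(t in root_event i (add_count b j))
     (walk R t (root_event j (add_count b' i)))%:E =
   (fine (mu (root_event i (add_count b j))) * ((b j).+1%:R / (csize b).+1%:R) * q j b')%:E)%E.
Proof.
move=> sm; set c := add_count b j; set B := root_event j _.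
have mR := measurable_root_event i c; have mB : measurable B by exact: measurable_root_event.
have r0 : 0 <= fine (mu (root_event i c)) by rewrite fine_ge0.
have fin : mu (root_event i c) \is a fin_num by exact: fin_num_measure.
pose m2 : {measure set (trees n) -> \bar R} := mscale (NngNum r0) (star_law i c).
rewrite (@eq_measure_integral _ _ _ _ m2); last first.
  move=> A mA AR; change (mu A = (fine (mu (root_event i c)))%:E * star_law i c A)%E.
  by rewrite fineK // -sm //; congr (mu _); apply/seteqP; split=> t; [move=> At; split=> //; exact: AR|case].
rewrite ge0_integral_mscale //; last 2 first.
- by apply: measurable_funTS; apply/measurable_EFinP; exact: measurable_walk.
- by move=> t _; rewrite lee_fin walk_ge0.
rewrite -mulrA EFinM; congr (_ * _)%E.
rewrite walk_star // (bigD1 j) //= [X in (_ + X)%E]big1 ?adde0.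
  by rewrite add_countK edge_event_root // -EFinM add_count_self csize_add_count.
by move=> l lj; rewrite edge_event_root0 // mule0.
Qed.

Lemma edge_balance mu i j b b' : star_mixture mu -> reversible mu ->
  fine (mu (root_event i (add_count b j))) * ((b j).+1%:R / (csize b).+1%:R) * q j b' =
  fine (mu (root_event j (add_count b' i))) * ((b' i).+1%:R / (csize b').+1%:R) * q i b.
Proof.
move=> sm rev; apply: EFin_inj; rewrite -!walk_root_events //.
by apply: rev; exact: measurable_root_event.
Qed.

End Model.
End Mixtures.


(** * Type probabilities and detailed balance *)

Section TypeGraph.
Variables (n : nat) (R : realType).
Implicit Types (i j k : 'I_n.+1) (b c : counts n) (p : 'I_n.+1 -> 'I_n.+1 -> R).
Implicit Types (q : 'I_n.+1 -> counts n -> R) (m x : 'I_n.+1 -> R).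

Definition child_rel q : rel 'I_n.+1 :=
  fun i k => `[< exists c, 0 < q i c /\ (0 < c k)%N >].

Definition connected_types q := forall i k, connect (child_rel q) i k.

(** The ratio of an edge is m_j/m_i, so the product along a path telescopes. *)
Lemma detailed_balance_cycle p m : (forall i, 0 < m i) ->
  (forall i j, m i * p i j = m j * p j i) -> cycle_condition p.
Proof.
move=> m0 bal N x xN pos.
suff tele : forall k : nat, (k <= N)%N ->
    \prod_(0 <= s < k) (p (x s) (x s.+1) / p (x s.+1) (x s)) = m (x k) / m (x 0%N).
  by rewrite tele // xN divff // gt_eqF.
elim=> [_|k IH kN]; first by rewrite big_nil divff // gt_eqF.
rewrite big_nat_recr //= IH ?(ltnW kN) //.
have b := bal (x k) (x k.+1); have pk := pos k kN.
have mk := m0 (x k); have mk1 := m0 (x k.+1); have m00 := m0 (x 0%N).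
have pk1 : 0 < p (x k.+1) (x k) by rewrite -(pmulr_rgt0 _ mk1) -b mulr_gt0.
have -> : p (x k) (x k.+1) = m (x k.+1) * p (x k.+1) (x k) / m (x k).
  by rewrite -b mulrC mulKf // gt_eqF.
by field; rewrite !gt_eqF.
Qed.

Lemma multinomial_offspring_mass q p : (forall i c, 0 <= q i c) ->
  multinomial_offspring q p -> forall i c, q i c = size_prob (q i) (csize c) * multinomial_mass (p i) c.
Proof.
move=> q0 mo i c; apply: (multinomial_massP _ _ (q0 i)).2 => //.
exact: mo.
Qed.

Lemma child_rel_gt0 q p i k : (forall i c, 0 <= q i c) -> stochastic p ->
  multinomial_offspring q p -> child_rel q i k -> 0 < p i k.
Proof.
move=> q0 [p01 _] mo /asboolP[c [qc ck]].
have pik : 0 <= p i k by have /andP[] := p01 i k.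
rewrite lt0r pik andbT; apply/eqP => pz; move: qc.
rewrite (multinomial_offspring_mass q0 mo) /multinomial_mass [X in _ * (_ * X)](bigD1 k) //= pz.
by rewrite expr0n eqn0Ngt ck mul0r !mulr0 ltxx.
Qed.

(** The quotient of [x] by [m] is constant along [child_rel], hence constant, and both vectors sum
    to 1. *)
Lemma connect_root_unique q p m x : (forall i c, 0 <= q i c) -> stochastic p ->
  multinomial_offspring q p -> connected_types q -> (forall i, 0 < m i) ->
  (forall i j, m i * p i j = m j * p j i) -> \sum_i m i = 1 ->
  root_system p x <-> x = m.
Proof.
move=> q0 sp mo conn m0 bal m1; split=> [[xp x1]|->]; last first.
  split=> // i j pij; have b := bal i j.
  rewrite (_ : m i = m j * p j i / p i j); last by rewrite -b mulfK // gt_eqF.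
  by field; rewrite !gt_eqF.
have step i k : child_rel q i k -> x i / m i = x k / m k.
  move=> /(child_rel_gt0 q0 sp mo) pik; have b := bal i k.
  have pki : 0 < p k i by rewrite -(pmulr_rgt0 _ (m0 k)) -b mulr_gt0.
  have xik := xp i k pik.
  (* Division by 0 gives 0, whereas the prescribed ratio is positive. *)
  have xk0 : x k != 0.
    apply/eqP => xk; move: xik; rewrite xk invr0 mulr0 => /esym /eqP.
    by rewrite mulf_eq0 invr_eq0 !gt_eqF.
  have -> : x i = p k i / p i k * x k by rewrite -xik divfK.
  have -> : p k i = m i * p i k / m k by rewrite b mulrC mulKf // gt_eqF.
  by field; rewrite !gt_eqF.
have all_eq i k : x i / m i = x k / m k.
  have /connectP[l] := conn i k; elim: l i => [|j l IH] i /=; first by move=> _ ->.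
  by move=> /andP[/step -> /IH h] /h.
have xE i : x i = x ord0 / m ord0 * m i by rewrite -(all_eq i) divfK // gt_eqF.
have r1 : x ord0 / m ord0 = 1.
  by rewrite -x1 (eq_bigr _ (fun i _ => xE i)) -mulr_sumr m1 mulr1.
by apply/funext => i; rewrite xE r1 mul1r.
Qed.

(** Given a size d > 0, the vector with all children of type j has conditional probability
    p_(i,j)^d, which determines p_(i,j). *)
Lemma multinomial_offspring_unique q p p' : (forall i c, 0 <= q i c) ->
  stochastic p -> stochastic p' -> multinomial_offspring q p -> multinomial_offspring q p' ->
  connected_types q -> p = p'.
Proof.
move=> q0 [p01 p1] [p01' p1'] mo mo' conn; apply/funext => i; apply/funext => j.
have [[c [qc c0]]|noc] := pselect (exists c, 0 < q i c /\ (0 < csize c)%N).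
  have ds : csize c \in sizes (q i) by rewrite inE; exists c.
  pose cj : counts n := [ffun k => if k == j then csize c else 0%N].
  have cjd : csize cj = csize c.
    rewrite {1}/csize (bigD1 j) //= ffunE eqxx big1 ?addn0 // => k /negbTE kj.
    by rewrite ffunE kj.
  have := mo i _ ds cj cjd; rewrite (mo' i _ ds cj cjd) => /mulfI e.
  have {}e : \prod_k p' i k ^+ cj k = \prod_k p i k ^+ cj k.
    by apply: e; rewrite mulf_neq0 // ?invr_neq0 ?prod_fact_neq0 // pnatr_eq0 -lt0n fact_gt0.
  move: e; rewrite (bigD1 j) //= [in RHS](bigD1 j) //= !big1.
  - rewrite !ffunE eqxx !mulr1 => /(pexpIrn c0) -> //; rewrite nnegrE.
    + by have /andP[] := p01' i j.
    + by have /andP[] := p01 i j.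
  - by move=> k /negbTE kj; rewrite ffunE kj.
  - by move=> k /negbTE kj; rewrite ffunE kj.
(* Type [i] never has children, so no other type can be reached from it; a stochastic matrix of size
   1 is unique. *)
have only k : k = i.
  have /connectP[[|l s] //= /andP[/asboolP[c [qc cl]] _] _] := conn i k.
  by case: noc; exists c; split=> //; rewrite /csize (bigD1 l) //= addn_gt0 cl.
have single (f : 'I_n.+1 -> R) : \sum_k f k = f i.
  by rewrite (bigD1 i) //= big1 ?addr0 // => k /eqP; rewrite [k]only.
by rewrite (only j) -(single (p i)) -(single (p' i)) p1 p1'.
Qed.

(* The weight of a type is the product of the ratios in the cycle condition along
   a path from type 0; completing two such paths by one common return path shows
   that it changes along an edge by the ratio of that edge. *)
Lemma cycle_condition_root p : stochastic p -> cycle_condition p ->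
  (forall i k, connect (fun i j => 0 < p i j) i k) ->
  exists x, [/\ (forall i, 0 < x i), \sum_i x i = 1 &
    forall i j, x i * p i j = x j * p j i].
Proof.
move=> [p01 _] cyc conn.
have p0 i j : 0 <= p i j by have /andP[] := p01 i j.
pose e i j := 0 < p i j.
pose g i j := p i j / p j i.
pose fix wprod i l := if l is j :: l' then g i j * wprod j l' else 1.
have wprodE (x0 i : 'I_n.+1) l : wprod i l = \prod_(0 <= s < size l) g (nth x0 (i :: l) s) (nth x0 l s).
  elim: l i => [|j l IH] i /=; first by rewrite big_nil.
  by rewrite big_nat_recl //= IH.
have wprod_cat i l l' : wprod i (l ++ l') = wprod i l * wprod (last i l) l'.
  by elim: l i => [|j l IH] i /=; rewrite ?mul1r // IH mulrA.
have wprod_cyc i l : path e i l -> last i l = i -> wprod i l = 1.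
  move=> pl li; rewrite (wprodE i).
  apply: (cyc (size l) (fun s => nth i (i :: l) s)).
    by rewrite -[RHS]/i -[RHS]li (last_nth i).
  by move=> s sl; move/(pathP i) : pl => /(_ s sl).
have wprod_ge0 i l : 0 <= wprod i l.
  by elim: l i => [|j l IH] i //=; rewrite mulr_ge0 // divr_ge0.
have /choice[L LP] : forall i, exists l, path e ord0 l /\ last ord0 l = i.
  by move=> i; have /connectP[l pl ->] := conn ord0 i; exists l.
have /choice[L' L'P] : forall i, exists l, path e i l /\ last i l = ord0.
  by move=> i; have /connectP[l pl li] := conn i ord0; exists l.
pose y i := wprod ord0 (L i).
have yL' i : y i * wprod i (L' i) = 1.
  have [pL lL] := LP i; have [pL' lL'] := L'P i.
  rewrite /y -[in wprod i _]lL -wprod_cat wprod_cyc //.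
    by rewrite cat_path pL lL.
  by rewrite last_cat lL lL'.
have y0 i : 0 < y i.
  rewrite lt0r wprod_ge0 andbT; apply/eqP => yi; have := yL' i.
  by rewrite yi mul0r => /eqP; rewrite eq_sym oner_eq0.
have L'0 i : wprod i (L' i) != 0.
  by apply/eqP => z; have := yL' i; rewrite z mulr0 => /eqP; rewrite eq_sym oner_eq0.
have yg i j : e i j -> y i * g i j = y j.
  move=> eij; apply: (mulIf (L'0 j)); rewrite yL'.
  have [pL lL] := LP i; have [pL' lL'] := L'P j.
  have := wprod_cyc ord0 (L i ++ j :: L' j); rewrite cat_path pL lL /= eij pL' last_cat lL /= lL'.
  by move=> /(_ erefl erefl); rewrite wprod_cat /= lL mulrA.
(* If the reverse probability were 0, the ratio of the edge would be 0 by convention and [y j] would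
   vanish. *)
have pC i j : e i j -> e j i.
  move=> eij; rewrite /e lt0r p0 andbT; apply/eqP => z.
  by have := yg i j eij; rewrite /g z invr0 !mulr0 => h; have := y0 j; rewrite -h ltxx.
have bal i j : y j * p j i = y i * p i j.
  have [eij|] := boolP (e i j).
    by rewrite -(yg _ _ eij) /g -mulrA divfK // gt_eqF //; exact: pC.
  move=> neij; have neji : ~~ e j i by apply: contra neij; exact: pC.
  have z k l : ~~ e k l -> p k l = 0.
    by rewrite /e -leNgt => h; apply/eqP; rewrite eq_le h p0.
  by rewrite !z // !mulr0.
have S0 : 0 < \sum_i y i.
  by rewrite (bigD1 ord0) //= ltr_pwDl // sumr_ge0 // => i _; exact: ltW.
exists (fun i => y i / \sum_k y k); split.
- by move=> i; rewrite divr_gt0.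
- by rewrite -mulr_suml divff // gt_eqF.
- by move=> i j; rewrite mulrAC -bal mulrAC.
Qed.

(** * Multinomial offspring extracted from the balance of root data *)

Section RootWeights.
Variables (q V : 'I_n.+1 -> counts n -> R) (m : 'I_n.+1 -> R).
Hypothesis q0 : forall i c, 0 <= q i c.
Hypothesis V0 : forall i c, 0 <= V i c.
Hypothesis q1 : forall i, (\esum_(c in [set: counts n]) (q i c)%:E = 1)%E.
Hypothesis Vm : forall i, (\esum_(c in [set: counts n]) (V i c)%:E = (m i)%:E)%E.
Hypothesis Vz : forall i c, csize c = 0%N -> V i c = 0.
Hypothesis m1 : \sum_i m i = 1.
Hypothesis conn : connected_types q.
Hypothesis bal : forall i j b b',
  V i (add_count b j) * ((b j).+1%:R / (csize b).+1%:R) * q j b' =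
  V j (add_count b' i) * ((b' i).+1%:R / (csize b').+1%:R) * q i b.

Let W i b j := V i (add_count b j) * ((b j).+1%:R / (csize b).+1%:R).

Let W_ge0 i b j : 0 <= W i b j.
Proof. by rewrite mulr_ge0 // divr_ge0. Qed.

(* kap i j is the flow of the walk from type i to type j. *)
Let flow : exists kap : 'I_n.+1 -> 'I_n.+1 -> R,
  [/\ (forall i j, 0 <= kap i j), (forall i j, kap i j = kap j i) &
      forall i b j, W i b j = kap i j * q i b].
Proof.
have /choice[b0 b0P] : forall i, exists b, 0 < q i b.
  move=> i; apply: contrapT => nb; have := q1 i; rewrite esum1.
    by move=> /eqP; rewrite eqe eq_sym oner_eq0.
  move=> c _; congr EFin; apply/eqP; rewrite eq_le q0 andbT leNgt; apply/negP => qc.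
  by apply: nb; exists c.
have b0n i : q i (b0 i) != 0 by rewrite gt_eqF.
(* The balance W_i(b,j) q_j(b') = W_j(b',i) q_i(b) shows that this quotient does not depend on the
   vector chosen. *)
pose kap i j := W i (b0 i) j / q i (b0 i).
have kapC i j : kap i j = kap j i.
  apply: (mulIf (b0n i)); apply: (mulIf (b0n j)).
  by rewrite /kap divfK // [LHS](bal i j) -/(W j (b0 j) i) [RHS]mulrAC divfK.
exists kap; split=> // [i j|i b j]; first by rewrite divr_ge0.
apply: (mulIf (b0n j)); rewrite [LHS](bal i j) -/(W j (b0 j) i) kapC /kap.
by rewrite [RHS]mulrAC divfK.
Qed.

Lemma root_weights : exists p,
  [/\ stochastic p, multinomial_offspring q p, (forall i, 0 < m i),
      (forall i j, m i * p i j = m j * p j i) &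
      forall i c, V i c = m i * child_mix (p i) (q i) c].
Proof.
have [kap [kap0 kapC WE]] := flow.
(* The shares c_j/|c| sum to 1 unless [c] is zero; that vector has weight 0 by [Vz]. *)
have VE i c : V i c = child_mix (kap i) (q i) c.
  have [c0|c0] := eqVneq (csize c) 0%N.
    rewrite Vz // /child_mix big_pred0 // => j; apply/negbTE; rewrite -eqn0Ngt.
    by move/eqP: c0; rewrite sum_nat_eq0 => /forallP /(_ j).
  have c0' : (csize c)%:R != 0 :> R by rewrite pnatr_eq0.
  rewrite -[LHS](mulfK c0') -sum_counts mulr_sumr mulr_suml.
  apply: eq_bigr => j cj; rewrite -WE /W remove_countK // sum_counts.
  rewrite csize_remove_count // prednK ?lt0n // ffunE eqxx subn1 prednK //.
  by rewrite mulrA.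
have kapm i : \sum_j kap i j = m i.
  apply: EFin_inj; rewrite -Vm.
  under eq_esum do rewrite VE.
  by rewrite (@esum_child_mix _ _ (kap i) (q i) setT setT) // q1 mule1.
have m_ge0 i : 0 <= m i by rewrite -kapm sumr_ge0.
have kap_le i j : kap i j <= m i.
  by rewrite -kapm (bigD1 j) //= lerDl sumr_ge0.
(* Some flow from [i] to a type [j] is positive, so a root of type [i] with neighbours c + e_j has
   positive weight. It also has a neighbour of type [k]; thus the flow between [i] and [k] is
   positive, and it bounds [m k] from below. *)
have step i k : child_rel q i k -> 0 < m i -> 0 < m k.
  move=> /asboolP[c [qc ck]] mi.
  have [j kij] : exists j, 0 < kap i j.
    apply: contrapT => nk; move: mi; rewrite -kapm big1 ?ltxx // => j _.
    apply/eqP; rewrite eq_le kap0 andbT leNgt; apply/negP => kij.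
    by apply: nk; exists j.
  have Wc : 0 < W i c j by rewrite WE mulr_gt0.
  have Vc : 0 < V i (add_count c j).
    by move: Wc; rewrite /W pmulr_lgt0 // divr_gt0 ?ltr0n.
  have ck' : (0 < add_count c j k)%N by rewrite ffunE addn_gt0 ck.
  have : 0 < W i (remove_count (add_count c j) k) k.
    by rewrite /W remove_countK // mulr_gt0 // divr_gt0 ?ltr0n.
  rewrite WE kapC => h; apply: lt_le_trans (kap_le k i).
  by rewrite lt0r kap0 andbT; apply/eqP => z; rewrite z mul0r ltxx in h.
have m_gt0 i : 0 < m i.
  have [i0 mi0] : exists i0, 0 < m i0.
    apply: contrapT => nm; move: m1; rewrite big1 => [/eqP|j _].
      by rewrite eq_sym oner_eq0.
    apply/eqP; rewrite eq_le m_ge0 andbT leNgt; apply/negP => mj.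
    by apply: nm; exists j.
  have /connectP[l] := conn i0 i; elim: l i0 mi0 => [|j l IH] i0 mi0 /=; first by move=> _ ->.
  by move=> /andP[/step/(_ mi0)/IH h] /h; apply.
have mn i : m i != 0 by rewrite gt_eqF.
pose p i j := kap i j / m i.
have p0 i j : 0 <= p i j by rewrite divr_ge0.
have psum i : \sum_j p i j = 1 by rewrite -mulr_suml kapm divff.
have WEp i b j : W i b j = m i * (p i j * q i b).
  by rewrite WE /p; field; rewrite mn.
exists p; split => //.
- split=> // i j; rewrite p0 /= -(psum i) (bigD1 j) //= lerDl sumr_ge0 //.
- move=> i d; apply: (multinomial_massP _ _ (q0 i)).1 => c cd.
  rewrite -cd; apply: exchange_multinomial => // b j k.
  have [->//|jk] := eqVneq j k.
  (* Both equations contain the weight of the same root vector b + e_j + e_k; eliminating it leaves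
     the exchange relation. *)
  have e1 := WEp i (add_count b k) j; have e2 := WEp i (add_count b j) k.
  move: e1 e2; rewrite /W !csize_add_count (add_countC b k j).
  rewrite [add_count b k j]ffunE (negbTE jk) addn0 [add_count b j k]ffunE eq_sym (negbTE jk) addn0.
  move=> e1 e2; apply: (mulfI (mn i)).
  by rewrite [LHS]mulrA -e1 [RHS]mulrA -e2; ring.
- by move=> i j; rewrite /p ![m _ * _]mulrC !divfK.
- move=> i c; rewrite VE /child_mix mulr_sumr; apply: eq_bigr => j cj.
  by rewrite /p; field; rewrite mn.
Qed.

End RootWeights.
End TypeGraph.


(** * Existence of the reversible measure *)

Section CountableMixtures.
Variables (R : realType) (d : measure_display) (T : measurableType d) (K : countType).
Variables (w : K -> R) (m : K -> probability T R).
Hypothesis w0 : forall x, 0 <= w x.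

Definition mixture_term k : {measure set T -> \bar R} :=
  if choice.pickle_inv k is Some x then mscale (NngNum (w0 x)) (m x) else mzero.

Definition mixture_measure : {measure set T -> \bar R} := mseries mixture_term 0.

Lemma mixture_measureE A :
  (mixture_measure A = \esum_(x in [set: K]) (w x)%:E * m x A)%E.
Proof.
rewrite esum_count => [|x]; last by rewrite mule_ge0 ?lee_fin.
rewrite /mixture_measure /= /mseries; apply: eq_eseriesr => k _.
by rewrite /mixture_term; case: choice.pickle_inv.
Qed.

Lemma integral_mixture (mu : {measure set T -> \bar R}) (D : set T) (f : T -> \bar R) :
  (forall A, measurable A -> mu A = \esum_(x in [set: K]) (w x)%:E * m x A)%E ->
  measurable D -> measurable_fun D f -> (forall t, D t -> 0 <= f t)%E ->
  (\int[mu]_(t in D) f t = \esum_(x in [set: K]) (w x)%:E * \int[m x]_(t in D) f t)%E.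
Proof.
move=> muE mD mf f0.
rewrite (@eq_measure_integral _ _ _ _ mixture_measure); last first.
  by move=> A mA _; rewrite muE // -mixture_measureE.
rewrite ge0_integral_measure_series // esum_count => [|x]; last first.
  by rewrite mule_ge0 ?lee_fin // integral_ge0.
apply: eq_eseriesr => k _; rewrite /mixture_term.
case: choice.pickle_inv => [x|] /=; first by rewrite ge0_integral_mscale.
by rewrite integral_measure_zero.
Qed.

Hypothesis w1 : (\esum_(x in [set: K]) (w x)%:E = 1)%E.

(** The anonymous proof argument is kept in the term, so that the probability structure can be
    attached to it. *)
Definition mixture of (\esum_(x in [set: K]) (w x)%:E = 1)%E : set T -> \bar R :=
  mixture_measure.

HB.instance Definition _ := Measure.copy (mixture w1) mixture_measure.

Let mixture_setT : mixture w1 setT = 1%E.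
Proof.
rewrite /mixture mixture_measureE -w1; apply: eq_esum => x _.
by rewrite probability_setT mule1.
Qed.

HB.instance Definition _ := Measure_isProbability.Build _ _ _ (mixture w1) mixture_setT.

Lemma mixtureE A : (mixture w1 A = \esum_(x in [set: K]) (w x)%:E * m x A)%E.
Proof. exact: mixture_measureE. Qed.

End CountableMixtures.

Lemma esum_single (R : realType) (K : countType) (f : K -> \bar R) x : (0 <= f x)%E ->
  (forall y, y <> x -> f y = 0%E) -> (\esum_(y in [set: K]) f y = f x)%E.
Proof.
move=> f0 fz; rewrite -[RHS](esum_set1 f0) [RHS]esum_mkcond; apply: eq_esum => y _.
by case: ifPn => // /negP; rewrite inE => /fz.
Qed.

Lemma esum_ord (R : realType) n (f : 'I_n -> \bar R) : (forall i, 0 <= f i)%E ->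
  (\esum_(i in [set: 'I_n]) f i = \sum_i f i)%E.
Proof.
move=> f0; have fin : finite_set [set: 'I_n] by exact: finite_finset.
rewrite esum_fset // fsbig_finite //= -big_enum /=; apply: perm_big.
apply: uniq_perm; [exact: finmap.fset_uniq|exact: enum_uniq|move=> i].
by rewrite mem_enum in_fset_set // in_setT.
Qed.

Lemma esum_pair (R : realType) n (K : countType) (f : 'I_n.+1 -> K -> \bar R) :
  (forall i c, 0 <= f i c)%E ->
  (\esum_(ic in [set: 'I_n.+1 * K]) f ic.1 ic.2 = \sum_i \esum_(c in [set: K]) f i c)%E.
Proof.
move=> f0; transitivity (\esum_(i in [set: 'I_n.+1]) \esum_(c in [set: K]) f i c)%E.
  rewrite esum_esum //; congr (esum _ _); by apply/seteqP; split.
by rewrite esum_ord // => i; exact: esum_ge0.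
Qed.

Section Main.
Variables (n : nat) (R : realType) (q : 'I_n.+1 -> counts n -> R).
Implicit Types (i j : 'I_n.+1) (b c : counts n) (A B : set (trees n)).

Section Model.
Variables (d : measure_display) (Om : measurableType d) (P : probability Om R).
Variable xi : seq nat * 'I_n.+1 -> Om -> counts n.
Hypothesis iid : iid_offspring q P xi.

Notation gw_law := (gw_law iid).
Notation star_law := (star_law iid).

Let q0 := offspring_ge0 iid.

Lemma vertex_type_connect i (eta : seq nat * 'I_n.+1 -> counts n) u :
  (forall a, 0 < q a.2 (eta a)) ->
  vertex (PlaneTree (fun u => csize (eta (u, gw_type i eta u))) (gw_type i eta)) u ->
  connect (child_rel q) i (gw_type i eta u).
Proof.
elim: u i eta => [|k u IH] i eta qeta; first by [].
move=> /= /andP[kc Tu].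
pose j := nth i (child_types (eta ([::], i))) k.
have ij : child_rel q i j.
  apply/asboolP; exists (eta ([::], i)); split; first exact: (qeta ([::], i)).
  exact: child_types_gt0.
apply: connect_trans (connect1 ij) _.
by apply: (IH j (fun a => eta (k :: a.1, a.2))) => // a; exact: (qeta (k :: a.1, a.2)).
Qed.

Lemma has_label_connect i j : (0 < gw_law i (has_label j))%E -> connect (child_rel q) i j.
Proof.
move=> gwpos; apply: contrapT => nc; move: gwpos.
suff -> : gw_law i (has_label j) = 0%E by rewrite ltxx.
(* These countably many null events say that some offspring vector takes a value of probability 0.
   Outside of their union, the type of every vertex is reached from [i] along [child_rel]. *)
pose F k : set Om := if choice.pickle_inv k is Some (a, c) then
  (if q a.2 c == 0 then xi a @^-1` [set c] else set0) else set0.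
have [mxi qxi _] := iid.
have negF : P.-negligible (\bigcup_k F k).
  apply: negligible_bigcup => k; rewrite /F.
  case: choice.pickle_inv => [[a c]|]; last exact: negligible_set0.
  case: eqP => [qz|_]; last exact: negligible_set0.
  apply/negligibleP; first exact: mxi.
  by have := qxi a c; rewrite qz.
change (P ((fun w => gw_tree i (xi^~ w)) @^-1` has_label j) = 0%E).
apply/negligibleP.
  exact: (measurable_preimage (measurable_gw iid i) (@measurable_has_label n j)).
apply: negligibleS negF => w /= [u Tu uj].
have [w0|] := pselect (exists a, q a.2 (xi a w) = 0).
  have [a qa] := w0; exists (choice.pickle (a, xi a w)) => //.
  by rewrite /F choice.pickleK_inv qa eqxx.
move=> nw; case: nc.
have pos a : 0 < q a.2 (xi a w).
  by rewrite lt0r q0 andbT; apply/eqP => qa; apply: nw; exists a.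
have [f [[fh _ _] _ flab _]] := repr_class
  (PlaneTree (fun u => csize (xi (u, gw_type i (xi^~ w) u) w)) (gw_type i (xi^~ w))).
have := flab u Tu; rewrite [X in _ = X]uj => <-.
by apply: vertex_type_connect pos _; exact: fh Tu.
Qed.

Lemma connected_offspring nu : GW q nu -> strongly_connected nu -> connected_types q.
Proof.
move=> nuGW sc i j; apply: has_label_connect.
have [nui pos] := sc i j; move: pos.
rewrite (GW_from_law iid (nuGW i nui) (@measurable_has_label n j)) => pos.
by rewrite -[X in (_ < X)%E]fineK ?lte_fin // fin_num_measure //; exact: measurable_has_label.
Qed.

Section Weights.
Variables (mu : probability (trees n) R).
Hypotheses (wd : walk_defined mu) (rev : reversible mu) (sg : sim_g mu q).
Hypothesis conn : connected_types q.

Let sm := sim_g_star_mixture iid sg.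

Lemma root_prob_sum i :
  (\esum_(c in [set: counts n]) (fine (mu (root_event i c)))%:E = (root_prob mu i)%:E)%E.
Proof.
rewrite /root_prob fineK ?fin_num_measure //; last exact: measurable_root_is.
rewrite (@measure_esum _ _ _ mu (counts n) (@root_counts n)) //; last exact: measurable_root_is.
  apply: eq_esum => c _; rewrite fineK ?fin_num_measure //; exact: measurable_root_event.
by move=> c; exact: (determined_measurable (@determined_root_counts n [set c])).
Qed.

Lemma reversible_weights : exists p,
  [/\ stochastic p, multinomial_offspring q p,
      (forall i, 0 < root_prob mu i) /\ \sum_i root_prob mu i = 1,
      (forall i j, root_prob mu i * p i j = root_prob mu j * p j i) &
      forall i c, fine (mu (root_event i c)) = root_prob mu i * child_mix (p i) (q i) c].
Proof.
have tot : \sum_i root_prob mu i = 1.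
  apply: EFin_inj; rewrite -sumEFin -(probability_setT mu).
  rewrite (eq_bigr (fun i => mu (root_is i))) => [|i _]; last first.
    by rewrite fineK // fin_num_measure //; exact: measurable_root_is.
  rewrite (@measure_esum _ _ _ mu 'I_n.+1 (@root_label n) setT) //; last first.
    by move=> i; exact: measurable_root_is.
  by rewrite esum_ord //; apply: eq_bigr => i _; rewrite setTI.
have Vz i c : csize c = 0%N -> fine (mu (root_event i c)) = 0.
  move=> c0; rewrite [X in fine X](_ : _ = 0%E) //; apply/eqP.
  rewrite eq_le measure_ge0 andbT -wd; apply: le_measure; rewrite ?inE.
  - exact: measurable_root_event.
  - exact: (determined_measurable (h := 1) (fun s t e es => etrans (esym (tcode1_root_degree e)) es)).
  - by move=> t [_ /= tc]; rewrite -csize_root_counts tc.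
have [] := @root_weights n R q (fun i c => fine (mu (root_event i c))) (root_prob mu) q0
    _ (offspring_sum iid) root_prob_sum Vz tot conn.
- by move=> i c; rewrite fine_ge0.
- by move=> i j b b'; exact: (edge_balance _ _ _ _ sm rev).
by move=> p [sp mo mpos bal VE]; exists p; split.
Qed.

End Weights.

(** The product measure may be computed by sections in either order; exchanging the coordinates
    exchanges the sides of the edge. *)
Lemma edge_event_swap i j A B : measurable A -> measurable B ->
  (gw_law i \x gw_law j)%E (edge_event A B) = (gw_law j \x gw_law i)%E (edge_event B A).
Proof.
move=> mA mB; have mE := measurable_edge_event mA mB.
pose m' : {measure set (trees n * trees n) -> \bar R} := (gw_law i \x^ gw_law j)%E.
rewrite (@product_measure_unique _ _ _ _ _ _ _ m') // => [|C D mC mD]; last exact: product_measure2E.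
apply: eq_integral => t _ /=; congr (gw_law i _).
by apply/seteqP; split=> s; rewrite /ysection /xsection /= !inE => -[].
Qed.

Lemma product_branching i j (C : set (trees n * trees n)) : measurable C ->
  ((gw_law i \x gw_law j) C =
   \esum_(b in [set: counts n]) (q i b)%:E * (star_law i b \x gw_law j) C)%E.
Proof.
move=> mC; apply: (@integral_mixture R _ _ (counts n) (q i) (star_law i) (q0 i) (gw_law i)) => //.
- by move=> A mA; exact: gw_law_star.
- exact: measurable_fun_xsection.
Qed.

(** * The reversible measure built from p and a solution of detailed balance *)

Section Construction.
Variables (p : 'I_n.+1 -> 'I_n.+1 -> R) (x : 'I_n.+1 -> R).
Hypotheses (sp : stochastic p) (mo : multinomial_offspring q p).
Hypotheses (x0 : forall i, 0 < x i) (x1 : \sum_i x i = 1).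
Hypothesis bal : forall i j, x i * p i j = x j * p j i.

Let p0 i j : 0 <= p i j. Proof. by have [/(_ i j)/andP[]] := sp. Qed.

Let w (ic : 'I_n.+1 * counts n) : R := x ic.1 * child_mix (p ic.1) (q ic.1) ic.2.

Let w0 ic : 0 <= w ic.
Proof. by rewrite mulr_ge0 ?child_mix_ge0 // ltW. Qed.

Let w1 : (\esum_(ic in [set: 'I_n.+1 * counts n]) (w ic)%:E = 1)%E.
Proof.
rewrite (@esum_pair R n (counts n) (fun i c => (w (i, c))%:E)) => [|i c]; last by rewrite lee_fin.
rewrite -x1 -sumEFin; apply: eq_bigr => i _.
under eq_esum do rewrite /w /= EFinM.
rewrite esumZl //; [|exact: ltW|by move=> c _; rewrite lee_fin child_mix_ge0].
rewrite (@esum_child_mix _ _ (p i) (q i) setT setT) // (offspring_sum iid).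
by have [_ ->] := sp; rewrite !mule1.
Qed.

Let mu : probability (trees n) R := mixture (fun ic => star_law ic.1 ic.2) w0 w1.

Let muE A : (mu A = \esum_(ic in [set: 'I_n.+1 * counts n]) (w ic)%:E * star_law ic.1 ic.2 A)%E.
Proof. exact: mixtureE. Qed.

Let mu_setI i c A : (mu (A `&` root_event i c) = (w (i, c))%:E * star_law i c A)%E.
Proof.
rewrite muE (@esum_single _ _ _ (i, c)) /=.
- by rewrite star_law_setI.
- by rewrite mule_ge0 ?lee_fin.
- by move=> [i' c'] ne; rewrite star_law_setI0 ?mule0.
Qed.

Lemma constructed_star_mixture : star_mixture iid mu.
Proof.
move=> i c A mA; rewrite mu_setI; congr (_ * _)%E.
by rewrite -[root_event i c]setTI mu_setI probability_setT mule1.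
Qed.

Lemma constructed_walk_defined : walk_defined mu.
Proof.
rewrite /walk_defined muE esum1 // => -[i c] _ /=.
have [c0|c0] := eqVneq (csize c) 0%N.
  rewrite /w /child_mix big_pred0 ?mulr0 ?mul0e // => j; apply/negbTE; rewrite -eqn0Ngt.
  by move/eqP: c0; rewrite sum_nat_eq0 => /forallP /(_ j).
rewrite [X in (_ * X)%E](_ : _ = 0%E) ?mule0 //.
change (P (star xi i c @^-1` [set t | root_degree t = 0%N]) = 0%E).
rewrite (_ : _ @^-1` _ = set0) ?measure0 //; apply/seteqP; split=> v //=.
by rewrite root_degree_graft_fun => /eqP; rewrite (negbTE c0).
Qed.

(** [child_mix_multinomial] rewrites the weight of an edge of type j as x_i p_(i,j) q_i(c-e_j);
    after the substitution c = b + e_j, the sum over b rebuilds lam_i. *)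
Let flow_formula A B : measurable A -> measurable B ->
  (\int[mu]_(t in A) (walk R t B)%:E =
   \sum_i \sum_j (x i * p i j)%:E * (gw_law i \x gw_law j) (edge_event A B))%E.
Proof.
move=> mA mB; have mE := measurable_edge_event mA mB.
rewrite (@integral_mixture R _ _ _ w (fun ic => star_law ic.1 ic.2) w0 mu) //; last 3 first.
- by move=> C _; exact: muE.
- by apply: measurable_funTS; apply/measurable_EFinP; exact: measurable_walk.
- by move=> t _; rewrite lee_fin walk_ge0.
pose G i j b := ((star_law i b \x gw_law j) (edge_event A B))%E.
have G0 i j b : (0 <= G i j b)%E by exact: measure_ge0.
transitivity (\esum_(ic in [set: 'I_n.+1 * counts n]) \sum_(j | (0 < ic.2 j)%N)
    (x ic.1 * p ic.1 j * q ic.1 (remove_count ic.2 j))%:E * G ic.1 j (remove_count ic.2 j))%E.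
  apply: eq_esum => -[i c] _ /=; rewrite walk_star // ge0_sume_distrr; last first.
    by move=> j _; rewrite mule_ge0 ?lee_fin ?divr_ge0 //; exact: G0.
  rewrite [RHS]big_mkcond /=; apply: eq_bigr => j _.
  case: ifPn => [cj|]; last by rewrite -eqn0Ngt => /eqP ->; rewrite mul0r mul0e mule0.
  rewrite muleA -EFinM; congr (_%:E * _)%E.
  have := child_mix_multinomial (q0 i) (multinomial_offspring_mass q0 mo i) (remove_count c j) j.
  rewrite remove_countK // csize_remove_count // ffunE eqxx subn1.
  have c0 : (0 < csize c)%N by rewrite (leq_trans cj) // /csize (bigD1 j) //= leq_addr.
  rewrite !prednK // /w /= => e.
  have c0' : (csize c)%:R != 0 :> R by rewrite pnatr_eq0 -lt0n.
  transitivity (x i * (child_mix (p i) (q i) c * (c j)%:R) / (csize c)%:R); first by ring.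
  by rewrite e; field.
rewrite (@esum_pair R n (counts n) (fun i c => \sum_(j | (0 < c j)%N)
    (x i * p i j * q i (remove_count c j))%:E * G i j (remove_count c j))%E); last first.
  by move=> i c; apply: sume_ge0 => j _; rewrite mule_ge0 ?lee_fin ?mulr_ge0 // ltW.
apply: eq_bigr => i _.
rewrite (@esum_remove_count n R setT setT (fun j b => (x i * p i j * q i b)%:E * G i j b)%E) //; last first.
  by move=> j b; rewrite mule_ge0 ?lee_fin ?mulr_ge0 // ltW.
apply: eq_bigr => j _; rewrite product_branching //.
rewrite -esumZl; [|by rewrite mulr_ge0 // ltW|by move=> b _; rewrite mule_ge0 ?lee_fin].
by apply: eq_esum => b _; rewrite EFinM muleA.
Qed.

Lemma constructed_reversible : reversible mu.
Proof.
move=> A B mA mB; rewrite !flow_formula // exchange_big /=.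
by apply: eq_bigr => i _; apply: eq_bigr => j _; rewrite edge_event_swap // bal.
Qed.

Lemma exists_reversible : exists mu : probability (trees n) R,
  [/\ walk_defined mu, reversible mu & sim_g mu q].
Proof.
exists mu; split; [exact: constructed_walk_defined|exact: constructed_reversible|].
exact: (star_mixture_sim_g (iid := iid) constructed_star_mixture).
Qed.

End Construction.

End Model.
End Main.


Theorem theorem4p1 (R : realType) (n : nat)
    (q : 'I_n.+1 -> counts n -> R) (nu : probability (trees n) R)
    (nuGW : GW q nu) (nu_conn : strongly_connected nu) :
  ((exists mu : probability (trees n) R,
      [/\ walk_defined mu, reversible mu & sim_g mu q]) <->
   (exists p : 'I_n.+1 -> 'I_n.+1 -> R,
      [/\ stochastic p, multinomial_offspring q p & cycle_condition p])) /\
  (forall p : 'I_n.+1 -> 'I_n.+1 -> R,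
     stochastic p -> multinomial_offspring q p -> cycle_condition p ->
     (forall mu mu' : probability (trees n) R,
        [/\ walk_defined mu, reversible mu & sim_g mu q] ->
        [/\ walk_defined mu', reversible mu' & sim_g mu' q] ->
        forall A : set (trees n), measurable A -> mu A = mu' A) /\
     (forall mu : probability (trees n) R,
        [/\ walk_defined mu, reversible mu & sim_g mu q] ->
        [/\ (forall (i : 'I_n.+1) (d : nat),
               d.+1 \in sizes (root_law mu i) <-> d \in sizes (q i)),
            (forall (i : 'I_n.+1) (d : nat),
               size_prob (root_law mu i) d.+1 = size_prob (q i) d)
          & (forall x : 'I_n.+1 -> R,
               root_system p x <-> x = root_prob mu)])).
Proof.
(* The family [xi] contains offspring vectors for all types, so the model for type 0 serves for
   every type. *)
have [d [Om [P [xi [xi1 xi2 xi3 _]]]]] := nuGW ord0 (nu_conn ord0 ord0).1.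
have iid : iid_offspring q P xi by [].
have conn := connected_offspring iid nuGW nu_conn.
have q0 := offspring_ge0 iid.
have connp p : stochastic p -> multinomial_offspring q p ->
    forall i k, connect (fun i j => 0 < p i j) i k.
  move=> sp mo i k; apply: connect_sub (conn i k) => {}i {}k ik.
  by apply: connect1; exact: (child_rel_gt0 q0 sp mo).
split; [split|].
- move=> [mu [wd rev sg]].
  have [p [sp mo [mpos _] bal _]] := reversible_weights iid wd rev sg conn.
  by exists p; split=> //; exact: detailed_balance_cycle mpos bal.
- move=> [p [sp mo cyc]].
  have [x [x0 x1 bal]] := cycle_condition_root sp cyc (connp p sp mo).
  exact: (exists_reversible iid sp mo x0 x1 bal).
move=> p sp mo cyc.
have weights mu : [/\ walk_defined mu, reversible mu & sim_g mu q] ->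
    [/\ (forall i, 0 < root_prob mu i),
        (forall x : 'I_n.+1 -> R, root_system p x <-> x = root_prob mu) &
        forall i c, fine (mu (root_event i c)) = root_prob mu i * child_mix (p i) (q i) c].
  move=> [wd rev sg].
  have [p' [sp' mo' [mpos m1] bal VE]] := reversible_weights iid wd rev sg conn.
  (* The matrix extracted from [mu] is the given one; hence two reversible measures have the same
     root weights. *)
  have pE := multinomial_offspring_unique q0 sp sp' mo mo' conn; subst p'.
  by split=> // x; exact: (connect_root_unique x q0 sp mo conn mpos bal m1).
split.
  move=> mu mu' hmu hmu' A mA.
  have [_ rs V] := weights mu hmu; have [_ rs' V'] := weights mu' hmu'.
  have mE : root_prob mu = root_prob mu' by apply/(rs' _).1/(rs _).2.
  have [_ _ sg] := hmu; have [_ _ sg'] := hmu'.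
  rewrite (star_mixtureE (sim_g_star_mixture iid sg) mA).
  rewrite (star_mixtureE (sim_g_star_mixture iid sg') mA).
  apply: eq_esum => -[i c] _ /=; congr (_ * _)%E.
  have mR := measurable_root_event i c.
  by rewrite -[LHS]fineK ?fin_num_measure // -[RHS]fineK ?fin_num_measure // V V' mE.
move=> mu hmu; have [mpos rs V] := weights mu hmu.
have p0 i j : 0 <= p i j by have [/(_ i j)/andP[]] := sp.
have psum i : \sum_j p i j = 1 by have [_] := sp.
have rootE i c : root_law mu i c = child_mix (p i) (q i) c.
  rewrite /root_law /cprob setIC V /root_prob mulrAC divff ?mul1r //.
  by rewrite gt_eqF //; exact: mpos.
have rootE' i : root_law mu i = child_mix (p i) (q i) by apply/funext => c.
split=> [i d'|i d'|//].
- rewrite !inE; split=> [[c [cd]]|[b [bd qb]]].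
    rewrite rootE => cpos.
    have [j [cj qj]] : exists j, (0 < c j)%N /\ 0 < q i (remove_count c j).
      apply: contrapT => nj; move: cpos; rewrite /child_mix big1 ?ltxx // => j cj.
      apply/eqP; rewrite mulf_eq0; apply/orP; right; rewrite eq_le q0 andbT leNgt.
      by apply/negP => qj; apply: nj; exists j.
    by exists (remove_count c j); rewrite csize_remove_count // cd.
  have [j pj] : exists j, 0 < p i j.
    apply: contrapT => nj; have := psum i; rewrite big1 => [/eqP|j _].
      by rewrite eq_sym oner_eq0.
    by apply/eqP; rewrite eq_le p0 andbT leNgt; apply/negP => pj; apply: nj; exists j.
  exists (add_count b j); rewrite csize_add_count bd; split=> //.
  rewrite rootE /child_mix (bigD1 j) ?add_count_gt0 //= add_countK.
  by rewrite ltr_pwDl ?mulr_gt0 // sumr_ge0 // => k _; rewrite mulr_ge0.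
- by rewrite rootE' size_prob_child_mix.
Qed.
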